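(* Let $C>0$ be a constant and let $\mathcal P\subset\mathbb R^3$ be a set of $N\ge 1$ points which is proper 3-dimensional up to the constant factor $C$. All implied constants in the upper bounds (i)–(iii) depend only on $C$. (i) For every integer $k$ with $2\le k\le C\sqrt[3]{N}$, the number of $k$-rich lines of $\mathcal P$ is $O\bigl(N^2/k^4\bigr)$. (ii) More generally, for every integer $k$ with $2\le k\le C\sqrt[3]{N}$, the number of incidences between $\mathcal P$ and the $k$-rich lines of $\mathcal P$ is $O\bigl(N^2/k^3\bigr)$. (iii) For every set of $M\ge 1$ distinct straight lines in $\mathbb R^3$, the number $I$ of incidences between these lines and the $N$ points of $\mathcal P$ satisfies $$I=\begin{cases} O(M), & \text{if } N^2<M;\\ O(N^{1/2}M^{3/4}), & \text{if } N^{2/3}<M\le N^2;\\ O(N^{1/3}M), & \text{if } M\le N^{2/3}.\end{cases}$$ In other words, $I=O\bigl(\min\{M+N^{1/2}M^{3/4},\ N^{1/3}M\}\bigr)$. Moreover, these bounds give the best possible order of magnitude, in the following sense: there are absolute constants $C_0,c>0$ such that for every $N=n^3$ ($n\ge 1$ an integer) there is a set $\mathcal P\subset\mathbb R^3$ of $N$ points, proper 3-dimensional up to the constant factor $C_0$, such that for every integer $k$ with $2\le k\le N^{1/3}$ the number of $k$-rich lines of $\mathcal P$ is at least $cN^2/k^4$ and the number of incidences between $\mathcal P$ and its $k$-rich lines is at least $cN^2/k^3$; and such that for every integer $M\ge 1$ there are $M$ distinct straight lines in $\mathbb R^3$ having at least $c\min\{M+N^{1/2}M^{3/4},\,N^{1/3}M\}$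 incidences with $\mathcal P$.
   Context: A set of $N$ points in $\mathbb R^d$ is called proper $d$-dimensional up to a constant factor $C$ if it can be cut into singletons by at most $C\sqrt[d]{N}$ hyperplanes; that is, there is a set of at most $C\sqrt[d]{N}$ hyperplanes, none of which contains a point of the set, such that every open convex cell (connected component of the complement of the union of these hyperplanes) contains at most one point of the set. Here $d=3$ and the hyperplanes are planes. A $k$-rich line of $\mathcal P$ is a straight line containing at least $k$ points of $\mathcal P$. An incidence between a set of points and a set of lines is a pair (point, line) with the point lying on the line. *)

(* Defs.v *)
From mathcomp Require Import all_boot all_order all_algebra finmap.
From mathcomp Require Import all_classical all_reals all_analysis.

Set Implicit Arguments.
Unset Strict Implicit.
Unset Printing Implicit Defensive.

Import Order.TTheory GRing.Theory Num.Theory.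
Import numFieldNormedType.Exports.

Local Open Scope classical_set_scope.
Local Open Scope ring_scope.

Definition hyperplane (R : realType) (d : nat) (H : set 'rV[R]_d) : Prop :=
  exists (u : 'rV[R]_d) (c : R),
    u != 0 /\ H = [set x : 'rV[R]_d | \sum_(i < d) u 0 i * x 0 i = c].

Definition straight_line (R : realType) (d : nat) (L : set 'rV[R]_d) : Prop :=
  exists (a v : 'rV[R]_d), v != 0 /\ L = [set a + t *: v | t in [set: R]].

Definition proper_up_to (R : realType) (d : nat) (C : R) (P : {fset 'rV[R]_d})
    : Prop :=
  exists Hs : {fset set 'rV[R]_d},
    let U := ~` \bigcup_(H in [set` Hs]) H in
    [/\ #|` Hs|%:R <= C * (#|` P|%:R `^ d%:R^-1),
        forall H, H \in Hs -> hyperplane H,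
        forall H p, H \in Hs -> p \in P -> ~ H p
      & forall x, U x -> forall p q, p \in P -> q \in P ->
          connected_component U x p -> connected_component U x q -> p = q].

Definition rich_lines (R : realType) (d : nat) (k : nat)
    (P : {fset 'rV[R]_d}) : set (set 'rV[R]_d) :=
  [set L | straight_line L /\ (k <= #|` [fset p in P | p \in L]%fset|)%N].

Definition incidences (R : realType) (d : nat) (P : {fset 'rV[R]_d})
    (Ls : set (set 'rV[R]_d)) : set ('rV[R]_d * set 'rV[R]_d) :=
  [set pL | [/\ pL.1 \in P, Ls pL.2 & pL.2 pL.1]].

(* [fset_set A] is empty when [A] is infinite, so an upper bound on [ncard A]
   is only meaningful together with [finite_set A]. *)
Definition ncard (T : choiceType) (A : set T) : nat := #|` fset_set A|.

(* Main.v *)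
(* Upper bounds. Along a [k]-rich line consecutive points are separated by
   [O(h / k)] of the [h] cutting planes on average, so rich lines are charged to
   the pairs of points separated by at most [D = O(h / k)] planes, and everything
   follows from the fact that there are only [O(h^3 D^3)] such pairs. By
   Clarkson-Shor sampling with density [1 / D], applied to a vertex of the cell of
   each of the two points, this reduces to counting pairs of vertices of a common
   cell of an arrangement of [r] planes. A vertex is extremal in a facet of the
   cell, so it is enough that the number of triples (cell, wall, wall) is [O(r^3)].
   Deleting planes one at a time reduces that count to its analogue in the plane.
   There, among the cells in one quadrant of two lines that touch both lines, the
   farthest one is charged to the two lines, and every other one is the only cell
   of its kind for its first wall and the side on which the second one lies.

   Lower bounds. The grid [{0..n-1}^3] is cut by [3 n] axis-parallel planes, and the
   lines in primitive directions of size at most [n / (2 k)] are [k]-rich. *)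

Require Import Defs.
From mathcomp Require Import all_boot all_order all_algebra finmap.
From mathcomp Require Import all_classical all_reals all_analysis.
From mathcomp Require Import ring lra zify.

Set Implicit Arguments.
Unset Strict Implicit.
Unset Printing Implicit Defensive.

Import Order.TTheory GRing.Theory Num.Theory.
Import numFieldNormedType.Exports.

Local Open Scope ring_scope.

(** * Affine functionals on three-space *)

(** The exponent in [O(h^3 D^3)] comes from the six planes through two simple vertices. With density
    [1 / D], all six enter the sample and the at most [D] other separators stay out with probability
    at least a constant times [D^-6]; the two vertices then lie on a common closed cell of the
    sample. A sample of about [h / D] planes has only [O((h / D)^3)] such pairs, which leaves
    [O(h^3 D^3)] close pairs, and [D = O(h / k)] with [h = O(N^(1/3))] gives [N^2 / k^3].

    The obstacle is that pairs of vertices of one cell are counted: a total of [O(r^3)] vertices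
    does not suffice, because squares of cell sizes are summed. Naming a vertex by a facet and one
    bit passes to pairs of facets, for which deletion of planes works.

    Simple vertices need general position, while the given planes may be parallel or concurrent.
    Each form [f] is replaced by [x f + m], with [m] taken from the moment curve and [x] large,
    which keeps its sign at all of the finitely many points. These signs are all that remains of the
    topological cells. *)

Section Vectors.
Variable R : realType.
Implicit Types (u v w x y e : 'rV[R]_3) (f : 'rV[R]_3 * R) (t : R).

Definition dot u x : R := \sum_(i < 3) u 0 i * x 0 i.

Definition ev f x : R := dot f.1 x - f.2.

Definition row3 (a b c : R) : 'rV[R]_3 := \row_(i < 3) [:: a; b; c]`_i.

(** The first coordinate of [cross u v]. When it is nonzero, coordinate [0] is not constant on the
    line where planes with normals [u] and [v] meet, so it can serve as a height on edges. *)
Definition det2 u v : R := u 0 1 * v 0 2%:R - u 0 2%:R * v 0 1.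

Definition cross u v : 'rV[R]_3 :=
  row3 (u 0 1 * v 0 2%:R - u 0 2%:R * v 0 1)
       (u 0 2%:R * v 0 0 - u 0 0 * v 0 2%:R)
       (u 0 0 * v 0 1 - u 0 1 * v 0 0).

Definition det3 u v w : R := dot (cross u v) w.

Lemma dotE u x : dot u x = u 0 0 * x 0 0 + u 0 1 * x 0 1 + u 0 2%:R * x 0 2%:R.
Proof.
rewrite /dot !big_ord_recr big_ord0 /= add0r.
by congr (u 0 _ * x 0 _ + u 0 _ * x 0 _ + u 0 _ * x 0 _); apply/val_inj.
Qed.

Lemma row3E a b c :
  (row3 a b c 0 0 = a) * (row3 a b c 0 1 = b) * (row3 a b c 0 2%:R = c).
Proof. by rewrite !mxE. Qed.

Lemma row3_inj x y :
  x 0 0 = y 0 0 -> x 0 1 = y 0 1 -> x 0 2%:R = y 0 2%:R -> x = y.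
Proof.
move=> e0 e1 e2; apply/rowP => -[[|[|[|//]]] i3].
- by have -> : Ordinal i3 = 0 by apply/val_inj.
- by have -> : Ordinal i3 = 1 by apply/val_inj.
- by have -> : Ordinal i3 = 2%:R by apply/val_inj.
Qed.

Lemma dotDr u x y : dot u (x + y) = dot u x + dot u y.
Proof. by rewrite !dotE !mxE; ring. Qed.

Lemma dotZr u t x : dot u (t *: x) = t * dot u x.
Proof. by rewrite !dotE !mxE; ring. Qed.

Lemma dotBr u x y : dot u (x - y) = dot u x - dot u y.
Proof. by rewrite !dotE !mxE; ring. Qed.

Lemma ev_move f x t w : ev f (x + t *: w) = ev f x + t * dot f.1 w.
Proof. by rewrite /ev dotDr dotZr; ring. Qed.

Lemma evB f x y : dot f.1 (x - y) = ev f x - ev f y.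
Proof. by rewrite /ev dotBr; ring. Qed.

Lemma ev_conv f t x y :
  ev f ((1 - t) *: x + t *: y) = (1 - t) * ev f x + t * ev f y.
Proof. by rewrite /ev dotDr !dotZr; ring. Qed.

Lemma dot_crossl u v : dot u (cross u v) = 0.
Proof. by rewrite dotE !row3E; ring. Qed.

Lemma dot_crossr u v : dot v (cross u v) = 0.
Proof. by rewrite dotE !row3E; ring. Qed.

Lemma dot_cross u v w : dot w (cross u v) = det3 u v w.
Proof. by rewrite /det3 !dotE !row3E; ring. Qed.

(** Cramer's rule: weighting the three equations by a coordinate of [cross v w], [cross w u] and
    [cross u v] isolates that coordinate of [x], times the determinant. *)
Lemma det3_inj u v w x : det3 u v w != 0 ->
  dot u x = 0 -> dot v x = 0 -> dot w x = 0 -> x = 0.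
Proof.
move=> d0; rewrite !dotE => hu hv hw.
have key (a : R) : det3 u v w * a = 0 -> a = 0.
  by move/eqP; rewrite mulf_eq0 (negPf d0) => /eqP.
have [e0 e1 e2] : [/\ det3 u v w * x 0 0 = 0, det3 u v w * x 0 1 = 0
    & det3 u v w * x 0 2%:R = 0].
  rewrite /det3 dotE !row3E; split.
  - transitivity ((v 0 1 * w 0 2%:R - v 0 2%:R * w 0 1) *
      (u 0 0 * x 0 0 + u 0 1 * x 0 1 + u 0 2%:R * x 0 2%:R)
     + (w 0 1 * u 0 2%:R - w 0 2%:R * u 0 1) *
      (v 0 0 * x 0 0 + v 0 1 * x 0 1 + v 0 2%:R * x 0 2%:R)
     + (u 0 1 * v 0 2%:R - u 0 2%:R * v 0 1) *
      (w 0 0 * x 0 0 + w 0 1 * x 0 1 + w 0 2%:R * x 0 2%:R)); first by ring.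
    by rewrite hu hv hw; ring.
  - transitivity ((v 0 2%:R * w 0 0 - v 0 0 * w 0 2%:R) *
      (u 0 0 * x 0 0 + u 0 1 * x 0 1 + u 0 2%:R * x 0 2%:R)
     + (w 0 2%:R * u 0 0 - w 0 0 * u 0 2%:R) *
      (v 0 0 * x 0 0 + v 0 1 * x 0 1 + v 0 2%:R * x 0 2%:R)
     + (u 0 2%:R * v 0 0 - u 0 0 * v 0 2%:R) *
      (w 0 0 * x 0 0 + w 0 1 * x 0 1 + w 0 2%:R * x 0 2%:R)); first by ring.
    by rewrite hu hv hw; ring.
  - transitivity ((v 0 0 * w 0 1 - v 0 1 * w 0 0) *
      (u 0 0 * x 0 0 + u 0 1 * x 0 1 + u 0 2%:R * x 0 2%:R)
     + (w 0 0 * u 0 1 - w 0 1 * u 0 0) *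
      (v 0 0 * x 0 0 + v 0 1 * x 0 1 + v 0 2%:R * x 0 2%:R)
     + (u 0 0 * v 0 1 - u 0 1 * v 0 0) *
      (w 0 0 * x 0 0 + w 0 1 * x 0 1 + w 0 2%:R * x 0 2%:R)); first by ring.
    by rewrite hu hv hw; ring.
by apply: row3_inj; rewrite !mxE; apply: key.
Qed.

Lemma det3_dual u v w : det3 u v w != 0 ->
  exists e, [/\ dot u e = 0, dot v e = 0 & dot w e = 1].
Proof.
move=> d0; exists ((det3 u v w)^-1 *: cross u v).
by rewrite !dotZr dot_crossl dot_crossr dot_cross !mulr0 mulVf.
Qed.

Definition sg (b : bool) : R := if b then 1 else -1.

Lemma sgM b (a : R) : (0 < sg b * a) = (if b then 0 < a else a < 0).
Proof. by case: b; rewrite /sg ?mul1r // mulN1r oppr_gt0. Qed.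

Lemma sg_neq0 b : sg b != 0.
Proof. by case: b; rewrite /sg ?oner_eq0 // oppr_eq0 oner_eq0. Qed.

Lemma sg_inj b b' (a : R) : 0 < sg b * a -> 0 < sg b' * a -> b = b'.
Proof. by rewrite !sgM; case: b b' => -[] //; lra. Qed.

Lemma sg_neq b b' (a : R) : b != b' -> 0 < sg b' * a -> sg b * a < 0.
Proof. by case: b b' => -[] // _; rewrite /sg; lra. Qed.

Lemma sg_total (a : R) : a != 0 -> 0 < sg (0 < a) * a.
Proof. by rewrite neq_lt sgM => /orP[h|->] //; rewrite ltNge (ltW h). Qed.

Lemma small_eps (T : finType) (A : {set T}) (a m : T -> R) :
  (forall i, i \in A -> 0 < a i) ->
  exists2 t, 0 < t & forall i, i \in A -> 0 < a i + t * m i.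
Proof.
have [k] := ubnP #|A|; elim: k => // k IH in A *.
have [->|[i iA]] := set_0Vmem A; first by exists 1 => // i; rewrite inE.
rewrite (cardsD1 i) iA add1n ltnS => lek pos.
have [j|t t0 ht] := IH _ lek; first by rewrite !inE => /andP[_ /pos].
have pai := pos i iA.
(* The [1 +] keeps the step strictly below [a i / |m i|] and covers [m i = 0]. *)
have d0 : 0 < a i / (1 + `|m i|) by rewrite divr_gt0 // ltr_wpDr.
exists (Num.min t (a i / (1 + `|m i|))); first by rewrite lt_min t0.
move=> j jA; have [->|ji] := eqVneq j i; last first.
  have pj := pos j jA.
  have := ht j; rewrite !inE ji jA => /(_ isT) h.
  have [m0|m0] := leP 0 (m j).
    by rewrite ltr_pwDl // mulr_ge0 // le_min !ltW.
  apply: lt_le_trans h _; rewrite lerD2l; apply: ler_wnM2r; first exact: ltW.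
    by rewrite ge_min lexx.
have [m0|m0] := leP 0 (m i).
  by rewrite ltr_pwDl // mulr_ge0 // le_min !ltW.
have : a i / (1 + `|m i|) * m i <= Num.min t (a i / (1 + `|m i|)) * m i.
  by apply: ler_wnM2r; [exact: ltW|rewrite ge_min lexx orbT].
rewrite ltr0_norm // => h; rewrite -subr_gt0 subr0.
apply: lt_le_trans (_ : a i + a i / (1 - m i) * m i <= _); last by rewrite lerD2l.
have m1 : 0 < 1 - m i by lra.
have -> : a i + a i / (1 - m i) * m i = a i / (1 - m i) by field; lra.
by rewrite divr_gt0.
Qed.

End Vectors.

(** * Cells and walls of an arrangement *)

Lemma setD1_notin (I : finType) (i : I) (t : {set I}) : i \notin t -> t :\ i = t.
Proof.
move=> it; apply/finset.setP => j; rewrite !inE.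
by case: eqP => // ->; rewrite (negPf it).
Qed.

(* Deleting [i] merges two sets of [A] only when [A] contains both extensions of
   a set; for cells this means that the plane [i] cuts the merged cell. *)
Lemma split_card (I : finType) (A B C : {set {set I}}) (i : I) :
  (forall s : {set I}, s \in A -> s :\ i \in B) ->
  (forall t : {set I}, i \notin t -> t \in A -> i |: t \in A -> t \in C) ->
  (#|A| <= #|B| + #|C|)%N.
Proof.
move=> AB AC.
pose A1 := [set s in A | i \in s]; pose A0 := [set s in A | i \notin s].
pose A1' := [set s :\ i | s in A1].
have -> : #|A| = (#|A0| + #|A1|)%N.
  rewrite -(cardsID A1 A) addnC; congr (_ + _)%N; apply: eq_card => s;
    by rewrite !inE; case: (s \in A); case: (i \in s).
have <- : #|A1'| = #|A1|.
  apply: card_in_imset => s t; rewrite !inE => /andP[_ si] /andP[_ ti] st.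
  by rewrite -(finset.setD1K si) st finset.setD1K.
rewrite -(cardsUI A0 A1') leq_add //; apply: subset_leq_card; apply/fintype.subsetP => t.
  case/finset.setUP => [|/imsetP[s]]; rewrite inE => /andP[tA ti].
    by have := AB _ tA; rewrite setD1_notin.
  by move=> ->; apply: AB.
case/finset.setIP; rewrite inE => /andP[tA ti] /imsetP[s].
rewrite inE => /andP[sA si] ts.
by apply: AC => //; rewrite ts finset.setD1K.
Qed.

Section Cells.
Variables (R : realType) (I : finType) (F : I -> 'rV[R]_3 * R).
Implicit Types (s Q : {set I}) (J : seq I) (x y : 'rV[R]_3).

(* A cell of the arrangement [Q] is encoded by the set [s] of the planes on whose
   positive side it lies. *)
Definition ok s i x : bool := 0 < sg R (i \in s) * ev (F i) x.

(** The planes in [J] cut the ambient space down to a flat, so that one induction treats space,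
    planes, lines and points alike. *)
Definition flat J x : Prop := forall j, j \in J -> ev (F j) x = 0.

Definition cells J Q : {set {set I}} := [set s : {set I} |
  (s \subset Q) && `[< exists x, flat J x /\ forall i, i \in Q -> ok s i x >]].

Lemma cellsP J Q s : reflect
  (s \subset Q /\ exists x, flat J x /\ forall i, i \in Q -> ok s i x)
  (s \in cells J Q).
Proof.
by rewrite inE; apply: (iffP andP) => -[h1 h2]; split => //; apply/asboolP.
Qed.

Lemma ok_ev0 s i x : ev (F i) x = 0 -> ok s i x = false.
Proof. by rewrite /ok => ->; rewrite mulr0 ltxx. Qed.

Lemma ok_setD1 s i j x : j != i -> ok (s :\ i) j x = ok s j x.
Proof. by move=> ji; rewrite /ok !inE ji. Qed.

Lemma ok_setU1 s i j x : j != i -> ok (i |: s) j x = ok s j x.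
Proof. by move=> ji; rewrite /ok !inE (negPf ji). Qed.

Lemma ok_mem s s' i x : ok s i x -> ok s' i x -> (i \in s) = (i \in s').
Proof. exact: sg_inj. Qed.

Lemma ok_eq s s' Q x : s \subset Q -> s' \subset Q ->
  (forall i, i \in Q -> ok s i x) -> (forall i, i \in Q -> ok s' i x) -> s = s'.
Proof.
move=> /fintype.subsetP sQ /fintype.subsetP s'Q ks ks'; apply/finset.setP => i.
have [iQ|iQ] := boolP (i \in Q); first by apply: ok_mem (ks i iQ) (ks' i iQ).
by apply/idP/idP => [/sQ|/s'Q]; rewrite (negPf iQ).
Qed.

Lemma cross_point i x y : ev (F i) x < 0 -> 0 < ev (F i) y ->
  exists t, [/\ 0 < t, t < 1 & ev (F i) ((1 - t) *: x + t *: y) = 0].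
Proof.
move=> hx hy; exists (ev (F i) x / (ev (F i) x - ev (F i) y)).
have h : ev (F i) x - ev (F i) y < 0 by lra.
rewrite ev_conv; split.
- by rewrite -mulrNN -invrN divr_gt0 // oppr_gt0.
- by rewrite ltr_ndivrMr // mul1r; lra.
- by field; lra.
Qed.

Lemma ok_conv s i x y t : 0 < t -> t < 1 -> ok s i x -> ok s i y ->
  ok s i ((1 - t) *: x + t *: y).
Proof.
rewrite /ok => t0 t1 hx hy.
have -> : sg R (i \in s) * ev (F i) ((1 - t) *: x + t *: y)
  = (1 - t) * (sg R (i \in s) * ev (F i) x) + t * (sg R (i \in s) * ev (F i) y).
  by rewrite ev_conv; ring.
by rewrite addr_gt0 // mulr_gt0 ?subr_gt0.
Qed.

Lemma flat_conv J x y t : flat J x -> flat J y -> flat J ((1 - t) *: x + t *: y).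
Proof. by move=> hx hy j jJ; rewrite ev_conv hx // hy // !mulr0 addr0. Qed.

Lemma flat_cons i J x : ev (F i) x = 0 -> flat J x -> flat (i :: J) x.
Proof. by move=> hi hJ j; rewrite inE => /predU1P[->//|/hJ]. Qed.

(** Two cells merged by deleting [i] contain points on opposite sides of [i]; the segment between
    these meets [i] inside the merged cell, which is thus also a cell of the section by [i]. *)
Lemma cells_split J Q i : i \in Q ->
  (#|cells J Q| <= #|cells J (Q :\ i)| + #|cells (i :: J) (Q :\ i)|)%N.
Proof.
move=> iQ; apply: (@split_card _ _ _ _ i) => [s|t it].
  move/cellsP => [sQ [x [hx ks]]]; apply/cellsP; split; first exact: finset.setSD.
  by exists x; split => // j; rewrite !inE => /andP[ji jQ]; rewrite ok_setD1 ?ks.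
move=> /cellsP[tQ [x [hx kx]]] /cellsP[_ [y [hy ky]]]; apply/cellsP; split.
  by rewrite subsetD1 tQ.
have {}hix : ev (F i) x < 0.
  by have := kx _ iQ; rewrite /ok (negPf it) /sg mulN1r oppr_gt0.
have {}hiy : 0 < ev (F i) y.
  by have := ky _ iQ; rewrite /ok !inE eqxx /sg mul1r.
have [u [u0 u1 hu]] := cross_point hix hiy.
exists ((1 - u) *: x + u *: y); split.
  by apply: flat_cons => //; apply: flat_conv.
move=> j; rewrite !inE => /andP[ji jQ]; apply: ok_conv => //; first exact: kx.
by have := ky _ jQ; rewrite ok_setU1.
Qed.

Hypothesis gp3 : forall i j k, uniq [:: i; j; k] ->
  det3 (F i).1 (F j).1 (F k).1 != 0.

Lemma flat3_inj i j k x y : uniq [:: i; j; k] ->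
  flat [:: i; j; k] x -> flat [:: i; j; k] y -> x = y.
Proof.
move=> u hx hy; apply/eqP; rewrite -subr_eq0; apply/eqP.
by apply: (det3_inj (gp3 u)); rewrite evB hx ?hy ?subrr // !inE eqxx ?orbT.
Qed.

(** With [n = #|Q|] and [e = 3 - size J], deletion reduces the bound to [n^e + n^(e-1) <= (n+1)^e].
    For [e = 0] the flat is at most one point, which has one sign vector. *)
Lemma card_cells J Q : uniq J -> (size J <= 3)%N ->
  (#|cells J Q| <= (#|Q|).+1 ^ (3 - size J))%N.
Proof.
have [n] := ubnP #|Q|; elim: n => // n IH in J Q *; rewrite ltnS => leQ uJ sJ.
have [->|[i iQ]] := set_0Vmem Q.
  rewrite cards0 exp1n -(cards1 (finset.set0 : {set I})); apply: subset_leq_card.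
  by apply/fintype.subsetP => s /cellsP[+ _]; rewrite finset.subset0 inE.
(* A plane containing the flat admits no strict sign there, so there are no cells. *)
have [iJ|iJ] := boolP (i \in J).
  rewrite (_ : cells J Q = finset.set0) ?cards0 //.
  apply/finset.setP => s; rewrite [RHS]inE.
  by apply/negP => /cellsP[_ [x [hx /(_ _ iQ)]]]; rewrite ok_ev0 // hx.
rewrite leq_eqVlt in sJ; case/orP: sJ => [/eqP sJ|sJ].
  rewrite sJ subnn expn0; apply/card_le1_eqP => s s' /cellsP[sQ [x [hx ks]]].
  move=> /cellsP[s'Q [x' [hx' ks']]].
  case: J sJ uJ hx hx' {iJ} => [|a [|b [|c [|//]]]] // _ u hx hx'.
  rewrite (flat3_inj u hx' hx) in ks'.
  by apply/esym; apply: ok_eq sQ s'Q ks ks'.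
apply: leq_trans (cells_split _ iQ) _.
have Qi : #|Q| = (#|Q :\ i|).+1 by rewrite (cardsD1 i) iQ.
have lt : (#|Q :\ i| < n)%N by rewrite -Qi.
have /= h1 := IH J _ lt uJ (ltnW sJ).
have /= h2 := IH (i :: J) (Q :\ i) lt.
rewrite /= iJ uJ in h2; have {}h2 := h2 isT sJ.
apply: leq_trans (leq_add h1 h2) _; rewrite -Qi.
have -> : (3 - size J)%N = (3 - (size J).+1).+1 by lia.
have : (#|Q| ^ (3 - (size J).+1) <= #|Q|.+1 ^ (3 - (size J).+1))%N.
  by case: (3 - _)%N => // e; rewrite leq_exp2r.
by rewrite !expnS; set u := (#|Q| ^ _)%N; set v := (#|Q|.+1 ^ _)%N; nia.
Qed.

End Cells.

(* Two lines through the points [-A1/a1 >= -A2/a2] of the axis [s = 0], both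
   seen from a region that a third line [AL + t aL + s bL = 0] cuts off on the
   right: the point at [s3] on the first line would lie in the triangle spanned
   by the two apexes and the point at [s2], where the third form is positive. *)
Lemma hidden_wall (R : realFieldType)
    (A1 a1 b1 A2 a2 b2 AL aL bL t' t2 s2 t3 s3 : R) :
  0 < A1 -> 0 < A2 -> 0 < AL -> 0 < a1 -> 0 < a2 -> A1 * a2 <= A2 * a1 ->
  0 < t' -> AL + t' * aL < 0 ->
  0 < s2 -> A2 + t2 * a2 + s2 * b2 = 0 -> 0 < A1 + t2 * a1 + s2 * b1 ->
  0 < AL + t2 * aL + s2 * bL ->
  0 < s3 -> A1 + t3 * a1 + s3 * b1 = 0 -> 0 < A2 + t3 * a2 + s3 * b2 ->
  AL + t3 * aL + s3 * bL < 0 -> False.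
Proof.
move=> A1p A2p ALp a1p a2p ord t'p Lx' s2p y2 y21 y2L s3p y3 y32 y3L.
have a1n : a1 != 0 by rewrite gt_eqF.
have a2n : a2 != 0 by rewrite gt_eqF.
pose p1 := A1 / a1; pose p2 := A2 / a2; pose q1 := b1 / a1; pose q2 := b2 / a2.
have A1E : A1 = a1 * p1 by rewrite /p1; field.
have A2E : A2 = a2 * p2 by rewrite /p2; field.
have b1E : b1 = a1 * q1 by rewrite /q1; field.
have b2E : b2 = a2 * q2 by rewrite /q2; field.
have p1p : 0 < p1 by rewrite divr_gt0.
have p2p : 0 < p2 by rewrite divr_gt0.
have d0 : 0 <= p2 - p1 by rewrite subr_ge0 ler_pdivrMr // mulrAC ler_pdivlMr.
have t2E : t2 = - p2 - s2 * q2.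
  by apply: (mulfI a2n); rewrite -[LHS]subr0 -y2 A2E b2E; ring.
have t3E : t3 = - p1 - s3 * q1.
  by apply: (mulfI a1n); rewrite -[LHS]subr0 -y3 A1E b1E; ring.
(* The two lines cross at height [(p2 - p1) / (q1 - q2)]; [h3] and [h2] place it above [s3] and
   below [s2]. *)
have h3 : s3 * (q1 - q2) < p2 - p1.
  rewrite -subr_gt0 -(pmulr_rgt0 _ a2p).
  by move: y32; rewrite A2E b2E t3E; congr (_ < _); ring.
have h2 : p2 - p1 < s2 * (q1 - q2).
  rewrite -subr_gt0 -(pmulr_rgt0 _ a1p).
  by move: y21; rewrite A1E b1E t2E; congr (_ < _); ring.
have e0 : 0 < q1 - q2 by rewrite -(pmulr_rgt0 _ s2p); lra.
have aL0 : aL < 0.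
  by rewrite -(pmulr_rlt0 _ t'p); lra.
move: y2L y3L; rewrite t2E t3E => y2L y3L.
have c1 : bL - aL * q1 < 0.
  rewrite -(pmulr_rlt0 _ s3p).
  have : 0 < - aL * p1 by rewrite mulr_gt0 // oppr_gt0.
  by lra.
(* The third form at the crossing point, times [q1 - q2], computed along the first line: it
   decreases there and is already negative at [s3]. *)
have phi : (q1 - q2) * (AL - aL * p1) + (p2 - p1) * (bL - aL * q1) < 0.
  have : 0 < (p2 - p1 - s3 * (q1 - q2)) * (- (bL - aL * q1)).
    by rewrite mulr_gt0 ?subr_gt0 ?oppr_gt0.
  have : 0 < (q1 - q2) * - (AL + (- p1 - s3 * q1) * aL + s3 * bL).
    by rewrite mulr_gt0 // oppr_gt0.
  by lra.
(* The same value computed along the second line, where the form is positive both on the axis and at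
   [s2], hence in between. *)
have psi : 0 < (q1 - q2) * (AL - aL * p2) + (p2 - p1) * (bL - aL * q2).
  have [c2|c2] := leP 0 (bL - aL * q2).
    apply: ltr_pwDl; last exact: mulr_ge0.
    rewrite mulr_gt0 // -mulNr ltr_wpDr // ltW // mulr_gt0 // oppr_gt0 //.
  have : 0 < (s2 * (q1 - q2) - (p2 - p1)) * (- (bL - aL * q2)).
    by rewrite mulr_gt0 ?subr_gt0 ?oppr_gt0.
  have : 0 < (q1 - q2) * (AL + (- p2 - s2 * q2) * aL + s2 * bL).
    by rewrite mulr_gt0.
  by lra.
have : (q1 - q2) * (AL - aL * p2) + (p2 - p1) * (bL - aL * q2)
  = (q1 - q2) * (AL - aL * p1) + (p2 - p1) * (bL - aL * q1) by ring.
by lra.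
Qed.

(** * Walls, and pairs of walls of a cell in a plane section *)

Section PlaneSections.
Variables (R : realType) (I : finType) (F : I -> 'rV[R]_3 * R).
Hypothesis gp3 : forall i j k, uniq [:: i; j; k] ->
  det3 (F i).1 (F j).1 (F k).1 != 0.
Implicit Types (s Q : {set I}) (J : seq I) (x y : 'rV[R]_3).

(** The side of [H] itself is left free, so that one point of a facet is a witness for both cells
    that share it. *)
Definition wallpt J Q H s x : Prop :=
  [/\ flat F J x, ev (F H) x = 0 & forall i, i \in Q -> i != H -> ok F s i x].

Definition walls J Q H : {set {set I}} := [set s : {set I} |
  (s \subset Q) && `[< exists x, wallpt J Q H s x >]].

Definition walls2 J Q H G : {set {set I}} := walls J Q H :&: walls J Q G.

Lemma wallsP J Q H s : reflect (s \subset Q /\ exists x, wallpt J Q H s x)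
  (s \in walls J Q H).
Proof.
by rewrite inE; apply: (iffP andP) => -[h1 h2]; split => //; apply/asboolP.
Qed.

(** A wall in [H] is a cell of the section by [H], and it borders two cells: hence the factor 2. *)
Lemma card_walls J Q H : H \in Q -> uniq (H :: J) -> (size J < 3)%N ->
  (#|walls J Q H| <= 2 * #|Q| ^ (2 - size J))%N.
Proof.
move=> HQ uJ sJ.
have h : (#|walls J Q H| <= #|cells F (H :: J) (Q :\ H)| + #|cells F (H :: J) (Q :\ H)|)%N.
  have sub s : s \in walls J Q H -> s :\ H \in cells F (H :: J) (Q :\ H).
    move=> /wallsP[sQ [x [xJ xH ks]]]; apply/cellsP; split.
      exact: finset.setSD.
    exists x; split; first exact: flat_cons.
    by move=> i; rewrite !inE => /andP[iH iQ]; rewrite ok_setD1 ?ks.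
  by apply: (@split_card _ _ _ _ H) => // t Ht /sub; rewrite setD1_notin.
apply: leq_trans h _; rewrite addnn -mul2n leq_mul2l /=.
have := card_cells gp3 (Q :\ H) uJ sJ.
by rewrite /= subSS (cardsD1 H Q) HQ.
Qed.

(** Coordinates of the plane [F j = 0] adapted to the line [H]: [t] runs along the line, and the
    second coordinate is the value of [F H], signed so as to be positive on the chosen side. [G]
    supplies a third independent normal. *)
Lemma plane_chart j H G b x : uniq [:: j; H; G] ->
  flat F [:: j] x -> ev (F H) x = 0 ->
  exists e2, forall y, flat F [:: j] y -> exists t,
    y = x + t *: cross (F j).1 (F H).1 + (sg R b * ev (F H) y) *: e2.
Proof.
move=> u xj xH.
have d0 := gp3 u.
have [|e [ej eG eH]] := det3_dual (_ : det3 (F j).1 (F G).1 (F H).1 != 0).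
  apply: gp3; move: u; rewrite /= !inE !negb_or !andbT => /andP[/andP[-> ->]].
  by rewrite eq_sym => ->.
exists (sg R b *: e) => y yj.
exists (dot (F G).1 (y - x - ev (F H) y *: e) / det3 (F j).1 (F H).1 (F G).1).
apply/eqP; rewrite -subr_eq0; apply/eqP.
have sg2 : sg R b * sg R b = 1 by case: (b); rewrite /sg ?mulr1 // mulrNN mulr1.
rewrite scalerA mulrAC sg2 mul1r.
have evj z : flat F [:: j] z -> ev (F j) z = 0 by apply; rewrite inE.
apply: (det3_inj d0); rewrite opprD addrA !dotBr dotDr !dotZr.
- rewrite ej dot_crossl -addrA; rewrite -[dot _ x]addr0 -[dot _ y]addr0.
  by have := evB (F j) y x; rewrite !evj // dotBr; lra.
- rewrite eH dot_crossr; have := evB (F H) y x; rewrite xH dotBr; lra.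
- by rewrite eG dot_cross divfK //; ring.
Qed.


(* In the plane [F j = 0], another cell of the same quadrant of the lines [H] and
   [G] touches both of them, farther from their intersection than [s]. *)
Definition has_farther j Q H G s : Prop := exists s' x x',
  [/\ s != s', s' \subset Q, (H \in s) = (H \in s') & (G \in s) = (G \in s')] /\
  [/\ wallpt [:: j] Q H s x, wallpt [:: j] Q H s' x',
      exists y, wallpt [:: j] Q G s' y &
      sg R (G \in s) * ev (F G) x < sg R (G \in s) * ev (F G) x'].

(** [A G / |g G|] is the signed distance, in multiples of [e], from [x0] along the line [H] to its
    crossing with [G]. So [G1] crosses [H] no farther away than [G2], on the same side, and a plane
    separating [s] from a farther cell at [G1] would contradict [hidden_wall]. *)
Lemma farther_inj_le j Q H G1 G2 s x0 : j \notin Q ->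
  G1 != H -> G2 != H -> G1 != G2 -> H \in Q -> G1 \in Q -> G2 \in Q ->
  s \subset Q -> (exists y, wallpt [:: j] Q G2 s y) ->
  has_farther j Q H G1 s ->
  let e := cross (F j).1 (F H).1 in
  let g G := sg R (G \in s) * dot (F G).1 e in
  let A G := sg R (G \in s) * ev (F G) x0 in
  flat F [:: j] x0 -> ev (F H) x0 = 0 ->
  (0 < g G1) = (0 < g G2) ->
  A G1 * `|g G2| <= A G2 * `|g G1| -> False.
Proof.
move=> jQ G1H G2H G12 HQ G1Q G2Q sQ [y2 [y2j y20 ky2]].
move=> [s' [x [x' [[ss' s'Q Hs' Gs'] [[xj xH kx] [x'j x'H kx'] [y3 [y3j y30 ky3]] lt]]]]].
move=> e g A x0j x0H side ord.
have jN G : G \in Q -> j != G by move=> GQ; apply: contraNneq jQ => ->.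
have u1 : uniq [:: j; H; G1] by rewrite /= !inE !negb_or !jN // eq_sym G1H.
have u2 : uniq [:: j; H; G2] by rewrite /= !inE !negb_or !jN // eq_sym G2H.
have gn0 G : uniq [:: j; H; G] -> g G != 0.
  by move=> u; rewrite mulf_neq0 ?sg_neq0 // dot_cross gp3.
have [e2 chart] := plane_chart (H \in s) u1 xj xH.
have [tx' x'E] := chart _ x'j; have [t2 y2E] := chart _ y2j.
have [t3 y3E] := chart _ y3j; have [t0 x0E] := chart _ x0j.
rewrite -/e in x'E y2E y3E x0E.
rewrite x'H mulr0 scale0r addr0 in x'E.
rewrite x0H mulr0 scale0r addr0 in x0E.
have evE f z t h : z = x + t *: e + h *: e2 ->
  ev f z = ev f x + t * dot f.1 e + h * dot f.1 e2.
  by move=> ->; rewrite !ev_move.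
(* The line [H] is oriented so that moving forward leads away from both crossings. *)
pose r := sg R (0 < g G1).
have rr : r * r = 1 by rewrite /r /sg; case: ifP; rewrite ?mulr1 // mulrNN mulr1.
have rg1 : r * g G1 = `|g G1|.
  rewrite /r /sg; case: ltP => h; first by rewrite mul1r gtr0_norm.
  by rewrite mulN1r ler0_norm.
have rg2 : r * g G2 = `|g G2|.
  rewrite /r side /sg; case: ltP => h; first by rewrite mul1r gtr0_norm.
  by rewrite mulN1r ler0_norm.
have ng1 : 0 < r * g G1 by rewrite rg1 normr_gt0 gn0.
have ng2 : 0 < r * g G2 by rewrite rg2 normr_gt0 gn0.
pose c f := sg R (f \in s).
have kx1 : 0 < c G1 * ev (F G1) x by apply: kx.
have kx2 : 0 < c G2 * ev (F G2) x by apply: kx.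
have x'1 : c G1 * ev (F G1) x' = c G1 * ev (F G1) x + (r * tx') * (r * g G1).
  rewrite x'E ev_move /g -/(c G1).
  have -> : r * tx' * (r * (c G1 * dot (F G1).1 e))
    = (r * r) * (tx' * (c G1 * dot (F G1).1 e)) by ring.
  by rewrite rr; ring.
have t'p : 0 < r * tx'.
  by rewrite -(pmulr_lgt0 _ ng1); move: lt; rewrite -/(c G1) x'1; lra.
(* Going from [x] to [x'] leads away from [G1], hence also from [G2], which is therefore not
   crossed. *)
have G2s' : (G2 \in s) = (G2 \in s').
  apply: (@ok_mem _ _ F _ _ _ x') (kx' _ G2Q G2H).
  rewrite /ok -/(c G2) x'E ev_move.
  have -> : c G2 * (ev (F G2) x + tx' * dot (F G2).1 e)
    = c G2 * ev (F G2) x + (r * tx') * (r * g G2).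
    rewrite /g -/(c G2) mulrDr; congr (_ + _).
    by rewrite -[LHS]mul1r -rr; ring.
  by rewrite addr_gt0 // mulr_gt0.
have [L LQ Ls] : exists2 L, L \in Q & (L \in s) != (L \in s').
  apply/exists_inP; rewrite -[X in is_true X]negbK negb_exists_in; apply: contra ss'.
  move=> /forall_inP h; apply/eqP/finset.setP => i.
  have [iQ|iQ] := boolP (i \in Q); first by apply/eqP; rewrite -[_ == _]negbK h.
  by apply/idP/idP => [/(fintype.subsetP sQ)|/(fintype.subsetP s'Q)]; rewrite (negPf iQ).
have LH : L != H by apply: contraNneq Ls => ->; rewrite Hs'.
have LG1 : L != G1 by apply: contraNneq Ls => ->; rewrite Gs'.
have LG2 : L != G2 by apply: contraNneq Ls => ->; rewrite G2s'.
have eqc f z t h : z = x + t *: e + h *: e2 ->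
  c f * ev (F f) z = c f * ev (F f) x + (r * t) * (r * (c f * dot (F f).1 e))
     + h * (c f * dot (F f).1 e2).
  move=> /evE ->; have -> : r * t * (r * (c f * dot (F f).1 e))
    = (r * r) * (t * (c f * dot (F f).1 e)) by ring.
  by rewrite rr; ring.
(* Moving the base point along [H] from [x0] to [x] shifts both distances equally, so their order
   persists. *)
have ordx : c G1 * ev (F G1) x * (r * g G2) <= c G2 * ev (F G2) x * (r * g G1).
  move: ord; rewrite -rg1 -rg2 /A -!/(c _) x0E !ev_move /g -!/(c _) => ord.
  by lra.
apply: (@hidden_wall R (c G1 * ev (F G1) x) (r * g G1) (c G1 * dot (F G1).1 e2)
  (c G2 * ev (F G2) x) (r * g G2) (c G2 * dot (F G2).1 e2)
  (c L * ev (F L) x) (r * (c L * dot (F L).1 e)) (c L * dot (F L).1 e2)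
  (r * tx') (r * t2) (sg R (H \in s) * ev (F H) y2)
  (r * t3) (sg R (H \in s) * ev (F H) y3)) => //.
- exact: kx.
- have := eqc L x' tx' 0; rewrite scale0r addr0 x'E mul0r addr0 => <- //.
  by rewrite -x'E; apply: sg_neq Ls (kx' _ LQ LH).
- by apply: ky2; rewrite // eq_sym.
- by rewrite -(eqc _ _ _ _ y2E) y20 mulr0.
- by rewrite -(eqc _ _ _ _ y2E); apply: ky2.
- by rewrite -(eqc _ _ _ _ y2E); apply: ky2.
- by have := ky3 H HQ; rewrite /ok Hs'; apply; rewrite eq_sym.
- by rewrite -(eqc _ _ _ _ y3E) y30 mulr0.
- rewrite -(eqc _ _ _ _ y3E); have := ky3 G2 G2Q; rewrite /ok -G2s'; apply.
  by rewrite eq_sym.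
- rewrite -(eqc _ _ _ _ y3E); apply: sg_neq Ls _; exact: ky3.
Qed.


Lemma card_walls2_farther j Q H : j \notin Q -> H \in Q ->
  (\sum_(G in Q | G != H) #|[set s in walls2 [:: j] Q H G | `[< has_farther j Q H G s >]]|
    <= 2 * #|walls [:: j] Q H|)%N.
Proof.
move=> jQ HQ.
have -> : (\sum_(G in Q | G != H) #|[set s in walls2 [:: j] Q H G | `[< has_farther j Q H G s >]]|
   = \sum_(s in walls [:: j] Q H)
       #|[set G in Q | (G != H) && (s \in walls [:: j] Q G) && `[< has_farther j Q H G s >]]|)%N.
  transitivity (\sum_(G in Q | G != H) \sum_(s in walls [:: j] Q H)
     (if (s \in walls [:: j] Q G) && `[< has_farther j Q H G s >] then 1 else 0))%N.
    apply: eq_bigr => G _; rewrite -sum1_card -big_mkcondr /=.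
    by apply: eq_bigl => s; rewrite !inE -!andbA.
  rewrite exchange_big /=; apply: eq_bigr => s _.
  rewrite -sum1_card -big_mkcondr /=.
  by apply: eq_bigl => G; rewrite !inE -!andbA.
rewrite mulnC -sum_nat_const leq_sum // => s sH.
have [sQ [x0 [x0j x0H _]]] := wallsP _ _ _ _ sH.
set S := [set G in Q | _]; rewrite -card_bool.
pose side G := 0 < sg R (G \in s) * dot (F G).1 (cross (F j).1 (F H).1).
suff /card_in_imset <- : {in S &, injective side} by apply: max_card.
move=> G1 G2; rewrite !inE => /and3P[G1Q /andP[G1H w1] /asboolP o1].
move=> /and3P[G2Q /andP[G2H w2] /asboolP o2] eqs.
apply/eqP; apply/negPn/negP => G12.
case/andP: w1 => _ /asboolP y1; case/andP: w2 => _ /asboolP y2.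
(* The situation is symmetric, so the line crossing [H] nearer to [x0] takes the role of [G1]. This
   comparison is why the order is stated at a common [x0]. *)
case/orP: (le_total (sg R (G1 \in s) * ev (F G1) x0 *
     `|sg R (G2 \in s) * dot (F G2).1 (cross (F j).1 (F H).1)|)
   (sg R (G2 \in s) * ev (F G2) x0 *
     `|sg R (G1 \in s) * dot (F G1).1 (cross (F j).1 (F H).1)|)) => le.
  exact: (farther_inj_le jQ G1H G2H G12 HQ G1Q G2Q sQ y2 o1 x0j x0H eqs le).
rewrite eq_sym in G12.
exact: (farther_inj_le jQ G2H G1H G12 HQ G2Q G1Q sQ y1 o2 x0j x0H (esym eqs) le).
Qed.

Lemma card_walls2_last j Q H G : j \notin Q -> H \in Q -> G \in Q -> G != H ->
  (#|walls2 [:: j] Q H G :\: [set s in walls2 [:: j] Q H G | `[< has_farther j Q H G s >]]|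
    <= 4)%N.
Proof.
move=> jQ HQ GQ GH; set S := _ :\: _.
(* One cell for each quadrant of the lines [H] and [G]. *)
have -> : 4%N = #|{: bool * bool}| by rewrite card_prod card_bool.
suff /card_in_imset <- : {in S &, injective (fun s : {set I} => (H \in s, G \in s))}.
  exact: max_card.
have SP s : s \in S -> [/\ s \subset Q, exists x, wallpt [:: j] Q H s x,
    exists x, wallpt [:: j] Q G s x & ~ has_farther j Q H G s].
  rewrite !inE => /andP[+ /andP[/andP[sQ /asboolP w1] /andP[_ /asboolP w2]]].
  rewrite sQ /= (asboolT w1) (asboolT w2) /= => /asboolPn no.
  by [].
move=> s s' /SP[sQ [x wx] ex no] /SP[s'Q [x' wx'] ex' no'] [eH eG].
apply/eqP; apply/negPn/negP => ss'.
case: (ltgtP (sg R (G \in s) * ev (F G) x) (sg R (G \in s) * ev (F G) x')) => h.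
- by apply: no; exists s', x, x'; split.
- apply: no'; exists s, x', x; split; first by split; rewrite // eq_sym.
  by split => //; rewrite -eG.
move: h => /(mulfI (sg_neq0 _ _)) h.
case: wx wx' => xj xH kx [x'j x'H kx'].
have jN K : K \in Q -> j != K by move=> KQ; apply: contraNneq jQ => ->.
(* Two last cells of a quadrant have their witnesses at the same place on [H]; a common witness
   fixes every side but that of [H], which the quadrant fixes. *)
have xx' : x = x'.
  have u : uniq [:: j; H; G] by rewrite /= !inE !negb_or !jN // eq_sym GH.
  have evj z : flat F [:: j] z -> ev (F j) z = 0 by apply; rewrite inE.
  apply/eqP; rewrite -subr_eq0; apply/eqP; apply: (det3_inj (gp3 u));
    by rewrite evB ?evj // ?xH ?x'H ?h subrr.
move/negP: ss'; apply; apply/eqP/finset.setP => i.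
have [iQ|iQ] := boolP (i \in Q); last first.
  by apply/idP/idP => [/(fintype.subsetP sQ)|/(fintype.subsetP s'Q)]; rewrite (negPf iQ).
have [->//|iH] := eqVneq i H.
by apply: ok_mem (kx i iQ iH) _; rewrite xx'; apply: kx'.
Qed.

Lemma card_walls2_plane j Q : j \notin Q ->
  (\sum_(H in Q) \sum_(G in Q | G != H) #|walls2 [:: j] Q H G| <= 8 * #|Q| ^ 2)%N.
Proof.
move=> jQ.
have -> : (8 * #|Q| ^ 2 = \sum_(H in Q) 8 * #|Q|)%N.
  by rewrite sum_nat_const mulnCA mulnn.
apply: leq_sum => H HQ.
(* For each [H]: two lines [G] for each of the [2 |Q|] walls, and four last cells for each [G]. *)
rewrite (_ : (8 * #|Q|)%N = (2 * (2 * #|Q| ^ 1) + #|Q| * 4)%N); last by lia.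
have uJ : uniq [:: H; j] by rewrite /= inE andbT; apply: contraNneq jQ => <-.
have := card_walls2_farther jQ HQ; have := card_walls HQ uJ isT.
rewrite /= -(leq_pmul2l (isT : 0 < 2)%N) => h1 h2.
have {h1 h2} h := leq_trans h2 h1.
apply: leq_trans (leq_add h (leqnn _)).
have h4 : (\sum_(G in Q | G != H) 4 <= #|Q| * 4)%N.
  by rewrite -sum_nat_const big_mkcondr; apply: leq_sum => G _; case: ifP.
apply: leq_trans (leq_add (leqnn _) h4); rewrite -big_split /=.
apply: leq_sum => G /andP[GQ GH].
rewrite -(cardsID [set s in walls2 [:: j] Q H G | `[< has_farther j Q H G s >]]) leq_add //.
  by apply: subset_leq_card; apply: finset.subsetIr.
exact: card_walls2_last.
Qed.

End PlaneSections.

(** * Pairs of walls of a cell in space *)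

Section WallPairs.
Variables (R : realType) (I : finType) (F : I -> 'rV[R]_3 * R).
Hypothesis gp3 : forall i j k, uniq [:: i; j; k] ->
  det3 (F i).1 (F j).1 (F k).1 != 0.
Implicit Types (s Q : {set I}) (J : seq I) (x y : 'rV[R]_3).

Lemma walls_setD1 J Q j H s : j != H ->
  s \in walls F J Q H -> s :\ j \in walls F J (Q :\ j) H.
Proof.
move=> jH /wallsP[sQ [x [xJ xH kx]]]; apply/wallsP; split.
  exact: finset.setSD.
exists x; split => // i; rewrite !inE => /andP[ij iQ] iH.
by rewrite ok_setD1 ?kx.
Qed.

Lemma walls_cross J Q j H (t : {set I}) : j \in Q -> j != H -> j \notin t ->
  t \in walls F J Q H -> j |: t \in walls F J Q H ->
  t \in walls F (j :: J) (Q :\ j) H.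
Proof.
move=> jQ jH jt /wallsP[tQ [x [xJ xH kx]]] /wallsP[_ [y [yJ yH ky]]].
apply/wallsP; split; first by rewrite subsetD1 tQ.
have xj : ev (F j) x < 0.
  by have := kx _ jQ jH; rewrite /ok (negPf jt) /sg mulN1r oppr_gt0.
have yj : 0 < ev (F j) y.
  by have := ky _ jQ jH; rewrite /ok !inE eqxx /sg mul1r.
have [u [u0 u1 hu]] := cross_point xj yj.
exists ((1 - u) *: x + u *: y); split.
- by apply: flat_cons => //; apply: flat_conv.
- by rewrite ev_conv xH yH !mulr0 addr0.
- move=> i; rewrite !inE => /andP[ij iQ] iH; apply: ok_conv => //.
    exact: kx.
  by have := ky _ iQ iH; rewrite ok_setU1.
Qed.

Lemma walls2_split J Q j H G : j \in Q -> j != H -> j != G ->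
  (#|walls2 F J Q H G| <= #|walls2 F J (Q :\ j) H G| + #|walls2 F (j :: J) (Q :\ j) H G|)%N.
Proof.
move=> jQ jH jG; apply: (@split_card _ _ _ _ j) => [s|t jt].
  move=> /finset.setIP[hH hG]; apply/finset.setIP.
  by split; apply: walls_setD1.
move=> /finset.setIP[hH hG] /finset.setIP[hH' hG']; apply/finset.setIP.
by split; apply: walls_cross.
Qed.

Definition nwalls2 Q := (\sum_(H in Q) \sum_(G in Q | G != H) #|walls2 F [::] Q H G|)%N.

(* A pair of walls of a merged cell survives on both sides of the plane [j] only
   if it is cut by [j], and then it is a pair of walls in the plane [j]. *)
Lemma nwalls2_rec Q : ((#|Q| - 2) * nwalls2 Q
  <= \sum_(j in Q) (nwalls2 (Q :\ j) + 8 * #|Q :\ j| ^ 2))%N.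
Proof.
have -> : ((#|Q| - 2) * nwalls2 Q = \sum_(j in Q) \sum_(H in Q :\ j)
    \sum_(G in Q :\ j | G != H) #|walls2 F [::] Q H G|)%N.
  transitivity (\sum_(j in Q) \sum_(H in Q | H != j)
    \sum_(G in Q | (G != H) && (G != j)) #|walls2 F [::] Q H G|)%N; last first.
    apply: eq_bigr => j _; apply: eq_big => [H|H _]; first by rewrite !inE andbC.
    by apply: eq_bigl => G; rewrite !inE; case: (G == j); rewrite ?andbF ?andbT.
  rewrite (exchange_big_dep (mem Q)) /=; last by move=> j H _ /andP[].
  rewrite big_distrr /=; apply: eq_bigr => H HQ.
  rewrite (exchange_big_dep (fun G => (G \in Q) && (G != H))) /=; last first.
    by move=> j G _ /and3P[-> ->].
  rewrite big_distrr /=; apply: eq_bigr => G /andP[GQ GH].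
  (* An ordered pair of distinct walls survives the deletion of each of the [|Q| - 2] other
     planes. *)
  rewrite sum_nat_const; congr (_ * _)%N.
  rewrite (cardsD1 H) HQ (cardsD1 G) !inE GH GQ /= !add1n !subSS subn0.
  apply: eq_card => j; rewrite !inE -[RHS]/((j \in Q) && (H != j) && (G != j)).
  rewrite [H == j]eq_sym [G == j]eq_sym.
  by rewrite [LHS]andbC; congr (_ && _); rewrite andbC.
apply: leq_sum => j jQ.
apply: leq_trans (leq_add (leqnn _) (card_walls2_plane gp3 (j := j) _)); last first.
  by rewrite !inE eqxx.
rewrite /nwalls2 -big_split /=; apply: leq_sum => H.
rewrite !inE => /andP[Hj HQ]; rewrite -big_split /=; apply: leq_sum => G.
rewrite !inE => /andP[/andP[Gj GQ] GH].
by apply: walls2_split; rewrite // eq_sym.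
Qed.

(** The shape [r^2 (r - 1)] is chosen to close the recurrence, which becomes
    [(r - 1) (2 r - 3) <= 2 r (r - 2)], true from [r = 3] on. Below that, cells are bounded by
    subsets of [Q]. *)
Lemma nwalls2_le Q : (nwalls2 Q <= 16 * (#|Q| ^ 2 * #|Q|.-1))%N.
Proof.
have [n] := ubnP #|Q|; elim: n => // n IH in Q *; rewrite ltnS => leQ.
have cardD j : j \in Q -> #|Q :\ j| = #|Q|.-1.
  by move=> jQ; rewrite [in RHS](cardsD1 j) jQ.
have [r3|r2] := leqP 3 #|Q|.
  have r0 : (0 < #|Q| - 2)%N by rewrite subn_gt0.
  rewrite -(leq_pmul2l r0); apply: leq_trans (nwalls2_rec Q) _.
  apply: leq_trans (_ : \sum_(j in Q)
      (16 * (#|Q|.-1 ^ 2 * #|Q|.-2) + 8 * #|Q|.-1 ^ 2) <= _)%N.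
    apply: leq_sum => j jQ; rewrite -(cardD j jQ) leq_add2r; apply: IH.
    by rewrite cardD // prednK //; apply: leq_trans r3.
  rewrite sum_nat_const; case: #|Q| r3 => [|[|[|r]]] // _.
  by rewrite !expnS !expn0 /=; nia.
have c2 H G : (#|walls2 F [::] Q H G| <= 2 ^ #|Q|)%N.
  rewrite -card_powerset; apply: subset_leq_card; apply/fintype.subsetP => s.
  by rewrite finset.inE => /andP[/wallsP[sQ _] _]; rewrite powersetE.
have cH H : H \in Q -> (\sum_(G in Q | G != H) #|walls2 F [::] Q H G|
    <= #|Q|.-1 * 2 ^ #|Q|)%N.
  move=> HQ; rewrite -(cardD H HQ) -sum_nat_const.
  rewrite (eq_bigl (mem (Q :\ H))); last by move=> G; rewrite !inE andbC.
  exact: leq_sum.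
apply: leq_trans (leq_sum _ cH) _; rewrite sum_nat_const.
by case: #|Q| r2 => [|[|[|//]]].
Qed.

(** The diagonal [H = G] is included because two vertices may be extremal in the same facet. It adds
    [2 r^3] to [16 r^3]. *)
Lemma sum_walls2_le Q :
  (\sum_(H in Q) \sum_(G in Q) #|walls2 F [::] Q H G| <= 18 * #|Q| ^ 3)%N.
Proof.
have -> : (\sum_(H in Q) \sum_(G in Q) #|walls2 F [::] Q H G|
   = \sum_(H in Q) #|walls F [::] Q H| + nwalls2 Q)%N.
  rewrite /nwalls2 -big_split /=; apply: eq_bigr => H HQ.
  by rewrite (bigD1 H) //= /walls2 finset.setIid.
have cw H : H \in Q -> (#|walls F [::] Q H| <= 2 * #|Q| ^ (2 - 0))%N.
  by move=> HQ; apply: card_walls.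
apply: leq_trans (leq_add (leq_sum _ cw) (nwalls2_le Q)) _.
rewrite sum_nat_const /=; case: #|Q| => // r.
by rewrite !expnS !expn0 /=; nia.
Qed.

End WallPairs.

(** * Vertices of a simple arrangement *)

Lemma card3E (I : finType) (B : {set I}) : #|B| = 3%N ->
  exists a b c, uniq [:: a; b; c] /\ B =i [:: a; b; c].
Proof.
move=> B3; have := enum_uniq (mem B); have eB := mem_enum (mem B).
rewrite cardE in B3; case: (enum B) B3 eB => [|a [|b [|c [|//]]]] //= _ eB u.
by exists a, b, c; split => // x; rewrite eB.
Qed.

Section Vertices.
Variables (R : realType) (I : finType) (F : I -> 'rV[R]_3 * R).
Hypothesis gp2 : forall i j, i != j -> det2 (F i).1 (F j).1 != 0.
Hypothesis gp3 : forall i j k, uniq [:: i; j; k] ->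
  det3 (F i).1 (F j).1 (F k).1 != 0.
Implicit Types (s Q : {set I}) (x y v z e : 'rV[R]_3) (bit : bool).

Definition zeros v : {set I} := [set i | ev (F i) v == 0].

(** [v] is the strict minimum (for [true]) or maximum of coordinate [0] on the closed facet;
    strictness lets [(s, H, bit)] name the vertex. *)
Definition extremal Q s H bit v : Prop := forall z, ev (F H) z = 0 ->
  (forall i, i \in Q -> 0 <= sg R (i \in s) * ev (F i) z) ->
  0 <= sg R bit * (z 0 0 - v 0 0) /\ (z 0 0 = v 0 0 -> z = v).

Lemma edge_coord i j e : i != j ->
  dot (F i).1 e = 0 -> dot (F j).1 e = 0 -> e 0 0 = 0 -> e = 0.
Proof.
move=> ij; rewrite !dotE => hi hj e0.
have d0 := gp2 ij.
rewrite e0 !mulr0 !add0r in hi hj.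
have key (a : R) : det2 (F i).1 (F j).1 * a = 0 -> a = 0.
  by move/eqP; rewrite mulf_eq0 (negPf d0) => /eqP.
apply: row3_inj; rewrite !mxE //; apply: key; rewrite /det2.
- transitivity ((F j).1 0 2%:R * ((F i).1 0 1 * e 0 1 + (F i).1 0 2%:R * e 0 2%:R)
    - (F i).1 0 2%:R * ((F j).1 0 1 * e 0 1 + (F j).1 0 2%:R * e 0 2%:R)).
    by ring.
  by rewrite hi hj; ring.
- transitivity ((F i).1 0 1 * ((F j).1 0 1 * e 0 1 + (F j).1 0 2%:R * e 0 2%:R)
    - (F j).1 0 1 * ((F i).1 0 1 * e 0 1 + (F i).1 0 2%:R * e 0 2%:R)).
    by ring.
  by rewrite hi hj; ring.
Qed.

(** [ea] and [eb] are the two edges at [v] inside the plane [c], directed into the cell. The facet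
    lies in the cone [v + al ea + be eb] with [al, be >= 0], and both edges leave [v] to the same
    side in coordinate [0]. *)
Lemma facet_extremal Q s v a b c ea eb bit : uniq [:: a; b; c] ->
  zeros v =i [:: a; b; c] -> zeros v \subset Q -> s \subset Q ->
  (forall i, i \in Q -> i \notin zeros v -> ok F s i v) ->
  [/\ dot (F a).1 ea = sg R (a \in s), dot (F b).1 ea = 0 & dot (F c).1 ea = 0] ->
  [/\ dot (F a).1 eb = 0, dot (F b).1 eb = sg R (b \in s) & dot (F c).1 eb = 0] ->
  0 < sg R bit * ea 0 0 -> 0 < sg R bit * eb 0 0 ->
  s \in walls F [::] Q c /\ extremal Q s c bit v.
Proof.
move=> u zv /fintype.subsetP zQ sQ ks [aa ba ca] [ab bb cb] ua ub.
have [va vb vc] : [/\ ev (F a) v = 0, ev (F b) v = 0 & ev (F c) v = 0].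
  split; apply/eqP; [have := zv a|have := zv b|have := zv c];
    by rewrite !inE eqxx ?orbT.
have sg2 f : sg R f * sg R f = 1 by case: f; rewrite /sg ?mulr1 // mulrNN mulr1.
split.
  apply/wallsP; split => //.
  have pos i : i \in Q :\: zeros v -> 0 < sg R (i \in s) * ev (F i) v.
    by case/finset.setDP => iQ iz; apply: ks.
  have [t t0 ht] := @small_eps R I (Q :\: zeros v)
    (fun i => sg R (i \in s) * ev (F i) v)
    (fun i => sg R (i \in s) * dot (F i).1 (ea + eb))
    pos.
  (* A short step along both edges at once reaches the relative interior of the facet. *)
  exists (v + t *: (ea + eb)); split; first by move=> i; rewrite in_nil.
    by rewrite ev_move vc dotDr ca cb addr0 mulr0 addr0.
  move=> i iQ ic; rewrite /ok ev_move mulrDr [_ * (t * _)]mulrCA.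
  have [iz|iz] := boolP (i \in zeros v); last by apply: ht; apply/finset.setDP.
  rewrite zv !inE (negPf ic) orbF in iz; case/orP: iz => /eqP ->.
    by rewrite va mulr0 add0r dotDr aa ab addr0 sg2 mulr1.
  by rewrite vb mulr0 add0r dotDr ba bb add0r sg2 mulr1.
move=> z zc zs.
pose al := sg R (a \in s) * ev (F a) z; pose be := sg R (b \in s) * ev (F b) z.
have al0 : 0 <= al by apply: zs; apply: zQ; rewrite zv !inE eqxx.
have be0 : 0 <= be by apply: zs; apply: zQ; rewrite zv !inE eqxx ?orbT.
have zE : z - v = al *: ea + be *: eb.
  apply/eqP; rewrite -subr_eq0; apply/eqP.
  apply: (det3_inj (gp3 u)); rewrite [dot _ (_ - (_ + _))]dotBr evB dotDr !dotZr.
  - by rewrite va aa ab /al mulrAC sg2; ring.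
  - by rewrite vb ba bb /be [X in _ - (_ + X)]mulrAC sg2; ring.
  - by rewrite vc zc ca cb; ring.
have z0 : z 0 0 - v 0 0 = al * ea 0 0 + be * eb 0 0.
  by have := congr1 (fun w : 'rV[R]_3 => w 0 0) zE; rewrite !mxE.
have eE : sg R bit * (z 0 0 - v 0 0)
    = al * (sg R bit * ea 0 0) + be * (sg R bit * eb 0 0) by rewrite z0; ring.
split; first by rewrite eE addr_ge0 // mulr_ge0 // ltW.
move=> zv0; apply/eqP; rewrite -subr_eq0; apply/eqP.
move: eE; rewrite zv0 subrr mulr0 => /esym/eqP.
rewrite paddr_eq0; try by rewrite mulr_ge0 // ltW.
rewrite [al * _ == 0]mulf_eq0 [be * _ == 0]mulf_eq0 (gt_eqF ua) (gt_eqF ub) !orbF.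
case/andP => /eqP a0 /eqP b0.
by rewrite zE a0 b0 !scale0r addr0.
Qed.

(* Among the three edges at a simple vertex two point to the same side, so the
   vertex is the lowest or the highest point of the facet they span. *)
Lemma vertex_facet Q s v : #|zeros v| = 3%N -> zeros v \subset Q -> s \subset Q ->
  (forall i, i \in Q -> i \notin zeros v -> ok F s i v) ->
  exists H bit, [/\ H \in zeros v, s \in walls F [::] Q H & extremal Q s H bit v].
Proof.
move=> /card3E[a [b [c [u zv]]]] zQ sQ ks.
have dual i j k : uniq [:: i; j; k] -> exists e,
    [/\ dot (F i).1 e = 0, dot (F j).1 e = 0, dot (F k).1 e = sg R (k \in s)
      & e 0 0 != 0].
  move=> uijk; have [e [ei ej ek]] := det3_dual (gp3 uijk).
  exists (sg R (k \in s) *: e); rewrite !dotZr ei ej ek !mulr0 mulr1; split => //.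
  apply/eqP => e0; move: (uijk); rewrite /= inE => /andP[/norP[ij _] _].
  have eE := edge_coord ij (_ : dot _ (sg R (k \in s) *: e) = 0) _ e0.
  rewrite !dotZr ei ej !mulr0 in eE.
  have := dotZr (F k).1 (sg R (k \in s)) e; rewrite ek mulr1 eE //.
  by rewrite dotE !mxE !mulr0 !addr0 => /eqP; rewrite eq_sym (negPf (sg_neq0 _ _)).
have [ab ac bc] : [/\ a != b, a != c & b != c].
  by move: u; rewrite /= !inE negb_or andbT => /andP[/andP[-> ->] ->].
have ua : uniq [:: b; c; a].
  by rewrite /= !inE negb_or andbT bc [b == a]eq_sym ab [c == a]eq_sym ac.
have ub : uniq [:: a; c; b].
  by rewrite /= !inE negb_or andbT ab ac eq_sym bc.
have [ec [eca ecb ecc nc]] := dual _ _ _ u.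
have [ea [eab eac eaa na]] := dual _ _ _ ua.
have [eb [eba ebc ebb nb]] := dual _ _ _ ub.
have sgb (x : R) : x != 0 -> 0 < sg R (0 < x) * x by exact: sg_total.
have pick k i j ei ej bit : uniq [:: i; j; k] -> zeros v =i [:: i; j; k] ->
  [/\ dot (F i).1 ei = sg R (i \in s), dot (F j).1 ei = 0 & dot (F k).1 ei = 0] ->
  [/\ dot (F i).1 ej = 0, dot (F j).1 ej = sg R (j \in s) & dot (F k).1 ej = 0] ->
  0 < sg R bit * ei 0 0 -> 0 < sg R bit * ej 0 0 ->
  exists H bit, [/\ H \in zeros v, s \in walls F [::] Q H & extremal Q s H bit v].
  move=> u' zv' hi hj si sj.
  have [w x] := facet_extremal u' zv' zQ sQ ks hi hj si sj.
  by exists k, bit; split => //; rewrite zv' !inE eqxx !orbT.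
have [sab|sab] := eqVneq (0 < ea 0 0) (0 < eb 0 0).
  apply: (pick c a b ea eb (0 < ea 0 0)) => //; first exact: sgb.
  by rewrite sab; apply: sgb.
have [sac|sac] := eqVneq (0 < ea 0 0) (0 < ec 0 0).
  apply: (pick b a c ea ec (0 < ea 0 0)) => //.
  - by move=> x; rewrite zv !inE; congr (_ || _); rewrite orbC.
  - exact: sgb.
  - by rewrite sac; apply: sgb.
apply: (pick a b c eb ec (0 < eb 0 0)) => //.
- by move=> x; rewrite zv !inE orbC orbA.
- exact: sgb.
- suff -> : (0 < eb 0 0) = (0 < ec 0 0) by apply: sgb.
  by case: (0 < ea 0 0) (0 < eb 0 0) (0 < ec 0 0) sab sac => -[] [].
Qed.

End Vertices.

Lemma mul_gt0_trans (R : realDomainType) (a b c : R) :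
  0 < a * b -> 0 < b * c -> 0 < a * c.
Proof.
move=> ab bc; have b0 : b != 0 by apply: contraTneq ab => ->; rewrite mulr0 ltxx.
have : 0 < (a * c) * b ^+ 2.
  have -> : a * c * b ^+ 2 = (a * b) * (b * c) by ring.
  exact: mulr_gt0.
by rewrite pmulr_lgt0 // exprn_even_gt0.
Qed.

Lemma exists_notin (I : finType) (A : {set I}) : (#|A| < #|I|)%N ->
  exists x, x \notin A.
Proof.
move=> lt; have : (0 < #|~: A|)%N by rewrite cardsCs finset.setCK subn_gt0.
by case/card_gt0P => x; rewrite inE => xA; exists x.
Qed.

(** * A vertex on the cell of a given point *)

Section FindVertex.
Variables (R : realType) (I : finType) (F : I -> 'rV[R]_3 * R).
Hypothesis gp3 : forall i j k, uniq [:: i; j; k] ->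
  det3 (F i).1 (F j).1 (F k).1 != 0.
Hypothesis gp4 : forall x, (#|zeros F x| <= 3)%N.
Hypothesis I3 : (3 <= #|I|)%N.
Implicit Types (s Q : {set I}) (x y v z e : 'rV[R]_3).

(** Since there are at least three planes, [Z] can be padded to two of them and a third one [k]
    added outside; [w] is the dual vector of [k]. *)
Lemma flat_direction (Z : {set I}) : (#|Z| < 3)%N -> exists k w,
  [/\ k \notin Z, dot (F k).1 w = 1 & forall i, i \in Z -> dot (F i).1 w = 0].
Proof.
move=> Z3.
suff [k [a [b [u kZ sub]]]] : exists k a b,
    [/\ uniq [:: a; b; k], k \notin Z & {subset Z <= [:: a; b]}].
  have [w [wa wb wk]] := det3_dual (gp3 u).
  exists k, w; split => // i /sub; rewrite !inE => /orP[] /eqP -> //.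
have := enum_uniq (mem Z); have eZ := mem_enum (mem Z); move: Z3; rewrite cardE.
case: (enum Z) eZ => [|a [|b [|//]]] eZ _ u.
- have [a _] : exists a, a \notin (finset.set0 : {set I}).
    by apply: exists_notin; rewrite cards0 (leq_trans _ I3).
  have [b] : exists b, b \notin [set a].
    by apply: exists_notin; rewrite cards1 (leq_trans _ I3).
  rewrite !inE => ba.
  have [k] : exists k, k \notin [set a; b].
    by apply: exists_notin; rewrite (leq_ltn_trans _ I3) // cards2; case: eqP.
  rewrite !inE negb_or => /andP[ka kb].
  exists k, a, b; split.
  - by rewrite /= !inE negb_or andbT [a == b]eq_sym ba [a == k]eq_sym ka eq_sym kb.
  - by rewrite -eZ.
  - by move=> i; rewrite -eZ.
- have [b] : exists b, b \notin [set a].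
    by apply: exists_notin; rewrite cards1 (leq_trans _ I3).
  rewrite !inE => ba.
  have [k] : exists k, k \notin [set a; b].
    by apply: exists_notin; rewrite (leq_ltn_trans _ I3) // cards2; case: eqP.
  rewrite !inE negb_or => /andP[ka kb].
  exists k, a, b; split.
  - by rewrite /= !inE negb_or andbT [a == b]eq_sym ba [a == k]eq_sym ka eq_sym kb.
  - by rewrite -eZ inE.
  - by move=> i; rewrite -eZ !inE => ->.
have [k] : exists k, k \notin [set a; b].
  by apply: exists_notin; rewrite (leq_ltn_trans _ I3) // cards2; case: eqP.
rewrite !inE negb_or => /andP[ka kb].
exists k, a, b; split.
- move: u; rewrite /= !inE negb_or !andbT => ->.
  by rewrite [a == k]eq_sym ka eq_sym kb.
- by rewrite -eZ !inE negb_or ka.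
- by move=> i; rewrite -eZ.
Qed.

(** The point moves inside the planes already through it until it meets a further plane. Minimising
    [|tau|] over both directions ensures that no plane is crossed on the way. *)
Lemma descend x : (#|zeros F x| < 3)%N -> exists x',
  (#|zeros F x| < #|zeros F x'|)%N /\
  forall i, i \notin zeros F x' -> 0 < ev (F i) x * ev (F i) x'.
Proof.
move=> /flat_direction[k [w [kZ wk wZ]]].
pose P i := (i \notin zeros F x) && (dot (F i).1 w != 0).
have Pk : P k by rewrite /P kZ wk oner_eq0.
pose tau i := - ev (F i) x / dot (F i).1 w.
have [i0 Pi0 imin] := arg_minP (fun i => `|tau i|) Pk.
exists (x + tau i0 *: w).
have sub : zeros F x \subset zeros F (x + tau i0 *: w).
  apply/fintype.subsetP => i iZ; move: (iZ); rewrite !inE ev_move => /eqP ->.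
  by rewrite wZ // mulr0 addr0.
case/andP: (Pi0) => i0Z i0w.
split.
  apply: proper_card; rewrite properE sub; apply/negP => /fintype.subsetP/(_ i0).
  rewrite (negPf i0Z) !inE ev_move /tau divfK // addrN eqxx.
  by move/(_ isT).
move=> i iZ'; have iZ : i \notin zeros F x.
  by apply: contra iZ'; exact: (fintype.subsetP sub).
have n0 : ev (F i) x != 0 by move: iZ; rewrite inE.
move: iZ'; rewrite inE ev_move => iZ'.
have [iw|iw] := eqVneq (dot (F i).1 w) 0.
  by rewrite iw mulr0 addr0 -expr2 exprn_even_gt0.
have ti0 : tau i != 0 by rewrite mulf_neq0 ?invr_eq0 ?oppr_eq0.
have E : ev (F i) x + tau i0 * dot (F i).1 w = ev (F i) x * (1 - tau i0 / tau i).
  by rewrite /tau; field; rewrite ?oppr_eq0 ?n0 ?iw ?i0w.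
rewrite E mulrA -expr2 mulr_gt0 ?exprn_even_gt0 //.
rewrite lt_def; apply/andP; split.
  by apply: contraNneq iZ' => h; rewrite E h mulr0.
rewrite subr_ge0; apply: le_trans (ler_norm _) _.
rewrite normrM normfV ler_pdivrMr ?normr_gt0 // mul1r; apply: imin.
by rewrite /P iZ.
Qed.

Lemma find_vertex x : (forall i, ev (F i) x != 0) -> exists v,
  #|zeros F v| = 3%N /\ forall i, i \notin zeros F v -> 0 < ev (F i) x * ev (F i) v.
Proof.
move=> x0.
suff h n : forall y, (3 - #|zeros F y| <= n)%N ->
   (forall i, i \notin zeros F y -> 0 < ev (F i) x * ev (F i) y) -> exists v,
  #|zeros F v| = 3%N /\ forall i, i \notin zeros F v -> 0 < ev (F i) x * ev (F i) v.
  apply: (h 3%N x); first by rewrite leq_subr.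
  by move=> i _; rewrite -expr2 exprn_even_gt0 //= x0.
elim: n => [|n IH] y yn ky.
  by exists y; split => //; apply/eqP; rewrite eqn_leq gp4 -subn_eq0 -leqn0.
have [/eqP y3|y3] := boolP (#|zeros F y| == 3%N); first by exists y.
have lt : (#|zeros F y| < 3)%N by rewrite ltn_neqAle y3 gp4.
have [y' [lt' ky']] := descend lt.
apply: (IH y'); first by move: lt lt' yn; clear; lia.
move=> i iZ'; apply: mul_gt0_trans (ky' i iZ'); apply: ky.
rewrite inE; apply: contraTneq (ky' i iZ') => ->.
by rewrite mul0r ltxx.
Qed.

End FindVertex.

(** * Counting by random samples *)

Lemma card_fibers_le (T U : finType) (f : T -> U) (A : {set T}) (B : {set U}) m :
  (forall x, x \in A -> f x \in B) ->
  (forall y, (#|[set x in A | f x == y]| <= m)%N) -> (#|A| <= m * #|B|)%N.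
Proof.
move=> fB fm; rewrite -sum1_card (partition_big f (mem B)) //=.
rewrite mulnC -sum_nat_const; apply: leq_sum => y _.
by rewrite sum1_card; apply: leq_trans (fm y); rewrite cardsE.
Qed.

Section Sample.
Variables (R : realType) (I : finType) (F : I -> 'rV[R]_3 * R).
Hypothesis gp2 : forall i j, i != j -> det2 (F i).1 (F j).1 != 0.
Hypothesis gp3 : forall i j k, uniq [:: i; j; k] ->
  det3 (F i).1 (F j).1 (F k).1 != 0.
Variables (T : finType) (pos vx : T -> 'rV[R]_3).
Hypothesis pos0 : forall i a, ev (F i) (pos a) != 0.
Hypothesis pos_inj : forall a b,
  (forall i, 0 < ev (F i) (pos a) * ev (F i) (pos b)) -> a = b.
Hypothesis card_zeros : forall a, #|zeros F (vx a)| = 3%N.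
Hypothesis vx_sg : forall a i, i \notin zeros F (vx a) ->
  0 < ev (F i) (pos a) * ev (F i) (vx a).
Implicit Types (s Q : {set I}) (x y v z e : 'rV[R]_3).

(** The two chosen vertices are vertices of the arrangement [Q] and lie on a common closed cell of
    it. *)
Definition unsep Q : {set T * T} := [set ab |
  [&& zeros F (vx ab.1) \subset Q, zeros F (vx ab.2) \subset Q &
    [forall i in Q, 0 <= ev (F i) (vx ab.1) * ev (F i) (vx ab.2)]]].

Lemma extremal_uniq Q s H bit v v' : ev (F H) v = 0 -> ev (F H) v' = 0 ->
  (forall i, i \in Q -> 0 <= sg R (i \in s) * ev (F i) v) ->
  (forall i, i \in Q -> 0 <= sg R (i \in s) * ev (F i) v') ->
  extremal F Q s H bit v -> extremal F Q s H bit v' -> v = v'.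
Proof.
move=> vH v'H vs v's ext ext'.
have [h1 _] := ext _ v'H v's; have [h2 e] := ext' _ vH vs.
apply: e; apply/eqP; rewrite -subr_eq0 -(mulrI_eq0 _ (mulfI (sg_neq0 R bit))).
rewrite eq_le h2 andbT -oppr_ge0 -mulrN opprB //.
Qed.

Lemma unsep_code Q ab : ab \in unsep Q -> exists k : I * I * {set I} * (bool * bool),
  let: (H, G, s, (bit, bit')) := k in
  [/\ H \in zeros F (vx ab.1), G \in zeros F (vx ab.2), s \in walls2 F [::] Q H G,
    extremal F Q s H bit (vx ab.1) & extremal F Q s G bit' (vx ab.2)] /\
  forall i, i \in Q -> 0 <= sg R (i \in s) * ev (F i) (vx ab.1) /\
                       0 <= sg R (i \in s) * ev (F i) (vx ab.2).
Proof.
case: ab => a b; rewrite inE /= => /and3P[aQ bQ /forall_inP us].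
(* A cell having both vertices in its closure; planes through both of them get the negative side by
   default. *)
pose s := [set i in Q | (0 < ev (F i) (vx a)) || (0 < ev (F i) (vx b))].
have sQ : s \subset Q by apply/fintype.subsetP => i; rewrite inE => /andP[].
have hs i : i \in Q -> 0 <= sg R (i \in s) * ev (F i) (vx a) /\
                       0 <= sg R (i \in s) * ev (F i) (vx b).
  move=> iQ; have := us i iQ; rewrite inE iQ /=.
  set u := ev _ _; set w := ev _ _ => uw.
  have [u0|u0] := ltP 0 u; first by rewrite /sg /= !mul1r (ltW u0) -(pmulr_rge0 _ u0).
  have [w0|w0] := ltP 0 w; first by rewrite /sg /= !mul1r (ltW w0) -(pmulr_lge0 _ w0).
  by rewrite /sg /= !mulN1r !oppr_ge0.
have ok_of v i : i \notin zeros F v -> 0 <= sg R (i \in s) * ev (F i) v -> ok F s i v.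
  by rewrite /ok inE lt_def => h ->; rewrite mulf_neq0 ?sg_neq0.
have [|H [bit [Hz Hs He]]] :=
    vertex_facet gp2 gp3 (card_zeros a) aQ sQ.
  by move=> i iQ iz; apply: ok_of => //; have [] := hs i iQ.
have [|G [bit' [Gz Gs Ge]]] :=
    vertex_facet gp2 gp3 (card_zeros b) bQ sQ.
  by move=> i iQ iz; apply: ok_of => //; have [] := hs i iQ.
exists (H, G, s, (bit, bit')); split => //.
by split => //; rewrite finset.inE Hs.
Qed.

(** Only eight cells meet at a simple vertex, and a point is determined by its cell: away from the
    three planes through the vertex its signs are those of the vertex. Hence [8 * 8] pairs. *)
Lemma card_same_vertex v v' :
  (#|[set ab : T * T | (vx ab.1 == v) && (vx ab.2 == v')]| <= 64)%N.
Proof.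
set A := [set _ | _].
have [->|[[a0 b0]]] := set_0Vmem A; first by rewrite cards0.
rewrite inE /= => /andP[/eqP va /eqP vb].
pose oct (a : T) := [set i in zeros F (vx a) | 0 < ev (F i) (pos a)].
have oct_inj a b : vx a = vx b -> oct a = oct b -> a = b.
  move=> vab /finset.setP oab; apply: pos_inj => i.
  have [iz|iz] := boolP (i \in zeros F (vx a)).
    have := oab i; rewrite !inE -vab; rewrite inE in iz; rewrite iz /= => ab.
    have := pos0 i a; have := pos0 i b; rewrite !neq_lt.
    move: ab; case: (ltgtP 0 (ev (F i) (pos a))) => //= h1;
    case: (ltgtP 0 (ev (F i) (pos b))) => //= h2 _ _ _.
      exact: mulr_gt0.
    by rewrite -mulrNN mulr_gt0 // oppr_gt0.
  have h1 := vx_sg iz; rewrite vab in iz h1; have h2 := vx_sg iz.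
  by apply: mul_gt0_trans h1 _; rewrite mulrC.
pose f (ab : T * T) := (oct ab.1, oct ab.2).
have <- : #|f @: A| = #|A|.
  apply: card_in_imset => -[a b] [a' b']; rewrite !inE /=.
  move=> /andP[/eqP ea /eqP eb] /andP[/eqP ea' /eqP eb'] [w1 w2].
  congr (_, _); apply: oct_inj => //; first by rewrite ea.
  by rewrite eb.
apply: leq_trans (_ : #|finset.setX (powerset (zeros F v)) (powerset (zeros F v'))| <= _)%N.
  apply: subset_leq_card; apply/fintype.subsetP => _ /imsetP[[a b] + ->].
  rewrite !inE /= => /andP[/eqP <- /eqP <-].
  by apply/andP; split; apply/fintype.subsetP => i; rewrite inE => /andP[].
by rewrite cardsX !card_powerset -va -vb !card_zeros.
Qed.

Lemma card_unsep Q : (#|unsep Q| <= 64 * (4 * (18 * #|Q| ^ 3)))%N.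
Proof.
pose C := [set k : I * I * {set I} * (bool * bool) |
  [&& k.1.1.1 \in Q, k.1.1.2 \in Q & k.1.2 \in walls2 F [::] Q k.1.1.1 k.1.1.2]].
have cardC : #|C| = (4 * \sum_(H in Q) \sum_(G in Q) #|walls2 F [::] Q H G|)%N.
  rewrite -sum1_card.
  transitivity (\sum_(H in Q) \sum_(G in Q) \sum_(s in walls2 F [::] Q H G)
     \sum_(bb : bool * bool) 1)%N; last first.
    rewrite big_distrr /=; apply: eq_bigr => H _.
    rewrite big_distrr /=; apply: eq_bigr => G _.
    rewrite -sum1_card big_distrr /=; apply: eq_bigr => s _.
    by rewrite sum1_card card_prod card_bool.
  rewrite pair_big_dep /= pair_big_dep /= pair_big_dep /=.
  by apply: eq_bigl => -[[[H G] s] bb]; rewrite !inE /= andbT -!andbA.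
pose spec (ab : T * T) (k : I * I * {set I} * (bool * bool)) := ab \in unsep Q ->
  [/\ k.1.1.1 \in zeros F (vx ab.1), k.1.1.2 \in zeros F (vx ab.2),
    k.1.2 \in walls2 F [::] Q k.1.1.1 k.1.1.2,
    extremal F Q k.1.2 k.1.1.1 k.2.1 (vx ab.1) &
    extremal F Q k.1.2 k.1.1.2 k.2.2 (vx ab.2)] /\
  forall i, i \in Q -> 0 <= sg R (i \in k.1.2) * ev (F i) (vx ab.1) /\
                       0 <= sg R (i \in k.1.2) * ev (F i) (vx ab.2).
have /boolp.choice[code hcode] : forall ab, exists k, spec ab k.
  move=> ab; have [abQ|abQ] := boolP (ab \in unsep Q); last first.
    have [i _] := card3E (card_zeros ab.1).
    by exists (i, i, finset.set0, (true, true)) => h; rewrite h in abQ.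
  have [[[[H G] s] [bit bit']] h] := unsep_code abQ.
  by exists (H, G, s, (bit, bit')).
(* A code determines both vertices, since strict extrema are unique; at most 64 pairs of points
   share them. *)
have h64 : (#|unsep Q| <= 64 * #|C|)%N.
  apply: (@card_fibers_le _ _ code) => [ab abQ|k].
    have [[hH hG hs _ _] _] := hcode _ abQ; rewrite inE hs.
    move: abQ; rewrite inE => /and3P[/fintype.subsetP aQ /fintype.subsetP bQ _].
    by rewrite (aQ _ hH) (bQ _ hG).
  set A := [set _ in _ | _]; have [->|[ab0]] := set_0Vmem A; first by rewrite cards0.
  rewrite inE => /andP[ab0Q /eqP k0].
  apply: leq_trans (card_same_vertex (vx ab0.1) (vx ab0.2)).
  apply: subset_leq_card; apply/fintype.subsetP => ab.
  rewrite [ab \in A]inE => /andP[abQ /eqP k1]; rewrite inE.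
  have [[hH hG hs e1 e2] hp] := hcode _ abQ.
  have [[hH0 hG0 hs0 e10 e20] hp0] := hcode _ ab0Q.
  rewrite k1 in hH hG hs e1 e2 hp; rewrite k0 in hH0 hG0 hs0 e10 e20 hp0.
  rewrite !inE in hH hG hH0 hG0.
  apply/andP; split; apply/eqP.
    apply: (extremal_uniq (eqP hH) (eqP hH0) _ _ e1 e10) => i iQ.
      by have [] := hp i iQ.
    by have [] := hp0 i iQ.
  apply: (extremal_uniq (eqP hG) (eqP hG0) _ _ e2 e20) => i iQ.
    by have [] := hp i iQ.
  by have [] := hp0 i iQ.
apply: leq_trans h64 _; rewrite cardC leq_mul // leq_mul //.
exact: sum_walls2_le.
Qed.

End Sample.

(** * Random colourings and moments of a colour class *)

Section Colourings.
Variables (I : finType) (m : nat).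
Local Notation colouring := {ffun I -> 'I_m.+1}.
Implicit Types (phi : colouring) (B S : {set I}).

Definition class0 phi : {set I} := [set i | phi i == ord0].

(** The probability [M^-|B| (1 - 1/M)^|S|], with [M = m + 1], cleared of denominators; colours of
    different planes are independent. *)
Lemma card_colourings B S : [disjoint B & S] ->
  (#|[set phi | (B \subset class0 phi) && [disjoint S & class0 phi]]|
     * m.+1 ^ #|B| * m.+1 ^ #|S| = m.+1 ^ #|I| * m ^ #|S|)%N.
Proof.
move=> dBS.
pose D i : pred 'I_m.+1 :=
  if i \in B then pred1 ord0 else if i \in S then predC1 ord0 else predT.
have -> : #|[set phi | (B \subset class0 phi) && [disjoint S & class0 phi]]|
    = (\prod_i #|D i|)%N.
  have := card_family D; rewrite foldrE big_map big_enum /= => <-.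
  apply: eq_card => phi; rewrite !inE; apply/andP/familyP.
    move=> [/fintype.subsetP hB hS] i; rewrite /D.
    case: ifP => [/hB|_]; first by rewrite inE.
    case: ifP => // iS; have := disjointFr hS iS.
    by rewrite !inE => ->.
  move=> h; split.
    by apply/fintype.subsetP => i iB; have := h i; rewrite /D iB !inE.
  rewrite disjoint_subset; apply/fintype.subsetP => i iS; have := h i.
  by rewrite /D (disjointFl dBS iS) iS !inE.
have cardE (A : {set I}) k : (k ^ #|A| = \prod_i (if i \in A then k else 1))%N.
  by rewrite -big_mkcond prod_nat_const.
rewrite !cardE -cardsT cardE -!big_split /=; apply: eq_bigr => i _.
rewrite /D inE; case: ifP => iB.
  by rewrite (disjointFr dBS iB) card1 mul1n !muln1.
case: ifP => iS; last by rewrite !muln1 card_ord.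
by rewrite muln1 mulnC cardC1 card_ord.
Qed.

(** The expected number of [k]-subsets of the first class: each has probability [M^-k], with
    [M = m + 1]. *)
Lemma sum_bin_class0 k :
  (m.+1 ^ k * \sum_phi 'C(#|class0 phi|, k) = 'C(#|I|, k) * m.+1 ^ #|I|)%N.
Proof.
rewrite -cardsT -(cards_draws [set: I] k) -sum1_card big_distrl /=.
transitivity (m.+1 ^ k * \sum_(B : {set I} | (B \subset [set: I]) && (#|B| == k))
    \sum_(phi | B \subset class0 phi) 1)%N.
  congr (_ * _)%N; rewrite (exchange_big_dep predT) //=.
  apply: eq_bigr => phi _; rewrite -cards_draws -sum1_card.
  by apply: eq_bigl => B; rewrite !inE finset.subsetT andbC.
rewrite big_distrr /=; apply: eq_big => [B|B /andP[_ /eqP Bk]].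
  by rewrite !inE.
rewrite mul1n sum1_card.
have d0 (A : {set I}) : [disjoint A & finset.set0].
  by rewrite -finset.setI_eq0 finset.setI0.
have := @card_colourings B finset.set0 (d0 B).
rewrite cards0 !expn0 !muln1 Bk mulnC cardsT => <-; congr (_ * _)%N.
by apply: eq_card => phi; rewrite !inE [X in _ && X]disjoint_sym d0 andbT.
Qed.

End Colourings.

(** Maps from three elements sorted by image: there are 1, 6 and 6 surjections onto a set of size 1,
    2 and 3. *)
Lemma cube_bin r : (r ^ 3 = r + 6 * 'C(r, 2) + 6 * 'C(r, 3))%N.
Proof.
have h2 n : (2 * 'C(n, 2) + n = n ^ 2)%N.
  by elim: n => // n IH; rewrite binS bin1 !expnS !expn0 in IH *; nia.
elim: r => // r IH; rewrite !binS bin1.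
by have := h2 r; rewrite !expnS !expn0 in IH *; nia.
Qed.

Lemma bin_le_exp n k : ('C(n, k) <= n ^ k)%N.
Proof.
elim: k n => [|k IH] n; first by rewrite bin0.
case: n => [|n]; first by rewrite bin0n.
rewrite -(leq_pmul2l (ltn0Sn k)) -mul_bin_diag.
apply: leq_trans (_ : n.+1 * n ^ k <= _)%N; first by rewrite leq_mul2l IH.
rewrite expnS mulnCA leq_mul2l /=; apply: leq_trans (leq_pmull _ (ltn0Sn k)).
by case: k {IH} => // k; rewrite leq_exp2r.
Qed.

Lemma sum_cube_class0 (I : finType) m :
  (m.+1 ^ 3 * \sum_(phi : {ffun I -> 'I_m.+1}) #|class0 phi| ^ 3
   <= (#|I| * m.+1 ^ 2 + 6 * #|I| ^ 2 * m.+1 + 6 * #|I| ^ 3) * m.+1 ^ #|I|)%N.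
Proof.
have h1 := sum_bin_class0 I m 1; have h2 := sum_bin_class0 I m 2.
have h3 := sum_bin_class0 I m 3.
have -> : (\sum_(phi : {ffun I -> 'I_m.+1}) #|class0 phi| ^ 3
  = \sum_phi 'C(#|@class0 I m phi|, 1) + 6 * \sum_phi 'C(#|@class0 I m phi|, 2)
    + 6 * \sum_phi 'C(#|@class0 I m phi|, 3))%N.
  rewrite !big_distrr /= -!big_split /=; apply: eq_bigr => phi _.
  by rewrite cube_bin bin1.
have b2 := bin_le_exp #|I| 2; have b3 := bin_le_exp #|I| 3.
rewrite bin1 in h1; move: h1 h2 h3 b2 b3.
set s1 := (\sum_phi 'C(_, 1))%N; set s2 := (\sum_phi 'C(_, 2))%N.
set s3 := (\sum_phi 'C(_, 3))%N; set X := (m.+1 ^ #|I|)%N; set n := #|I|.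
set M := m.+1; set c2 := 'C(n, 2); set c3 := 'C(n, 3).
move=> h1 h2 h3 b2 b3.
have -> : (M ^ 3 * (s1 + 6 * s2 + 6 * s3)
  = M ^ 2 * (M ^ 1 * s1) + 6 * (M * (M ^ 2 * s2)) + 6 * (M ^ 3 * s3))%N.
  by rewrite !expnS !expn0; nia.
rewrite h1 h2 h3; move: b2 b3; set n2 := (n ^ 2)%N; set n3 := (n ^ 3)%N => b2 b3.
have p2 : (M * (c2 * X) <= M * (n2 * X))%N by rewrite !leq_mul.
have p3 : (c3 * X <= n3 * X)%N by rewrite leq_mul.
by move: p2 p3; clear; nia.
Qed.

(* Bernoulli's inequality [(1 - 1/M)^s >= 1 - s/M]. *)
Lemma half_survive m s : (2 * s <= m.+1)%N -> (m.+1 ^ s <= 2 * m ^ s)%N.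
Proof.
move=> hs; suff h k : (k <= m.+1 -> m.+1 ^ k * (m.+1 - k) <= m.+1 * m ^ k)%N.
  have hs' : (s <= m.+1)%N by lia.
  have := h s hs'.
  have : (m.+1 ^ s * m.+1 <= 2 * (m.+1 ^ s * (m.+1 - s)))%N.
    by rewrite mulnCA leq_mul2l; apply/orP; right; lia.
  by move=> h1 h2; rewrite -(leq_pmul2r (ltn0Sn m)); nia.
elim: k => [|k IH] kM; first by rewrite !expn0 subn0 mul1n muln1.
have := IH (ltnW kM) => {IH}; rewrite !expnS => IH.
apply: leq_trans (_ : m.+1 ^ k * (m.+1 - k) * m <= _)%N; last first.
  by apply: leq_trans (leq_mul IH (leqnn m)) _; rewrite mulnA mulnAC.
rewrite [(m.+1 * _)%N]mulnC -!mulnA leq_mul // subSS subSn; last by rewrite -ltnS.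
by have := subnK (_ : k <= m)%N; set d := (m - k)%N => /(_ kM) h; nia.
Qed.

Definition separators (R : realType) (I : finType) (F : I -> 'rV[R]_3 * R)
  (x y : 'rV[R]_3) : {set I} := [set i | ev (F i) x * ev (F i) y < 0].

(** The factors are 2 from [half_survive], [64 * (4 * 18)] from [card_unsep], 46 from the third
    moment of the sample size, and 8 from the number of colours being [2 D]. *)
Definition close_const : nat := (2 * (64 * (4 * 18)) * 46 * 8)%N.

Section ClosePairs.
Variables (R : realType) (I : finType) (F : I -> 'rV[R]_3 * R).
Hypothesis gp2 : forall i j, i != j -> det2 (F i).1 (F j).1 != 0.
Hypothesis gp3 : forall i j k, uniq [:: i; j; k] ->
  det3 (F i).1 (F j).1 (F k).1 != 0.
Hypothesis gp4 : forall x, (#|zeros F x| <= 3)%N.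
Hypothesis I3 : (3 <= #|I|)%N.
Variables (T : finType) (pos : T -> 'rV[R]_3).
Hypothesis pos0 : forall i a, ev (F i) (pos a) != 0.
Hypothesis pos_inj : forall a b,
  (forall i, 0 < ev (F i) (pos a) * ev (F i) (pos b)) -> a = b.

Definition close D : {set T * T} :=
  [set ab | (#|separators F (pos ab.1) (pos ab.2)| <= D)%N].

(* The planes are coloured at random with [2 (D + 1)] colours, and the first colour
   class is the sample. *)
Lemma colourings_unsep (vx : T -> 'rV[R]_3) D ab :
  (forall a, #|zeros F (vx a)| = 3%N) ->
  (forall a i, i \notin zeros F (vx a) -> 0 < ev (F i) (pos a) * ev (F i) (vx a)) ->
  ab \in close D.+1 ->
  ((D.*2.+1).+1 ^ #|I| <= 2 * (D.*2.+1).+1 ^ 6 *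
    #|[set phi : {ffun I -> 'I_(D.*2.+1).+1} | ab \in unsep F vx (class0 phi)]|)%N.
Proof.
set m := D.*2.+1 => card_zeros vx_sg; rewrite inE; set S0 := separators _ _ _ => cS0.
(* [B] must enter the sample and [S] must avoid it. Separators in [B] are harmless, because they
   vanish at one of the vertices. *)
pose B := zeros F (vx ab.1) :|: zeros F (vx ab.2); pose S := S0 :\: B.
have dBS : [disjoint B & S].
  by rewrite -finset.setI_eq0; apply/eqP/finset.setP => i; rewrite !inE;
    case: (ev _ _ == 0); case: (ev _ _ == 0).
have cB : (#|B| <= 6)%N.
  by rewrite (leq_trans (leq_card_setU _ _)) // !card_zeros.
have cS : (#|S| <= D.+1)%N.
  by apply: leq_trans cS0; apply: subset_leq_card; apply: finset.subsetDl.
have sub : [set phi : {ffun I -> 'I_m.+1} | (B \subset class0 phi) && [disjoint S & class0 phi]]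
   \subset [set phi | ab \in unsep F vx (class0 phi)].
  apply/fintype.subsetP => phi; rewrite inE => /andP[BQ SQ].
  rewrite inE [X in is_true X]inE.
  move: BQ; rewrite finset.subUset => /andP[B1Q B2Q]; rewrite B1Q B2Q /=.
  apply/forall_inP => i iQ.
  have [|n1] := boolP (i \in zeros F (vx ab.1)).
    by rewrite inE => /eqP ->; rewrite mul0r.
  have [|n2] := boolP (i \in zeros F (vx ab.2)).
    by rewrite inE => /eqP ->; rewrite mulr0.
  have iS : i \notin S by rewrite (disjointFl SQ iQ).
  have : i \notin S0.
    apply: contra iS => iS0; apply/finset.setDP; split => //.
    by rewrite finset.in_setU negb_or n1.
  rewrite inE -leNgt => h.
  have {}h : 0 < ev (F i) (pos ab.1) * ev (F i) (pos ab.2).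
    by rewrite lt_def h mulf_neq0.
  have h1 := vx_sg _ _ n1; have h2 := vx_sg _ _ n2.
  rewrite mulrC in h1; apply: ltW; apply: mul_gt0_trans h1 _.
  exact: mul_gt0_trans h h2.
have le := subset_leq_card sub.
have eq := card_colourings m dBS.
have hs : (m.+1 ^ #|S| <= 2 * m ^ #|S|)%N.
  by apply: half_survive; rewrite /m; lia.
have hB : (m.+1 ^ #|B| <= m.+1 ^ 6)%N by rewrite leq_exp2l.
have pS : (0 < m.+1 ^ #|S|)%N by rewrite expn_gt0.
move: le eq hs hB pS; set N1 := #|_|; set N2 := #|_|.
set XB := (_ ^ #|B|)%N; set XS := (_ ^ #|S|)%N; set X := (_ ^ #|I|)%N.
set x6 := (_ ^ 6)%N; set YS := (_ ^ #|S|)%N => le eq hs hB pS.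
rewrite -(leq_pmul2r pS).
apply: leq_trans (_ : X * (2 * YS) <= _)%N; first by rewrite leq_mul.
have -> : (X * (2 * YS) = 2 * (X * YS))%N by ring.
rewrite -eq; have -> : (2 * (N1 * XB * XS) = 2 * XB * N1 * XS)%N by ring.
by rewrite !leq_mul.
Qed.

Lemma card_close_gp D : (0 < D)%N -> (D <= 2 * #|I|)%N ->
  (#|close D| <= close_const * #|I| ^ 3 * D ^ 3)%N.
Proof.
case: D => // D _ DI.
have /boolp.choice[vx hvx] : forall a, exists v, #|zeros F v| = 3%N /\
    forall i, i \notin zeros F v -> 0 < ev (F i) (pos a) * ev (F i) v.
  by move=> a; apply: find_vertex.
have cz a : #|zeros F (vx a)| = 3%N by have [] := hvx a.
have vs a i : i \notin zeros F (vx a) -> 0 < ev (F i) (pos a) * ev (F i) (vx a).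
  by have [_] := hvx a; apply.
set m := D.*2.+1.
have h1 : (#|close D.+1| * m.+1 ^ #|I| <= 2 * m.+1 ^ 6 *
    \sum_(phi : {ffun I -> 'I_m.+1}) #|unsep F vx (class0 phi)|)%N.
  have -> : (\sum_(phi : {ffun I -> 'I_m.+1}) #|unsep F vx (class0 phi)|
    = \sum_(ab : T * T) #|[set phi : {ffun I -> 'I_m.+1} | ab \in unsep F vx (class0 phi)]|)%N.
    transitivity (\sum_(phi : {ffun I -> 'I_m.+1}) \sum_(ab | ab \in unsep F vx (class0 phi)) 1)%N.
      by apply: eq_bigr => phi _; rewrite sum1_card.
    rewrite (exchange_big_dep predT) //=; apply: eq_bigr => ab _.
    by rewrite -sum1_card; apply: eq_bigl => phi; rewrite [RHS]inE.
  rewrite -sum_nat_const big_distrr /= [X in (X <= _)%N]big_mkcond /=.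
  apply: leq_sum => ab _; case: ifP => // abD.
  exact: colourings_unsep.
have h2 : (\sum_(phi : {ffun I -> 'I_m.+1}) #|unsep F vx (class0 phi)|
   <= 64 * (4 * 18) * \sum_(phi : {ffun I -> 'I_m.+1}) #|class0 phi| ^ 3)%N.
  by rewrite big_distrr /=; apply: leq_sum => phi _; rewrite -!mulnA; apply: card_unsep.
have h3 := sum_cube_class0 I m.
have mI : (m.+1 <= 4 * #|I|)%N by rewrite /m; lia.
have X0 : (0 < m.+1 ^ #|I|)%N by rewrite expn_gt0.
(* With at most [4 |I|] colours the lower moments are absorbed: [16 + 24 + 6 = 46]. *)
have h4 : (#|I| * m.+1 ^ 2 + 6 * #|I| ^ 2 * m.+1 + 6 * #|I| ^ 3 <= 46 * #|I| ^ 3)%N.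
  have le2 : (m.+1 ^ 2 <= (4 * #|I|) ^ 2)%N by rewrite leq_exp2r.
  apply: leq_trans (_ : #|I| * (4 * #|I|) ^ 2 + 6 * #|I| ^ 2 * (4 * #|I|) + 6 * #|I| ^ 3 <= _)%N.
    by rewrite leq_add2r leq_add // leq_mul.
  by rewrite !expnS !expn0; nia.
have mE : (m.+1 ^ 3 = 8 * D.+1 ^ 3)%N.
  by have -> : (m.+1 = 2 * D.+1)%N; [rewrite /m; lia|rewrite expnMn].
have M0 : (0 < m.+1 ^ 3)%N by rewrite expn_gt0.
rewrite -(leq_pmul2r X0) -(leq_pmul2r M0).
have M6 : (m.+1 ^ 6 = m.+1 ^ 3 * m.+1 ^ 3)%N by rewrite -expnD.
rewrite /close_const; move: h1 h2 h3 h4 mE; rewrite M6.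
set X := (m.+1 ^ #|I|)%N; set M3 := (m.+1 ^ 3)%N.
set S1 := (\sum_phi #|unsep _ _ _|)%N; set S2 := (\sum_phi #|class0 _| ^ 3)%N.
set n3 := (#|I| ^ 3)%N; set E := (_ + _ + _)%N; set N := #|close D.+1|.
set D3 := (D.+1 ^ 3)%N.
have : exists2 c, c = (64 * (4 * 18))%N & True by exists (64 * (4 * 18))%N.
case=> c <- _ h1 h2 h3 h4 mE.
have h5 : (M3 * S2 <= 46 * n3 * X)%N by apply: leq_trans h3 _; rewrite leq_mul.
have h6 : (M3 * S1 <= c * (46 * n3 * X))%N.
  apply: leq_trans (_ : M3 * (c * S2) <= _)%N; first by rewrite leq_mul.
  by rewrite mulnCA leq_mul.
apply: leq_trans (leq_mul h1 (leqnn M3)) _.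
have -> : (2 * (M3 * M3) * S1 * M3 = 2 * (M3 * M3) * (M3 * S1))%N by ring.
apply: leq_trans (leq_mul (leqnn _) h6) _.
by apply: eq_leq; rewrite {1}mE; ring.
Qed.

End ClosePairs.

(** * General position *)

Section Perturbation.
Variable R : realType.
Implicit Types (phi psi : R -> R).

Definition polyfun phi : Prop := exists p : {poly R}, forall x, phi x = p.[x].

Lemma polyfun_affine a b : polyfun (fun x => x * a + b).
Proof. by exists (a *: 'X + b%:P) => x; rewrite !hornerE mulrC. Qed.

Lemma polyfunC b : polyfun (fun=> b).
Proof. by exists b%:P => x; rewrite hornerC. Qed.

Lemma polyfunD phi psi : polyfun phi -> polyfun psi -> polyfun (fun x => phi x + psi x).
Proof. by move=> [p hp] [q hq]; exists (p + q) => x; rewrite hornerD hp hq. Qed.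

Lemma polyfunB phi psi : polyfun phi -> polyfun psi -> polyfun (fun x => phi x - psi x).
Proof. by move=> [p hp] [q hq]; exists (p - q) => x; rewrite !hornerE hp hq. Qed.

Lemma polyfunM phi psi : polyfun phi -> polyfun psi -> polyfun (fun x => phi x * psi x).
Proof. by move=> [p hp] [q hq]; exists (p * q) => x; rewrite hornerM hp hq. Qed.

(** The product [q] of the polynomials is nonzero, so it has fewer than [size q] roots and cannot
    vanish at all of [size q] points beyond [x0]. *)
Lemma polyfun_avoid (J : finType) (phi : J -> R -> R) (x0 : R) :
  (forall c, polyfun (phi c)) -> (forall c, phi c 0 != 0) ->
  exists2 x, x0 < x & forall c, phi c x != 0.
Proof.
move=> /boolp.choice[p hp] h0; pose q := \prod_c p c.
have q0 : q != 0.
  by apply/prodf_neq0 => c _; apply: contraNneq (h0 c) => pc; rewrite hp pc horner0.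
pose r := [seq x0 + n.+1%:R | n <- iota 0 (size q)].
have ur : uniq r.
  rewrite map_inj_uniq ?iota_uniq // => m n /addrI/eqP.
  by rewrite eqr_nat => /eqP[].
have [x xr xq] : exists2 x, x \in r & ~~ root q x.
  apply/hasP; rewrite has_predC; apply/negP => allr.
  by have := max_poly_roots q0 allr ur; rewrite size_map size_iota ltnn.
exists x; first by case/mapP: xr => n _ ->; rewrite ltrDl ltr0n.
move=> c; rewrite hp; move: xq; rewrite rootE horner_prod.
by move/prodf_neq0; apply.
Qed.

(* The planes dual to the points of the moment curve are in general position,
   since all the minors involved are Vandermonde determinants. *)
Definition moment (t : R) : 'rV[R]_3 * R := (row3 t (t ^+ 2) (t ^+ 3), 1).

(** The determinant with rows (offset, normal); it vanishes when the four planes share a point. *)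
Definition det4 (f1 f2 f3 f4 : 'rV[R]_3 * R) : R :=
  f1.2 * det3 f2.1 f3.1 f4.1 - f2.2 * det3 f1.1 f3.1 f4.1
  + f3.2 * det3 f1.1 f2.1 f4.1 - f4.2 * det3 f1.1 f2.1 f3.1.

Lemma det2_moment s t :
  det2 (moment s).1 (moment t).1 = s ^+ 2 * t ^+ 2 * (t - s).
Proof. by rewrite /det2 !row3E; ring. Qed.

Lemma det3_moment s t u : det3 (moment s).1 (moment t).1 (moment u).1
  = s * t * u * ((t - s) * (u - s) * (u - t)).
Proof. by rewrite /det3 dotE !row3E; ring. Qed.

Lemma det4_moment s t u w : det4 (moment s) (moment t) (moment u) (moment w)
  = (t - s) * (u - s) * (w - s) * ((u - t) * (w - t)) * (w - u).
Proof. by rewrite /det4 !det3_moment /=; ring. Qed.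

Lemma det4_ev0 f1 f2 f3 f4 (x : 'rV[R]_3) : ev f1 x = 0 -> ev f2 x = 0 -> ev f3 x = 0 ->
  ev f4 x = 0 -> det4 f1 f2 f3 f4 = 0.
Proof.
rewrite /ev => /subr0_eq h1 /subr0_eq h2 /subr0_eq h3 /subr0_eq h4.
by rewrite /det4 -h1 -h2 -h3 -h4 /det3 !dotE !row3E; ring.
Qed.

(** Up to the factor [x], the form [f] perturbed by [m / x]. This version is polynomial in [x] and
    equals [m] at [0], where the minors are known. *)
Definition perturb (f m : 'rV[R]_3 * R) (x : R) : 'rV[R]_3 * R :=
  (x *: f.1 + m.1, x * f.2 + m.2).

Lemma ev_perturb f m x (y : 'rV[R]_3) : ev (perturb f m x) y = x * ev f y + ev m y.
Proof. by rewrite /ev /perturb /= !dotE !mxE; ring. Qed.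

Lemma perturb0 f m : perturb f m 0 = m.
Proof. by case: m => m1 m2; rewrite /perturb /= scale0r mul0r !add0r. Qed.

Lemma polyfun_det2 f1 f2 m1 m2 :
  polyfun (fun x => det2 (perturb f1 m1 x).1 (perturb f2 m2 x).1).
Proof.
have h (f m : 'rV[R]_3 * R) i : polyfun (fun x => (perturb f m x).1 0 i).
  by have [p hp] := polyfun_affine (f.1 0 i) (m.1 0 i); exists p => x; rewrite -hp !mxE.
by rewrite /det2; apply: polyfunB; apply: polyfunM; apply: h.
Qed.

Lemma polyfun_det3 f1 f2 f3 m1 m2 m3 :
  polyfun (fun x => det3 (perturb f1 m1 x).1 (perturb f2 m2 x).1 (perturb f3 m3 x).1).
Proof.
have h (f m : 'rV[R]_3 * R) i : polyfun (fun x => (perturb f m x).1 0 i).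
  by have [p hp] := polyfun_affine (f.1 0 i) (m.1 0 i); exists p => x; rewrite -hp !mxE.
suff [p hp] : polyfun (fun x =>
  (cross (perturb f1 m1 x).1 (perturb f2 m2 x).1) 0 0 * (perturb f3 m3 x).1 0 0
  + (cross (perturb f1 m1 x).1 (perturb f2 m2 x).1) 0 1 * (perturb f3 m3 x).1 0 1
  + (cross (perturb f1 m1 x).1 (perturb f2 m2 x).1) 0 2%:R * (perturb f3 m3 x).1 0 2%:R).
  by exists p => x; rewrite -hp /det3 dotE.
have hc i j (F := fun x => (perturb f1 m1 x).1 0 i * (perturb f2 m2 x).1 0 j
    - (perturb f1 m1 x).1 0 j * (perturb f2 m2 x).1 0 i) : polyfun F.
  by apply: polyfunB; apply: polyfunM; apply: h.
apply: polyfunD; [apply: polyfunD|]; (apply: polyfunM; last exact: h).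
- by have [p hp] := hc 1 2%:R; exists p => x; rewrite -hp row3E.
- by have [p hp] := hc 2%:R 0; exists p => x; rewrite -hp row3E.
- by have [p hp] := hc 0 1; exists p => x; rewrite -hp row3E.
Qed.

Lemma polyfun_det4 f1 f2 f3 f4 m1 m2 m3 m4 :
  polyfun (fun x => det4 (perturb f1 m1 x) (perturb f2 m2 x)
                         (perturb f3 m3 x) (perturb f4 m4 x)).
Proof.
have h2 (f m : 'rV[R]_3 * R) : polyfun (fun x => (perturb f m x).2).
  exact: polyfun_affine.
rewrite /det4; apply: polyfunB; [apply: polyfunD; [apply: polyfunB|]|];
  by apply: polyfunM; [exact: h2|exact: polyfun_det3].
Qed.

Lemma general_position h (f : 'I_h -> 'rV[R]_3 * R) (T : finType)
    (pos : T -> 'rV[R]_3) : (forall i a, ev (f i) (pos a) != 0) ->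
  exists g : 'I_h -> 'rV[R]_3 * R,
    [/\ forall i j, i != j -> det2 (g i).1 (g j).1 != 0,
      forall i j k, uniq [:: i; j; k] -> det3 (g i).1 (g j).1 (g k).1 != 0,
      forall x, (#|zeros g x| <= 3)%N &
      forall i a, 0 < ev (f i) (pos a) * ev (g i) (pos a)].
Proof.
(* Parameters start at 1, because the minors of order 2 and 3 vanish at parameter 0. *)
move=> f0; pose m (i : 'I_h) := moment (i.+1)%:R.
pose phi (c : 'I_h * 'I_h * 'I_h * 'I_h) x :=
  let: (i, j, k, l) := c in
  (if i != j then det2 (perturb (f i) (m i) x).1 (perturb (f j) (m j) x).1 else 1)
  * (if uniq [:: i; j; k] then det3 (perturb (f i) (m i) x).1
        (perturb (f j) (m j) x).1 (perturb (f k) (m k) x).1 else 1)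
  * (if uniq [:: i; j; k; l] then det4 (perturb (f i) (m i) x)
        (perturb (f j) (m j) x) (perturb (f k) (m k) x) (perturb (f l) (m l) x) else 1).
(* Beyond [d0], the term [x f] outweighs [m] at every point, so no sign changes. *)
pose d0 := \sum_i \sum_a `|ev (m i) (pos a)| / `|ev (f i) (pos a)|.
have mn0 (i : 'I_h) : (i.+1)%:R != 0 :> R by rewrite pnatr_eq0.
have mB (i j : 'I_h) : i != j -> (j.+1)%:R - (i.+1)%:R != 0 :> R.
  by rewrite subr_eq0 eqr_nat eqSS eq_sym.
have [c|c|d dd0 hd] := @polyfun_avoid _ phi d0.
- case: c => [[[i j] k] l].
  have p1 : polyfun (fun x => if i != j
      then det2 (perturb (f i) (m i) x).1 (perturb (f j) (m j) x).1 else 1).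
    by case: (i != j); [exact: polyfun_det2|exact: polyfunC].
  have p2 : polyfun (fun x => if uniq [:: i; j; k] then det3 (perturb (f i) (m i) x).1
        (perturb (f j) (m j) x).1 (perturb (f k) (m k) x).1 else 1).
    by case: (uniq _); [exact: polyfun_det3|exact: polyfunC].
  have p3 : polyfun (fun x => if uniq [:: i; j; k; l] then det4 (perturb (f i) (m i) x)
      (perturb (f j) (m j) x) (perturb (f k) (m k) x) (perturb (f l) (m l) x) else 1).
    by case: (uniq _); [exact: polyfun_det4|exact: polyfunC].
  exact: polyfunM (polyfunM p1 p2) p3.
- case: c => [[[i j] k] l]; rewrite /phi !perturb0 !mulf_neq0 //.
  + case: ifP => [ij|_]; last exact: oner_neq0.
    by rewrite /m det2_moment !mulf_neq0 ?expf_neq0 ?mB.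
  + case: ifP => [|_]; last exact: oner_neq0.
    rewrite /= !inE negb_or andbT => /andP[/andP[ij ik] jk].
    by rewrite /m det3_moment !mulf_neq0 ?mB.
  + case: ifP => [|_]; last exact: oner_neq0.
    rewrite /= !inE !negb_or andbT => /and3P[/and3P[ij ik il] /andP[jk jl] kl].
    by rewrite /m det4_moment !mulf_neq0 ?mB.
exists (fun i => perturb (f i) (m i) d); split.
- move=> i j ij; have := hd (i, j, i, i); rewrite /phi ij !mulf_eq0 !negb_or.
  by case/andP => /andP[].
- move=> i j k u; have := hd (i, j, k, i); rewrite /phi u !mulf_eq0 !negb_or.
  by case/andP => /andP[].
- move=> x; rewrite leqNgt; apply/negP; rewrite cardE => c4.
  have := enum_uniq (mem (zeros (fun i => perturb (f i) (m i) d) x)).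
  have := mem_enum (mem (zeros (fun i => perturb (f i) (m i) d) x)).
  case: (enum _) c4 => [|i [|j [|k [|l s]]]] // _ ez u.
  have z0 e : e \in [:: i, j, k, l & s] -> ev (perturb (f e) (m e) d) x = 0.
    by rewrite ez inE => /eqP.
  have := hd (i, j, k, l); rewrite /phi !mulf_eq0 !negb_or => /andP[_].
  have -> : uniq [:: i; j; k; l].
    by move: u; rewrite (_ : [:: i, j, k, l & s] = [:: i; j; k; l] ++ s) // cat_uniq => /andP[].
  by rewrite (det4_ev0 (z0 i _) (z0 j _) (z0 k _) (z0 l _)) ?eqxx // !inE eqxx ?orbT.
move=> i a; rewrite ev_perturb.
have le : `|ev (m i) (pos a)| / `|ev (f i) (pos a)| <= d0.
  rewrite /d0 (bigD1 i) //= (bigD1 a) //= -addrA lerDl addr_ge0 //.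
    by apply: sumr_ge0 => b _; rewrite divr_ge0.
  by apply: sumr_ge0 => j _; apply: sumr_ge0 => b _; rewrite divr_ge0.
have n0 : 0 < `|ev (f i) (pos a)| by rewrite normr_gt0.
have : `|ev (m i) (pos a)| < d * `|ev (f i) (pos a)|.
  by rewrite -ltr_pdivrMr //; apply: le_lt_trans dd0.
rewrite -(ltr_pM2r n0) -mulrA -expr2 real_normK ?num_real // -normrM => h1.
have := ler_norm (- (ev (m i) (pos a) * ev (f i) (pos a))); rewrite normrN => h2.
have -> : forall a b c : R, a * (b * a + c) = b * a ^+ 2 + c * a by move=> *; ring.
by lra.
Qed.

End Perturbation.

Lemma card_close (R : realType) h (f : 'I_h -> 'rV[R]_3 * R) (T : finType)
    (pos : T -> 'rV[R]_3) D :
  (forall i a, ev (f i) (pos a) != 0) ->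
  (forall a b, (forall i, 0 < ev (f i) (pos a) * ev (f i) (pos b)) -> a = b) ->
  (0 < D)%N -> (D <= 2 * h)%N ->
  (#|close f pos D| <= close_const * (h + 3) ^ 3 * D ^ 3)%N.
Proof.
move=> f0 finj D0 Dh.
(* Three constant forms equal to 1 are added, so that at least three planes exist; after
   perturbation they become planes with all the points on one side. *)
pose f' (i : 'I_(h + 3)) : 'rV[R]_3 * R :=
  match fintype.split i with inl j => f j | inr _ => (0, -1) end.
have evc x : ev (0, -1) x = 1 :> R by rewrite /ev dotE !mxE !mul0r !add0r opprK.
have f'0 i a : ev (f' i) (pos a) != 0.
  by rewrite /f'; case: (fintype.split i) => // _; rewrite evc oner_neq0.
have f'l j : f' (lshift 3 j) = f j.
  by rewrite /f' (unsplitK (inl j : 'I_h + 'I_3)).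
have [g [gp2 gp3 gp4 gf]] := general_position f'0.
have gg i a b : (0 < ev (g i) (pos a) * ev (g i) (pos b)) =
    (0 < ev (f' i) (pos a) * ev (f' i) (pos b)).
  apply/idP/idP => hh.
    apply: mul_gt0_trans (gf i a) _; apply: mul_gt0_trans hh _.
    by rewrite mulrC.
  apply: mul_gt0_trans (gf i b); rewrite mulrC.
  by apply: mul_gt0_trans (gf i a); rewrite mulrC.
have g0 i a : ev (g i) (pos a) != 0.
  by apply: contraTneq (gf i a) => ->; rewrite mulr0 ltxx.
have ginj a b : (forall i, 0 < ev (g i) (pos a) * ev (g i) (pos b)) -> a = b.
  by move=> hg; apply: finj => i; have := hg (lshift 3 i); rewrite gg f'l.
have c3 : (3 <= #|'I_(h + 3)|)%N by rewrite card_ord leq_addl.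
have := card_close_gp gp2 gp3 gp4 c3 g0 ginj D0.
rewrite card_ord => hc; apply: leq_trans (hc _); last by lia.
apply: subset_leq_card; apply/fintype.subsetP => -[a b]; rewrite !inE /=.
apply: leq_trans.
have <- : #|[set lshift 3 i | i in separators f (pos a) (pos b)]| =
    #|separators f (pos a) (pos b)|.
  by apply: card_imset => i j /lshift_inj.
apply: subset_leq_card; apply/fintype.subsetP => i; rewrite inE => hi.
have {}hi : ev (f' i) (pos a) * ev (f' i) (pos b) < 0.
  rewrite lt_neqAle mulf_neq0 // leNgt -gg -leNgt.
  exact: ltW.
apply/imsetP; move: hi; rewrite /f'; case: splitP => [j ji|k ki]; last first.
  by rewrite !evc mulr1 ltr10.
by move=> hj; exists j; [rewrite inE|apply/val_inj].
Qed.

(** * Rich lines *)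

Lemma straight_line_uniq (R : realType) d (L L' : set 'rV[R]_d) x y :
  straight_line L -> straight_line L' -> x != y ->
  L x -> L y -> L' x -> L' y -> L = L'.
Proof.
move=> [a [v [v0 ->]]] [a' [v' [v'0 ->]]] xy [t _ tx] [s _ sy] [t' _ tx'] [s' _ sy'].
have st : s - t != 0.
  by apply: contraNneq xy => h; rewrite -tx -sy; have -> : s = t by lra.
have st' : s' - t' != 0.
  by apply: contraNneq xy => h; rewrite -tx' -sy'; have -> : s' = t' by lra.
have e1 : y - x = (s - t) *: v.
  by rewrite -tx -sy scalerBl opprD addrACA subrr add0r.
have e2 : y - x = (s' - t') *: v'.
  by rewrite -tx' -sy' scalerBl opprD addrACA subrr add0r.
have e : v = ((s' - t') / (s - t)) *: v'.
  by rewrite mulrC -scalerA -e2 e1 scalerA mulVf // scale1r.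
have sub (b b' w w' : 'rV[R]_d) (r r' k : R) : b + r *: w = x -> b' + r' *: w' = x ->
    w = k *: w' ->
    ([set b + z *: w | z in [set: R]] `<=` [set b' + z *: w' | z in [set: R]])%classic.
  move=> h1 h2 h3 _ [z _ <-]; exists (r' + (z - r) * k) => //.
  by rewrite scalerDl addrA h2 -h1 -scalerA -h3 scalerBl addrA [X in X - _]addrAC addrK.
have e' : v' = ((s - t) / (s' - t')) *: v.
  by rewrite mulrC -scalerA -e1 e2 scalerA mulVf // scale1r.
by rewrite classical_sets.eqEsubset; split; [apply: sub tx tx' e|apply: sub tx' tx e'].
Qed.

Lemma mul_lt0_xor (R : realDomainType) (a b : R) : a != 0 -> b != 0 ->
  (a * b < 0) = (0 < a) (+) (0 < b).
Proof.
move=> a0 b0; have [a1|a1|a1] := ltgtP 0 a; last by rewrite -a1 eqxx in a0.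
  by rewrite pmulr_rlt0 // ltNge le_eqVlt eq_sym (negPf b0) /=; case: ltP.
by rewrite nmulr_rlt0.
Qed.

Section PointsOnLine.
Variables (R : realType) (h : nat) (f : 'I_h -> 'rV[R]_3 * R).
Variables (T : finType) (pos : T -> 'rV[R]_3).
Hypothesis f0 : forall i a, ev (f i) (pos a) != 0.
Hypothesis finj : forall a b, (forall i, 0 < ev (f i) (pos a) * ev (f i) (pos b)) -> a = b.

Definition on_line (L : set 'rV[R]_3) : {set T} := [set a | `[< L (pos a) >]].

(** [E] is linear interpolation of [phi t1] between [t0] and [t2], multiplied by [phi t1]; two sign
    changes would make its sides differ in sign. *)
Lemma one_sign_change (a b t0 t1 t2 : R) (phi := fun t => a + t * b) :
  t0 <= t1 -> t1 <= t2 -> phi t0 * phi t1 < 0 -> phi t1 * phi t2 < 0 -> False.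
Proof.
move=> t01 t12 h1 h2.
have E : phi t1 ^+ 2 * (t2 - t0)
    = (t2 - t1) * (phi t0 * phi t1) + (t1 - t0) * (phi t1 * phi t2).
  by rewrite /phi; ring.
have u1 : (t2 - t1) * (phi t0 * phi t1) <= 0 by rewrite mulr_ge0_le0 ?subr_ge0 // ltW.
have u2 : (t1 - t0) * (phi t1 * phi t2) <= 0 by rewrite mulr_ge0_le0 ?subr_ge0 // ltW.
have [t02|t02] := eqVneq t0 t2.
  have e : t1 = t0 by lra.
  by move: h1; rewrite e -expr2; have := sqr_ge0 (phi t0); lra.
have n1 : phi t1 != 0 by apply: contraTneq h1 => ->; rewrite mulr0 ltxx.
have : 0 < phi t1 ^+ 2 * (t2 - t0).
  by rewrite mulr_gt0 ?exprn_even_gt0 //= subr_gt0 lt_neqAle t02; lra.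
by lra.
Qed.

(** No plane separates both consecutive pairs, so the number of separating planes is an additive
    distance along a line. *)
Lemma separators_on_line (x v : 'rV[R]_3) (a0 a1 a2 : T) t0 t1 t2 :
  t0 <= t1 -> t1 <= t2 ->
  pos a0 = x + t0 *: v -> pos a1 = x + t1 *: v -> pos a2 = x + t2 *: v ->
  (#|separators f (pos a0) (pos a1)| + #|separators f (pos a1) (pos a2)|
    = #|separators f (pos a0) (pos a2)|)%N.
Proof.
move=> t01 t12 e0 e1 e2.
have key i : ~ (ev (f i) (pos a0) * ev (f i) (pos a1) < 0 /\
    ev (f i) (pos a1) * ev (f i) (pos a2) < 0).
  rewrite e0 e1 e2 !ev_move => -[h1 h2].
  exact: (one_sign_change t01 t12 h1 h2).
have -> : separators f (pos a0) (pos a2) =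
    separators f (pos a0) (pos a1) :|: separators f (pos a1) (pos a2).
  apply/finset.setP => i; rewrite !inE; have := key i.
  rewrite !mul_lt0_xor //.
  by case: (0 < ev (f i) (pos a0)) (0 < ev (f i) (pos a1)) (0 < ev (f i) (pos a2)) => -[] [] // [].
have -> : #|separators f (pos a0) (pos a1) :|: separators f (pos a1) (pos a2)| =
  (#|separators f (pos a0) (pos a1)| + #|separators f (pos a1) (pos a2)|)%N.
  rewrite -cardsUI (_ : _ :&: _ = finset.set0) ?cards0 ?addn0 //.
  apply/finset.setP => i; rewrite !inE; apply/negP => /andP[h1 h2].
  exact: (key i).
by [].
Qed.

Definition isolated L D : {set T} := [set a in on_line L |
  [forall b in on_line L, ((a, b) \in close f pos D) ==> (b == a)]].

Lemma card_isolated L D : straight_line L ->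
  (#|isolated L D| <= (h %/ D.+1).+1)%N.
Proof.
move=> [x [v [v0 LE]]].
have [e0|[b0 b0L]] := set_0Vmem (on_line L).
  rewrite (_ : isolated L D = finset.set0) ?cards0 //.
  by apply/finset.setP => a; rewrite inE e0 !inE.
have /boolp.choice[t ht] : forall a, exists t, a \in on_line L -> pos a = x + t *: v.
  move=> a; have [aL|_] := boolP (a \in on_line L); last by exists 0.
  by move: aL; rewrite inE LE => /asboolP[t _ <-]; exists t.
have [a0 a0L a0min] := arg_minP t b0L.
(* The distance from the first point of the line lies in [[0, h]]. Two points in one bucket of
   length [D + 1] are separated by at most [D] planes, so neither is isolated. *)
pose rho a := #|separators f (pos a0) (pos a)|.
have rhoD a b : a \in on_line L -> b \in on_line L -> t a <= t b ->
    (rho a + #|separators f (pos a) (pos b)| = rho b)%N.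
  move=> aL bL tab; rewrite /rho; apply: (@separators_on_line x v a0 a b (t a0) (t a) (t b)) => //;
    by [exact: a0min|exact: ht].
have rhoh a : (rho a %/ D.+1 < (h %/ D.+1).+1)%N.
  by rewrite ltnS leq_div2r // -[X in (_ <= X)%N]card_ord max_card.
pose g a : 'I_(h %/ D.+1).+1 := Ordinal (rhoh a).
suff /card_in_imset <- : {in isolated L D &, injective g}.
  by rewrite -[X in (_ <= X)%N]card_ord max_card.
have gle a b : a \in isolated L D -> b \in isolated L D -> t a <= t b ->
    g a = g b -> b = a.
  rewrite !inE => /andP[aL /forall_inP aI] /andP[bL _] tab /(congr1 val) /= gab.
  have aL' : a \in on_line L by rewrite inE.
  have bL' : b \in on_line L by rewrite inE.
  apply/eqP; apply: (implyP (aI b bL')); rewrite inE /=.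
  have := rhoD a b aL' bL' tab; have := divn_eq (rho a) D.+1.
  have := divn_eq (rho b) D.+1; rewrite gab; have := ltn_pmod (rho b) (ltn0Sn D).
  set q := (_ * D.+1)%N; set ra := (rho a %% _)%N; set rb := (rho b %% _)%N.
  move=> h1 h2 h3 h4; rewrite -(leq_add2l (rho a)) h4 h2 h3 -addnA leq_add2l.
  by rewrite (leq_trans _ (leq_addl _ _)).
move=> a b aI bI gab; case/orP: (le_total (t a) (t b)) => tab.
  by rewrite (gle a b).
by rewrite (gle b a).
Qed.

(** The case [D = 0] of [card_isolated]: distinct points are separated, so every point is
    isolated. *)
Lemma card_on_line L : straight_line L -> (#|on_line L| <= h.+1)%N.
Proof.
move=> sL; have := card_isolated 0 sL; rewrite divn1; apply: leq_trans.
apply: subset_leq_card; apply/fintype.subsetP => a aL.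
rewrite inE aL /=; apply/forall_inP => b _; apply/implyP; rewrite inE /= leqn0 cards_eq0.
move=> /eqP/finset.setP s0; apply/eqP/esym/finj => i.
have := s0 i; rewrite !inE => /negbT; rewrite -leNgt le_eqVlt eq_sym.
by rewrite (negPf (mulf_neq0 (f0 i a) (f0 i b))).
Qed.

(* The planes cut the line into at most [h + 1] intervals; grouping them into
   buckets of consecutive intervals leaves at most half of the points alone in
   their bucket. *)
Lemma sum_rich_lines (J : finType) (L : J -> set 'rV[R]_3) k : (1 < k)%N ->
  injective L -> (forall j, straight_line (L j)) ->
  (\sum_(j | k <= #|on_line (L j)|) #|on_line (L j)| <= 2 * #|close f pos (2 * h %/ k.-1)|)%N.
Proof.
move=> k1 Linj Ls; set D := (2 * h %/ k.-1)%N.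
pose C j := [set ab in close f pos D |
  [&& ab.1 != ab.2, ab.1 \in on_line (L j) & ab.2 \in on_line (L j)]].
have half j : (k <= #|on_line (L j)| -> #|on_line (L j)| <= 2 * #|C j|)%N.
  move=> Lk.
  have sub : on_line (L j) :\: isolated (L j) D \subset [set ab.1 | ab in C j].
    apply/fintype.subsetP => a /finset.setDP[aL]; rewrite inE aL /=.
    rewrite negb_forall => /existsP[b]; rewrite negb_imply negb_imply.
    case/and3P => bL cl ba; apply/imsetP; exists (a, b) => //.
    by rewrite finset.in_set cl /= aL bL eq_sym ba.
  have h1 : (#|on_line (L j) :\: isolated (L j) D| <= #|C j|)%N.
    by apply: leq_trans (subset_leq_card sub) (leq_imset_card _ _).
  have isub : isolated (L j) D \subset on_line (L j).
    by apply/fintype.subsetP => a; rewrite inE => /andP[].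
  rewrite cardsD (finset.setIidPr isub) in h1.
  have h2 := card_isolated D (Ls j); 
  have h4 : (2 * h < D.+1 * k.-1)%N by rewrite /D -ltn_divLR // -ltnS prednK // ltnW.
  have h5 : (h %/ D.+1 * D.+1 <= h)%N by exact: leq_divM.
  (* Hence at most [h %/ D.+1 + 1 <= k / 2] points are isolated, at most half of those on a [k]-rich
     line. *)
  have h6 : (2 * (h %/ D.+1) < k.-1)%N.
    rewrite -(ltn_pmul2r (ltn0Sn D)); apply: leq_ltn_trans (_ : 2 * h < _)%N.
      by rewrite -mulnA leq_mul.
    by rewrite [(k.-1 * _)%N]mulnC.
  by lia.
apply: leq_trans (leq_sum _ half) _.
rewrite -big_distrr leq_mul //=.
apply: leq_trans (_ : \sum_j #|C j| <= _)%N.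
  by rewrite big_mkcond; apply: leq_sum => j _; case: ifP.
have -> : (\sum_j #|C j| = \sum_(ab in close f pos D) #|[set j | ab \in C j]|)%N.
  transitivity (\sum_j \sum_(ab in close f pos D | ab \in C j) 1)%N.
    by apply: eq_bigr => j _; rewrite -sum1_card; apply: eq_bigl => ab;
      rewrite !inE; case: (_ <= D)%N.
  rewrite (exchange_big_dep (mem (close f pos D))) //=; last by move=> j ab _ /andP[].
  apply: eq_bigr => ab abD; rewrite -sum1_card; apply: eq_bigl => j.
  by rewrite abD !inE.
(* Two distinct points lie on one line, so each close pair is charged at most once. *)
rewrite -sum1_card; apply: leq_sum => ab abD.
apply/card_le1_eqP => i j; rewrite !inE => /and4P[_ ne ai bi] /and4P[_ _ aj bj].
apply: Linj; have ne' : pos ab.1 != pos ab.2.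
  apply: contraNneq ne => e; apply/eqP/finj => l; rewrite -e -expr2.
  by rewrite exprn_even_gt0 //= f0.
by apply: (straight_line_uniq (Ls j) (Ls i) ne'); apply/asboolP.
Qed.

End PointsOnLine.

(** Each 64 is [4^3], from [h + 3 <= 4 h] and from [D k <= 4 h]. *)
Definition line_const : nat := (2 * close_const * 64 * 64)%N.

Lemma sum_rich_lines_le (R : realType) h (f : 'I_h -> 'rV[R]_3 * R) (T : finType)
  (pos : T -> 'rV[R]_3) (J : finType) (L : J -> set 'rV[R]_3) k :
  (forall i a, ev (f i) (pos a) != 0) ->
  (forall a b, (forall i, 0 < ev (f i) (pos a) * ev (f i) (pos b)) -> a = b) ->
  (1 < k)%N ->
  injective L -> (forall j, straight_line (L j)) ->
  (k ^ 3 * \sum_(j | k <= #|on_line pos (L j)|) #|on_line pos (L j)| <= line_const * h ^ 6)%N.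
Proof.
move=> f0 finj k1 Linj Ls.
have [j0 Lk|J0] := pickP (fun j => k <= #|on_line pos (L j)|)%N; last by rewrite big_pred0 ?muln0.
have kh : (k.-1 <= h)%N.
  have := leq_trans Lk (card_on_line f0 finj (Ls j0)).
  by case: k k1 {Lk}.
have h0 : (0 < h)%N by apply: leq_trans kh; rewrite -subn1 subn_gt0.
have s1 := sum_rich_lines f0 finj k1 Linj Ls.
have D0 : (0 < 2 * h %/ k.-1)%N by rewrite divn_gt0; lia.
have Dh : (2 * h %/ k.-1 <= 2 * h)%N by exact: leq_div.
have s2 := card_close f0 finj D0 Dh.
have Dk : (2 * h %/ k.-1 * k <= 4 * h)%N.
  have kE : k = k.-1.+1 by rewrite prednK // ltnW.
  have k'0 : (0 < k.-1)%N by rewrite -subn1 subn_gt0.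
  have := leq_divM (2 * h) k.-1; rewrite [in X in _ -> X]kE mulnS.
  have := leq_pmulr (2 * h %/ k.-1) k'0; move: (2 * h %/ k.-1)%N => D.
  move: (D * k.-1)%N => Dk'; clear; lia.
move: s1 s2 Dk; set D := (_ %/ _)%N; set S := (\sum_(j | _) _)%N; set N := #|_| => s1 s2 Dk.
have h3 : ((h + 3) ^ 3 <= 64 * h ^ 3)%N.
  by rewrite -[64%N]/(4 ^ 3)%N -expnMn leq_exp2r //; lia.
have D3 : (D ^ 3 * k ^ 3 <= 64 * h ^ 3)%N.
  by rewrite -[64%N]/(4 ^ 3)%N -!expnMn leq_exp2r.
rewrite /line_const.
have -> : (h ^ 6 = h ^ 3 * h ^ 3)%N by rewrite -expnD.
apply: leq_trans (leq_mul (leqnn _) s1) _.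
apply: leq_trans (leq_mul (leqnn _) (leq_mul (leqnn 2) s2)) _.
move: h3 D3; set H := ((h + 3) ^ 3)%N; set h' := (h ^ 3)%N; set D' := (D ^ 3)%N.
set k' := (k ^ 3)%N => h3 D3; move: close_const => c.
have -> : (k' * (2 * (c * H * D')) = 2 * c * (H * (D' * k')))%N by ring.
have -> : (2 * c * 64 * 64 * (h' * h') = 2 * c * ((64 * h') * (64 * h')))%N.
  by ring.
by rewrite leq_mul // leq_mul.
Qed.

(** * Upper bounds *)

Local Open Scope classical_set_scope.
Local Open Scope ring_scope.

(** Translates topological cells into sign vectors: if no plane separates two points, their segment
    avoids all planes and is connected, so both lie in one component. *)
Lemma proper_forms (R : realType) (C : R) (P : {fset 'rV[R]_3}) :
  proper_up_to C P -> exists h (f : 'I_h -> 'rV[R]_3 * R),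
  [/\ h%:R <= C * (#|` P|%:R `^ 3^-1),
    forall i (a : P), ev (f i) (val a) != 0 &
    forall a b : P, (forall i, 0 < ev (f i) (val a) * ev (f i) (val b)) -> a = b].
Proof.
move=> [Hs [hC Hp HP cell]]; exists #|` Hs|.
pose H (i : 'I_#|` Hs|) := nth set0 (enum_fset Hs) i.
have HHs i : H i \in Hs by exact: mem_nth.
have /boolp.choice[f hf] : forall i : 'I_#|` Hs|, exists g : 'rV[R]_3 * R,
    forall x, H i x <-> ev g x = 0.
  move=> i; have [u [c [_ ->]]] := Hp _ (HHs i); exists (u, c) => x.
  by rewrite /ev /dot /=; split => [->|/subr0_eq//]; rewrite subrr.
have f0 i (a : P) : ev (f i) (val a) != 0.
  by apply/eqP => /hf; apply: HP => //; apply: valP.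
exists f; split => // a b ab.
have Hf K : K \in Hs -> exists i, K = H i.
  move=> KHs; have iK : (index K (enum_fset Hs) < #|` Hs|)%N by rewrite index_mem.
  by exists (Ordinal iK); rewrite /H /= nth_index.
have U (t : R) : 0 <= t <= 1 ->
    (~` \bigcup_(K in [set` Hs]) K) ((1 - t) *: val a + t *: val b).
  case/andP => t0 t1 [K /= /Hf[i ->] /hf]; rewrite ev_conv => e.
  have [fa|fa|fa] := ltgtP (ev (f i) (val a)) 0.
  - have fb : ev (f i) (val b) < 0 by have := ab i; rewrite nmulr_rgt0.
    have [t00|t00] := eqVneq t 0; first by move: e; rewrite t00; lra.
    have : t * ev (f i) (val b) < 0 by rewrite pmulr_rlt0 // lt_def t00.
    have : (1 - t) * ev (f i) (val a) <= 0 by rewrite mulr_ge0_le0 ?subr_ge0 // ltW.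
    by lra.
  - have fb : 0 < ev (f i) (val b) by have := ab i; rewrite pmulr_rgt0.
    have [t00|t00] := eqVneq t 0; first by move: e; rewrite t00; lra.
    have : 0 < t * ev (f i) (val b) by rewrite pmulr_lgt0 // lt_def t00.
    have : 0 <= (1 - t) * ev (f i) (val a) by rewrite pmulr_lge0 ?subr_ge0.
    by lra.
  - by have := f0 i a; rewrite fa eqxx.
have Ua : (~` \bigcup_(K in [set` Hs]) K) (val a).
  by have := U 0; rewrite lexx ler01 subr0 scale1r scale0r addr0; apply.
apply/val_inj/(cell _ Ua) => //; [exact: valP|exact: valP| |].
  exact: connected_component_refl.
pose g (t : R) : 'rV[R]_3 := (1 - t) *: val a + t *: val b.
have gc : continuous g.
  move=> t; apply: cvgD; apply: cvgZr_tmp; last exact: cvg_id.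
  by apply: cvgB; [exact: cvg_cst|exact: cvg_id].
have co : connected (g @` `[0, 1]).
  apply: connected_continuous_connected; first exact: segment_connected.
  exact: continuous_subspaceT.
apply: (connected_component_max _ _ co).
- by exists 0; rewrite ?/g ?subr0 ?scale1r ?scale0r ?addr0 //= in_itv /= lexx ler01.
- by move=> _ [t /=] + <-; rewrite in_itv /= => /U.
- by exists 1; rewrite ?/g ?subrr ?scale1r ?scale0r ?add0r //= in_itv /= lexx ler01.
Qed.

Lemma card_in_fset_image (T : finType) (K : choiceType) (f : T -> K) (A : {set T}) :
  {in A &, injective f} -> #|` [fset f x | x in A]%fset| = #|A|.
Proof.
move=> finj; rewrite card_in_imfset // cardE; apply/perm_size/uniq_perm.
- exact: enum_finmem_uniq.
- exact: enum_uniq.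
- by move=> x; rewrite !mem_enum.
Qed.

Lemma card_fset_image (T : finType) (K : choiceType) (f : T -> K) (A : {set T}) :
  injective f -> #|` [fset f x | x in A]%fset| = #|A|.
Proof. by move=> finj; apply: card_in_fset_image; apply: in2W. Qed.

Lemma card_fset_on_line (R : realType) (P : {fset 'rV[R]_3}) (L : set 'rV[R]_3) :
  #|` [fset p in P | p \in L]%fset| = #|on_line (val : P -> _) L|.
Proof.
rewrite -(card_fset_image (on_line (val : P -> _) L) val_inj); congr #|` _|.
apply/fsetP => p; apply/idP/imfsetP => [|[a /= + ->]].
  rewrite !inE /= => /andP[pP /set_mem pL]; exists [` pP]%fset => //.
  by rewrite inE /=; apply/asboolP.
rewrite inE => /asboolP aL; rewrite !inE /= fsvalP /=; exact: mem_set.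
Qed.

Lemma incidences_fset (R : realType) (P : {fset 'rV[R]_3})
    (Ls : {fset set 'rV[R]_3}) :
  finite_set (incidences P [set` Ls]) /\
  ncard (incidences P [set` Ls])
    = (\sum_(L : Ls) #|on_line (val : P -> _) (val L)|)%N.
Proof.
pose A : {set P * Ls} := [set aL | `[< val aL.2 (val aL.1) >]]%SET.
pose g (aL : P * Ls) := (val aL.1, val aL.2).
have ginj : injective g by move=> [a L] [b M] [/val_inj -> /val_inj ->].
have E : incidences P [set` Ls] = [set` [fset g aL | aL in A]%fset].
  rewrite predeqE => -[p L]; split => /=.
    move=> [/= pP LLs Lp]; apply/imfsetP; exists ([` pP]%fset, [` LLs]%fset) => //=.
    by rewrite inE; apply/asboolP.
  move=> /imfsetP[[a M] /=]; rewrite inE => /asboolP /= aM [-> ->].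
  by split => //=; apply: valP.
rewrite E; split; first exact: finite_fset.
rewrite /ncard set_fsetK card_fset_image // -sum1_card.
transitivity (\sum_(L : Ls) \sum_(a : P | `[< val L (val a) >]) 1)%N.
  rewrite (exchange_big_dep predT) //= pair_big_dep /=.
  by apply: eq_bigl => -[a L]; rewrite inE.
by apply: eq_bigr => L _; rewrite -sum1_card; apply: eq_bigl => a; rewrite inE.
Qed.

Lemma rich_lines_finite (R : realType) d (P : {fset 'rV[R]_d}) k : (1 < k)%N ->
  finite_set (rich_lines k P).
Proof.
move=> k1; pose lin (ab : 'rV[R]_d * 'rV[R]_d) :=
  [set ab.1 + t *: (ab.2 - ab.1) | t in [set: R]].
apply: (@sub_finite_set _ _ (lin @` ([set` P] `*` [set` P]))); last first.
  by apply: finite_image; apply: finite_setX; exact: finite_fset.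
move=> L [sL kL].
have /card_gt1P : (1 < #|{: [fset p in P | p \in L]%fset}|)%N.
  by rewrite -cardfE (leq_trans k1).
move=> [a [b [_ _ ab]]].
have aP := valP a; have bP := valP b; rewrite !inE /= in aP bP.
case/andP: aP => aP /set_mem aL; case/andP: bP => bP /set_mem bL.
exists (val a, val b) => //.
have ab' : val a != val b by rewrite (inj_eq val_inj).
apply: (straight_line_uniq _ sL ab') => //.
- by exists (val a), (val b - val a); split => //; rewrite subr_eq0 eq_sym.
- by exists 0 => //; rewrite /= scale0r addr0.
- by exists 1 => //; rewrite /= scale1r addrC subrK.
Qed.

Lemma cbrtK (R : realType) (N : nat) : (N%:R `^ 3^-1 : R) ^+ 3 = N%:R.
Proof. by rewrite -powR_mulrn ?powR_ge0 // -powRrM mulVf // powRr1. Qed.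

Lemma cbrt_cube (R : realType) (n : nat) : (n ^ 3)%:R `^ 3^-1 = n%:R :> R.
Proof. by rewrite natrX -powR_mulrn // -powRrM mulfV // powRr1. Qed.

Lemma powR_half_sqr (R : realType) (N : nat) : N%:R = (N%:R `^ (1 / 2)) ^+ 2 :> R.
Proof. by rewrite -powR_mulrn ?powR_ge0 // -powRrM mul1r mulVf // powRr1. Qed.

Lemma powR_quarter4 (R : realType) (M : nat) : M%:R = (M%:R `^ (1 / 4)) ^+ 4 :> R.
Proof. by rewrite -powR_mulrn ?powR_ge0 // -powRrM mul1r mulVf // powRr1. Qed.

Lemma powR_quarter3 (R : realType) (M : nat) :
  M%:R `^ (3 / 4) = (M%:R `^ (1 / 4)) ^+ 3 :> R.
Proof.
by rewrite -powR_mulrn ?powR_ge0 // -powRrM; congr (_ `^ _); rewrite mul1r mulrC.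
Qed.

Lemma cbrt_ge1 (R : realType) (N : nat) : (1 <= N)%N -> 1 <= (N%:R `^ 3^-1 : R).
Proof.
move=> N1; have e : 1 `^ 3^-1 = 1 :> R by rewrite powR1.
by rewrite -[leLHS]e ge0_ler_powR ?nnegrE ?ler1n.
Qed.

Lemma sum_rich_lines_bound (R : realType) : exists c : nat,
  forall h (f : 'I_h -> 'rV[R]_3 * R) (T J : finType) (pos : T -> 'rV[R]_3)
    (L : J -> set 'rV[R]_3) k,
  (forall i a, ev (f i) (pos a) != 0) ->
  (forall a b, (forall i, 0 < ev (f i) (pos a) * ev (f i) (pos b)) -> a = b) ->
  (1 < k)%N -> injective L -> (forall j, straight_line (L j)) ->
  (k ^ 3 * \sum_(j | k <= #|on_line pos (L j)|) #|on_line pos (L j)| <= c * h ^ 6)%N.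
Proof. by exists line_const => *; apply: sum_rich_lines_le. Qed.

Lemma rich_incidences_le (R : realType) (C : R) : 0 < C ->
  exists2 K : R, 0 < K & forall P : {fset 'rV[R]_3}, proper_up_to C P ->
  forall (Ls : {fset set 'rV[R]_3}), (forall L, L \in Ls -> straight_line L) ->
  forall k, (1 < k)%N ->
  (\sum_(L : Ls | (k <= #|on_line (val : P -> _) (val L)|)%N)
     #|on_line (val : P -> _) (val L)|)%:R <= K * (#|` P|%:R ^+ 2 / k%:R ^+ 3).
Proof.
move=> C0; have [c hc] := sum_rich_lines_bound R.
(* [C^6] comes from [h^6 <= C^6 N^2]; the successor makes the constant positive. *)
exists (c.+1%:R * C ^+ 6) => [|P prop Ls sLs k k1].
  by rewrite mulr_gt0 ?exprn_gt0.
have [h [f [hC f0 finj]]] := proper_forms prop.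
have := @hc h f P Ls val val k f0 finj k1 val_inj.
move=> /(_ (fun L => sLs _ (valP L))); set S := (\sum_(L : Ls | _) _)%N => hS.
have k0 : 0 < k%:R ^+ 3 :> R by rewrite exprn_gt0 // ltr0n ltnW.
rewrite mulrA ler_pdivlMr //.
have hS' : (S%:R : R) * k%:R ^+ 3 <= c%:R * h%:R ^+ 6.
  by rewrite -!natrX -!natrM ler_nat mulnC.
apply: le_trans hS' _.
have c6 : (h%:R : R) ^+ 6 <= C ^+ 6 * #|` P|%:R ^+ 2.
  rewrite -[X in _ <= _ * X ^+ 2]cbrtK -exprM -exprMn.
  by rewrite lerXn2r ?nnegrE ?mulr_ge0 ?powR_ge0 // ltW.
apply: le_trans (_ : c%:R * (C ^+ 6 * #|` P|%:R ^+ 2) <= _).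
  by rewrite ler_wpM2l.
rewrite mulrA ler_wpM2r ?exprn_ge0 // ler_wpM2r ?exprn_ge0 ?(ltW C0) //.
by rewrite ler_nat.
Qed.

Lemma card_on_line_le (R : realType) (C : R) (P : {fset 'rV[R]_3})
    (L : set 'rV[R]_3) :
  0 < C -> (1 <= #|` P|)%N -> proper_up_to C P -> straight_line L ->
  #|on_line (val : P -> _) L|%:R <= (C + 1) * (#|` P|%:R `^ 3^-1).
Proof.
move=> C0 N1 prop sL; have [h [f [hC f0 finj]]] := proper_forms prop.
have := card_on_line f0 finj sL; rewrite -(ler_nat R) => /le_trans; apply.
by rewrite -addn1 natrD mulrDl mul1r lerD // cbrt_ge1.
Qed.

Lemma rich_on_line (R : realType) (P : {fset 'rV[R]_3}) k : (1 < k)%N ->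
  let Ls := fset_set (rich_lines k P) in
  [/\ [set` Ls] = rich_lines k P, forall L, L \in Ls -> straight_line L &
    forall L : Ls, (k <= #|on_line (val : P -> _) (val L)|)%N].
Proof.
move=> k1 Ls; have fin := rich_lines_finite P k1.
have E : [set` Ls] = rich_lines k P by rewrite fset_setK.
have rich L : L \in Ls -> rich_lines k P L by move=> LLs; rewrite -E.
split => // [L /rich[]//|L]; rewrite -card_fset_on_line.
by have [] := rich _ (valP L).
Qed.

Lemma rich_incidences_finite_le (R : realType) (C : R) : 0 < C ->
  exists2 K : R, 0 < K & forall (P : {fset 'rV[R]_3}) k, proper_up_to C P ->
    (1 < k)%N -> finite_set (incidences P (rich_lines k P)) /\
    (ncard (incidences P (rich_lines k P)))%:R
      <= K * (#|` P|%:R ^+ 2 / k%:R ^+ 3).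
Proof.
move=> C0; have [K K0 hK] := rich_incidences_le C0; exists K => // P k prop k1.
have [E sL rL] := rich_on_line P k1; rewrite -E.
have [fin ->] := incidences_fset P (fset_set (rich_lines k P)).
split => //; have := hK P prop _ sL k k1.
by rewrite (eq_bigl xpredT) // => L; rewrite rL.
Qed.

Lemma card_rich_lines_le (R : realType) (C : R) : 0 < C ->
  exists2 K : R, 0 < K & forall (P : {fset 'rV[R]_3}) k, proper_up_to C P ->
    (1 < k)%N -> finite_set (rich_lines k P) /\
    (ncard (rich_lines k P))%:R <= K * (#|` P|%:R ^+ 2 / k%:R ^+ 4).
Proof.
move=> C0; have [K K0 hK] := rich_incidences_finite_le C0; exists K => // P k prop k1.
split; first exact: rich_lines_finite.
have [_] := hK P k prop k1; have [E sL rL] := rich_on_line P k1.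
rewrite -{1}E (incidences_fset P _).2 => h.
have k0 : 0 < k%:R :> R by rewrite ltr0n ltnW.
have -> : K * (#|` P|%:R ^+ 2 / k%:R ^+ 4) = K * (#|` P|%:R ^+ 2 / k%:R ^+ 3) / k%:R.
  by field; rewrite gt_eqF.
rewrite ler_pdivlMr //; apply: le_trans h; rewrite -natrM ler_nat.
have -> : ncard (rich_lines k P) = #|{: fset_set (rich_lines k P)}|.
  by rewrite /ncard cardfE.
by rewrite -sum_nat_const; apply: leq_sum => L _.
Qed.

(** Lines with fewer than [k] points contribute at most [k M], the others at most [K N^2 / k^3];
    these balance at [k] of order [N^(1/2) / M^(1/4)]. *)
Lemma incidences_le (R : realType) (C : R) : 0 < C ->
  exists2 K : R, 0 < K & forall (P : {fset 'rV[R]_3}) (Ls : {fset set 'rV[R]_3}),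
    (1 <= #|` P|)%N -> proper_up_to C P -> (1 <= #|` Ls|)%N ->
    (forall L, L \in Ls -> straight_line L) ->
    (ncard (incidences P [set` Ls]))%:R
      <= K * (#|` Ls|%:R + #|` P|%:R `^ (1 / 2) * #|` Ls|%:R `^ (3 / 4)).
Proof.
move=> C0; have [K K0 hK] := rich_incidences_le C0.
exists (K + 2) => [|P Ls N1 prop M1 sL]; first by rewrite addr_gt0.
rewrite (incidences_fset P Ls).2.
set N := #|` P|; set M := #|` Ls|; set m := fun L : Ls => #|on_line (val : P -> _) (val L)|.
pose A : R := N%:R `^ (1 / 2); pose q : R := M%:R `^ (1 / 4).
have A0 : 0 < A by rewrite powR_gt0 // ltr0n.
have q0 : 0 < q by rewrite powR_gt0 // ltr0n.
have NE : N%:R = A ^+ 2 by exact: powR_half_sqr.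
have ME : M%:R = q ^+ 4 by exact: powR_quarter4.
have q3 : M%:R `^ (3 / 4) = q ^+ 3 by exact: powR_quarter3.
rewrite -/A q3.
pose kap := A / q; have kap0 : 0 < kap by rewrite divr_gt0.
(* Rounding up by two gives both [k > kap] and [k >= 2], at the cost of [2 M] incidences. *)
pose k := (Num.truncn kap).+2.
have /andP[k1 k2] := truncn_itv (ltW kap0).
have kR : kap < k%:R by apply: lt_trans k2 _; rewrite ltr_nat.
have kR2 : k%:R <= kap + 2 by rewrite /k -addn2 natrD lerD2r.
have h1 := hK P prop Ls sL k isT.
have split : (\sum_(L : Ls) m L <= \sum_(L : Ls | (k <= m L)%N) m L + k * M)%N.
  rewrite (bigID (fun L => (k <= m L)%N)) /= leq_add2l.
  rewrite /M cardfE mulnC -sum_nat_const [leqLHS]big_mkcond.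
  by apply: leq_sum => L _; case: ifP => //; rewrite -ltnNge => /ltnW.
apply: le_trans (_ : (\sum_(L : Ls | (k <= m L)%N) m L)%:R + k%:R * M%:R <= _).
  by rewrite -natrM -natrD ler_nat.
have k0 : 0 < k%:R :> R by rewrite ltr0n.
have h2 : N%:R ^+ 2 / k%:R ^+ 3 <= A * q ^+ 3 :> R.
  rewrite ler_pdivrMr ?exprn_gt0 // NE.
  have -> : (A ^+ 2) ^+ 2 = A * q ^+ 3 * kap ^+ 3 by rewrite /kap; field; rewrite gt_eqF.
  rewrite ler_wpM2l ?mulr_ge0 ?exprn_ge0 ?(ltW A0) ?(ltW q0) //.
  by rewrite lerXn2r ?nnegrE ?(ltW kap0) ?(ltW kR) // (le_trans _ (ltW kR)) // ltW.
have h3 : k%:R * M%:R <= A * q ^+ 3 + 2 * q ^+ 4 :> R.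
  rewrite ME; apply: le_trans (_ : (kap + 2) * q ^+ 4 <= _).
    by rewrite ler_wpM2r ?exprn_ge0 // ltW.
  by rewrite mulrDl lerD2r /kap le_eqVlt; apply/orP; left; apply/eqP; field; rewrite gt_eqF.
rewrite ME in h3 *.
have h4 : K * (N%:R ^+ 2 / k%:R ^+ 3) <= K * (A * q ^+ 3) by rewrite ler_wpM2l // ltW.
have B0 : 0 <= A * q ^+ 3 by rewrite mulr_ge0 ?exprn_ge0 // ltW.
have Q0 : 0 <= q ^+ 4 by rewrite exprn_ge0 // ltW.
have KQ : 0 <= K * q ^+ 4 by rewrite mulr_ge0 // ltW.
move: h1 h3 h4; rewrite -/N; set X := (_%:R); set Y := k%:R * _; set Z := K * (_ / _).
by rewrite mulrDl !mulrDr; lra.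
Qed.

(** With [A = N^(1/2)] and [q = M^(1/4)] the two terms are [q^4] and [A q^3], so comparing [M] with
    [N^2] means comparing [q] with [A]. The bound [N^(1/3) M] holds line by line. *)
Lemma incidences_regimes (R : realType) (C : R) : 0 < C ->
  exists2 K : R, 0 < K & forall (N : nat) (P : {fset 'rV[R]_3}),
    (1 <= N)%N -> #|` P| = N -> proper_up_to C P ->
    forall (M : nat) (Ls : {fset set 'rV[R]_3}),
      (1 <= M)%N -> #|` Ls| = M ->
      (forall L, L \in Ls -> straight_line L) ->
    let Inc : R := (ncard (incidences P [set` Ls]))%:R in
    [/\ finite_set (incidences P [set` Ls]),
        (N%:R ^+ 2 < M%:R :> R -> Inc <= K * M%:R),
        (N%:R `^ (2 / 3) < M%:R :> R -> M%:R <= N%:R ^+ 2 :> R ->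
           Inc <= K * (N%:R `^ (1 / 2) * M%:R `^ (3 / 4))),
        (M%:R <= N%:R `^ (2 / 3) :> R -> Inc <= K * (N%:R `^ 3^-1 * M%:R))
      & Inc <= K * Num.min (M%:R + N%:R `^ (1 / 2) * M%:R `^ (3 / 4))
                         (N%:R `^ 3^-1 * M%:R)].
Proof.
move=> C0; have [K K0 hK] := incidences_le C0.
exists (2 * K + (C + 1)) => [|N P N1 NE prop M Ls M1 ME sL Inc].
  by rewrite !addr_gt0 // mulr_gt0.
have P1 : (1 <= #|` P|)%N by rewrite NE.
have L1 : (1 <= #|` Ls|)%N by rewrite ME.
have := hK P Ls P1 prop L1 sL; rewrite NE ME -/Inc => hI.
have hI3 : Inc <= (C + 1) * (N%:R `^ 3^-1 * M%:R).
  rewrite /Inc (incidences_fset P Ls).2 natr_sum -ME cardfE -sum1_card natr_sum.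
  rewrite mulrA mulr_sumr; apply: ler_sum => L _.
  rewrite mulr1 -NE; apply: card_on_line_le => //; apply: sL; exact: valP.
pose A : R := N%:R `^ (1 / 2); pose q : R := M%:R `^ (1 / 4).
have A0 : 0 < A by rewrite powR_gt0 // ltr0n.
have q0 : 0 < q by rewrite powR_gt0 // ltr0n.
have NA : N%:R = A ^+ 2 by exact: powR_half_sqr.
have Mq : M%:R = q ^+ 4 by exact: powR_quarter4.
have q3 : M%:R `^ (3 / 4) = q ^+ 3 by exact: powR_quarter3.
rewrite -/A q3 in hI *.
have c0 : 0 <= N%:R `^ 3^-1 * M%:R :> R by rewrite mulr_ge0 ?powR_ge0.
have B0 : 0 <= A * q ^+ 3 by rewrite mulr_ge0 ?exprn_ge0 // ltW.
have Q0 : 0 <= q ^+ 4 by rewrite exprn_ge0 // ltW.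
have X0 (x : R) : 0 <= x -> 0 <= K * x /\ 0 <= (C + 1) * x.
  by move=> x0; split; apply: mulr_ge0; lra.
have [KB CB] := X0 _ B0; have [KQ CQ] := X0 _ Q0; have [Kc Cc] := X0 _ c0.
rewrite Mq in hI hI3 Kc Cc c0 *.
split; first exact: (incidences_fset P Ls).1.
- rewrite NA -exprM => hN.
  have Aq : A <= q.
    by have := ltW hN; rewrite ler_pXn2r ?nnegrE ?(ltW A0) ?(ltW q0).
  have : K * (A * q ^+ 3) <= K * q ^+ 4.
    by rewrite ler_wpM2l ?(ltW K0) // [q ^+ 4]exprS ler_wpM2r ?exprn_ge0 ?(ltW q0).
  by rewrite mulrDl; rewrite mulrDr in hI; lra.
- move=> _; rewrite NA -exprM => hN.
  have Aq : q <= A by move: hN; rewrite ler_pXn2r ?nnegrE ?(ltW A0) ?(ltW q0).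
  have : K * q ^+ 4 <= K * (A * q ^+ 3).
    by rewrite ler_wpM2l ?(ltW K0) // [q ^+ 4]exprS ler_wpM2r ?exprn_ge0 ?(ltW q0).
  by rewrite mulrDl; rewrite mulrDr in hI; lra.
- by move=> _; rewrite mulrDl; lra.
- rewrite minElt; case: ifP => _; rewrite mulrDl; last by lra.
  by rewrite !mulrDr; rewrite mulrDr in hI; lra.
Qed.

(** * The cubic grid *)

Lemma card_multiples s d : (0 < d)%N -> (#|[set a : 'I_s | (d %| a.+1)%N]%SET| <= s %/ d)%N.
Proof.
move=> d0; set A := [set a : 'I_s | _]%SET.
have lt (a : 'I_s) : (a.+1 %/ d <= s %/ d)%N by rewrite leq_div2r.
pose g (a : 'I_s) : 'I_(s %/ d).+1 := inord (a.+1 %/ d).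
have gE a : g a = (a.+1 %/ d)%N :> nat by rewrite inordK // ltnS.
have ginj : {in A &, injective g}.
  move=> a b; rewrite !inE => da db /(congr1 val) /=; rewrite !gE => e.
  by apply/val_inj/succn_inj; rewrite -(divnK da) e divnK.
rewrite -(card_in_imset ginj).
have sub : g @: A \subset [set~ ord0]%SET.
  apply/fintype.subsetP => _ /imsetP[a + ->]; rewrite !inE => da.
  by rewrite -val_eqE /= gE -lt0n divn_gt0 // dvdn_leq.
apply: leq_trans (subset_leq_card sub) _.
by rewrite cardsC1 card_ord.
Qed.

(* [1 / d^3 <= (1 / (d - 1) - 1 / d) / 2] makes the sum telescope. *)
Lemma sum_cubes_div s : (2 * \sum_(2 <= d < s.+1) (s %/ d) ^ 3 <= s ^ 3)%N.
Proof.
case: s => [|s]; first by rewrite big_geq.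
suff h t : (2 * \sum_(2 <= d < t.+2) (s.+1 %/ d) ^ 3)%:R
    <= (s.+1%:R : rat) ^+ 3 * (1 - t.+1%:R^-1).
  have := h s; rewrite -(ler_nat rat) => h'.
  by apply: le_trans h' _; rewrite natrX ler_piMr ?exprn_ge0 //.
elim: t => [|t IH]; first by rewrite big_geq // invr1 subrr mulr0.
rewrite big_nat_recr //= mulnDr natrD.
apply: le_trans (lerD IH (_ : _ <= s.+1%:R ^+ 3 * (t.+1%:R^-1 - t.+2%:R^-1))) _; last first.
  by rewrite -mulrDr addrA subrK.
rewrite natrM natrX.
have d0 : 0 < t.+2%:R :> rat by rewrite ltr0n.
have d1 : 0 < t.+1%:R :> rat by rewrite ltr0n.
have dle : (s.+1 %/ t.+2)%:R * t.+2%:R <= s.+1%:R :> rat.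
  by rewrite -natrM ler_nat leq_divM.
have : 2%:R * (s.+1 %/ t.+2)%:R ^+ 3 * (t.+1%:R * t.+2%:R)
    <= ((s.+1 %/ t.+2)%:R * t.+2%:R) ^+ 3 :> rat.
  have k : 2%:R * t.+1%:R <= t.+2%:R ^+ 2 :> rat.
    by rewrite -natrX -natrM ler_nat; clear; lia.
  have -> : 2%:R * (s.+1 %/ t.+2)%:R ^+ 3 * (t.+1%:R * t.+2%:R)
      = (s.+1 %/ t.+2)%:R ^+ 3 * t.+2%:R * (2%:R * t.+1%:R) :> rat by ring.
  have -> : ((s.+1 %/ t.+2)%:R * t.+2%:R) ^+ 3
      = (s.+1 %/ t.+2)%:R ^+ 3 * t.+2%:R * t.+2%:R ^+ 2 :> rat by ring.
  by rewrite ler_wpM2l // mulr_ge0 ?exprn_ge0.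
move=> h; have h2 : ((s.+1 %/ t.+2)%:R * t.+2%:R) ^+ 3 <= s.+1%:R ^+ 3 :> rat.
  by rewrite lerXn2r ?nnegrE ?mulr_ge0.
have -> : t.+1%:R^-1 - t.+2%:R^-1 = (t.+1%:R * t.+2%:R)^-1 :> rat.
  have e : t.+2%:R = t.+1%:R + 1 :> rat by rewrite -natr1.
  have d0' : t.+1%:R != 0 :> rat by rewrite gt_eqF.
  have d1' : t.+1%:R + 1 != 0 :> rat by rewrite -e gt_eqF.
  by rewrite e; move: (t.+1%:R) d0' d1' => u d0' d1'; field; rewrite d0' d1'.
by rewrite ler_pdivlMr ?mulr_gt0 //; apply: le_trans h h2.
Qed.

Definition primitive s (v : 'I_s * 'I_s * 'I_s) : bool :=
  gcdn v.1.1.+1 (gcdn v.1.2.+1 v.2.+1) == 1%N.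

(** Union bound over a common divisor [d >= 2]: at most [(s / d)^3] vectors are divisible by [d],
    and these numbers sum to at most [s^3 / 2]. *)
Lemma card_primitive s :
  (s ^ 3 <= 2 * #|[set v : 'I_s * 'I_s * 'I_s | primitive v]%SET|)%N.
Proof.
set A := [set v | _]%SET.
pose B (d : nat) := [set a : 'I_s | (d %| a.+1)%N]%SET.
have cover : ~: A \subset \bigcup_(d : 'I_s.+1 | (1 < d)%N)
    finset.setX (finset.setX (B d) (B d)) (B d).
  apply/fintype.subsetP => -[[a b] c]; rewrite !inE /primitive /= => g1.
  set g := gcdn _ _ in g1.
  have ga : (g %| a.+1)%N by rewrite dvdn_gcdl.
  have gb : (g %| b.+1)%N by rewrite (dvdn_trans (dvdn_gcdr _ _)) // dvdn_gcdl.
  have gc : (g %| c.+1)%N by rewrite (dvdn_trans (dvdn_gcdr _ _)) // dvdn_gcdr.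
  have g0 : (0 < g)%N by rewrite gcdn_gt0.
  have gs : (g < s.+1)%N by rewrite ltnS (leq_trans (dvdn_leq _ ga)).
  apply/bigcupP; exists (Ordinal gs) => /=; last by rewrite !inE /= ga gb gc.
  by rewrite ltn_neqAle eq_sym g1.
have h1 : (#|~: A| <= \sum_(2 <= d < s.+1) (s %/ d) ^ 3)%N.
  apply: leq_trans (subset_leq_card cover) _.
  apply: leq_trans (_ : \sum_(d < s.+1 | (1 < d)%N) (s %/ d) ^ 3 <= _)%N; last first.
    rewrite -(big_mkord (fun d => (1 < d)%N) (fun d => (s %/ d) ^ 3)%N).
    rewrite big_mkcond /=; case: s {A B cover} => [|s]; first by rewrite big_nat1.
    rewrite big_ltn // big_ltn // !add0n.
    by rewrite [leqRHS]big_nat_cond [leqLHS]big_nat_cond;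
      apply: leq_sum => d /andP[/andP[-> _] _].
  elim/big_rec2: _ => [|d x y d1 le]; first by rewrite cards0.
  apply: leq_trans (leq_card_setU _ _) _; rewrite leq_add //.
  have := @card_multiples s d (ltnW d1); rewrite -/(B d) !cardsX => h.
  by rewrite !expnS expn0 muln1 mulnA !leq_mul.
have h2 := sum_cubes_div s.
have h3 : (#|A| + #|~: A| = s ^ 3)%N.
  by rewrite cardsC !card_prod !card_ord !expnS expn0 muln1 mulnA.
by move: h1 h2 h3; move: (\sum_(2 <= d < s.+1) _)%N (s ^ 3)%N #|A| #|~: A| => X Y Z T; lia.
Qed.

(** A first component above [s / 4] leaves room for [s / 4 + 1] starting abscissas below it. The
    restriction discards at most [s^3 / 4] vectors. *)
Lemma card_primitive_large s : (s ^ 3 <= 4 *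
  #|[set v : 'I_s * 'I_s * 'I_s | primitive v && (s %/ 4 <= v.1.1)%N]%SET|)%N.
Proof.
have h1 := card_primitive s; set A := [set v | primitive v]%SET in h1.
set L := [set v | _ && _]%SET.
pose S := finset.setX
  (finset.setX [set a : 'I_s | (a < s %/ 4)%N]%SET (finset.setT : {set 'I_s}))
  (finset.setT : {set 'I_s}).
have h2 : (#|A| <= #|L| + #|S|)%N.
  apply: leq_trans (leq_card_setU L (S : {set 'I_s * 'I_s * 'I_s})).
  apply: subset_leq_card; apply/fintype.subsetP => v; rewrite !inE => ->.
  by rewrite /= leqNgt !andbT; case: (_ < _)%N.
have h3 : (#|S| <= s %/ 4 * s * s)%N.
  rewrite !cardsX !cardsT !card_ord !leq_mul //.
  have [->|[a0]] := set_0Vmem [set a : 'I_s | (a < s %/ 4)%N]%SET; first by rewrite cards0.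
  rewrite inE => a0s.
  pose g (a : 'I_s) : 'I_(s %/ 4).-1.+1 := inord a.
  have e : (s %/ 4).-1.+1 = (s %/ 4)%N by rewrite prednK // (leq_ltn_trans _ a0s).
  have ginj : {in [set a : 'I_s | (a < s %/ 4)%N]%SET &, injective g}.
    move=> a b; rewrite !inE => la lb /(congr1 val) /=.
    by rewrite !inordK ?e // => ?; apply/val_inj.
  by rewrite -(card_in_imset ginj) (leq_trans (max_card _)) // card_ord e.
have h4 : (4 * (s %/ 4) <= s)%N by rewrite mulnC leq_divM.
have h5 : (4 * (s %/ 4 * s * s) <= s ^ 3)%N.
  by rewrite !mulnA !expnS expn0 muln1 mulnA !leq_mul.
move: h1 h2 h3 h5; move: (s ^ 3)%N (_ * s * s)%N #|A| #|L| #|S| => X Y Z T U; lia.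
Qed.

Section Grid.
Variable R : realType.
Implicit Types (p v : nat * nat * nat) (n k : nat).

Definition gpt p : 'rV[R]_3 := row3 p.1.1%:R p.1.2%:R p.2%:R.

Definition grid n : {fset 'rV[R]_3} :=
  [fset gpt (nat_of_ord i.1.1, nat_of_ord i.1.2, nat_of_ord i.2)
    | i : 'I_n * 'I_n * 'I_n in (finset.setT : {set 'I_n * 'I_n * 'I_n})]%fset.

Definition gline p v : set 'rV[R]_3 := [set gpt p + t *: gpt v | t in [set: R]].

Lemma gpt_inj : injective gpt.
Proof.
move=> [[x y] z] [[x' y'] z'] /rowP e.
have := e 0; have := e 1; have := e 2%:R; rewrite !row3E /= => /eqP + /eqP + /eqP.
by rewrite !eqr_nat => /eqP -> /eqP -> /eqP ->.
Qed.

Lemma card_grid n : #|` grid n| = (n ^ 3)%N.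
Proof.
rewrite card_fset_image ?cardsT ?card_prod ?card_ord; last first.
  move=> [[x y] z] [[x' y'] z'] /gpt_inj[ex ey ez].
  by congr (_, _, _); apply/val_inj.
by rewrite !expnS expn0 muln1 mulnA.
Qed.

Lemma mem_grid n x y z : (x < n)%N -> (y < n)%N -> (z < n)%N -> gpt (x, y, z) \in grid n.
Proof.
move=> xn yn zn; apply/imfsetP.
by exists (Ordinal xn, Ordinal yn, Ordinal zn); rewrite //= inE.
Qed.

Lemma gline_straight p v : v != (0, 0, 0)%N -> straight_line (gline p v).
Proof.
move=> v0; exists (gpt p), (gpt v); split => //.
apply: contraNneq v0 => e; apply/eqP/gpt_inj; rewrite e.
by apply: row3_inj; rewrite !row3E !mxE.
Qed.

Lemma gptD p v (j : nat) : gpt p + j%:R *: gpt v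
  = gpt (p.1.1 + j * v.1.1, p.1.2 + j * v.1.2, p.2 + j * v.2)%N.
Proof.
by apply: row3_inj; rewrite !mxE /= natrD natrM.
Qed.

Lemma gline_rich n k p v : v != (0, 0, 0)%N -> (0 < k)%N ->
  (p.1.1 + k.-1 * v.1.1 < n)%N -> (p.1.2 + k.-1 * v.1.2 < n)%N ->
  (p.2 + k.-1 * v.2 < n)%N -> rich_lines k (grid n) (gline p v).
Proof.
move=> v0 k0 hx hy hz; split; first exact: gline_straight.
pose g (j : 'I_k) := gpt p + (j%:R : R) *: gpt v.
have ginj : injective g.
  move=> i j; rewrite /g !gptD => /gpt_inj[] /addnI ex /addnI ey /addnI ez.
  apply/val_inj/eqP => /=; case: v v0 ex ey ez {hx hy hz g} => [[a b] c] v0 /=.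
  move=> /eqP + /eqP + /eqP; rewrite !eqn_mul2r.
  case/orP => [/eqP a0|//]; case/orP => [/eqP b0|//]; case/orP => [/eqP c0|//].
  by rewrite a0 b0 c0 eqxx in v0.
rewrite -[X in (X <= _)%N]card_ord -cardsT -(card_fset_image _ ginj).
apply: fsubset_leq_card; apply/fsubsetP => _ /imfsetP[j _ ->].
rewrite !inE /= /g; apply/andP; split; last first.
  by apply/mem_set; exists j%:R.
have jk : (j <= k.-1)%N by rewrite -ltnS prednK.
by rewrite gptD; apply: mem_grid; [move: hx|move: hy|move: hz];
  apply: leq_ltn_trans; rewrite leq_add2l leq_mul.
Qed.

Lemma card_le_ncard (T : finType) (K : choiceType) (f : T -> K) (A : {set T}) (B : set K) :
  finite_set B -> {in A &, injective f} -> (forall a, a \in A -> B (f a)) ->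
  (#|A| <= ncard B)%N.
Proof.
move=> Bfin finj fB; rewrite /ncard.
rewrite -(card_in_fset_image finj).
apply: fsubset_leq_card; apply/fsubsetP => _ /imfsetP[a aA ->].
by rewrite in_fset_set // mem_set //; apply: fB.
Qed.

Lemma axis_inj n : injective (fun xy : 'I_n * 'I_n =>
  gline (xy.1 : nat, xy.2 : nat, 0)%N (0, 0, 1)%N).
Proof.
move=> [x y] [x' y'] /= e.
have : gline (x' : nat, y' : nat, 0)%N (0, 0, 1)%N (gpt (x : nat, y : nat, 0)%N).
  by rewrite -e; exists 0; rewrite //= scale0r addr0.
move=> [t _ /rowP et]; have := et 0; have := et 1.
rewrite !mxE /= !mulr0 !addr0 => /eqP + /eqP; rewrite !eqr_nat => /eqP ey /eqP ex.
by congr (_, _); apply/val_inj.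
Qed.

Lemma axis_rich n k (x y : 'I_n) : (0 < k)%N -> (k <= n)%N ->
  rich_lines k (grid n) (gline (x : nat, y : nat, 0)%N (0, 0, 1)%N).
Proof.
move=> k0 kn; apply: gline_rich; rewrite //= ?muln0 ?addn0 ?ltn_ord //.
by rewrite muln1 add0n prednK.
Qed.

(* Along a primitive direction a lattice line meets every slab [0 <= x < a] in at
   most one lattice point, so direction and that point are determined. *)
Lemma gline_inj x y z a b c x' y' z' a' b' c' :
  gcdn a (gcdn b c) = 1%N -> gcdn a' (gcdn b' c') = 1%N ->
  (x < a)%N -> (x' < a')%N ->
  gline (x, y, z) (a, b, c) = gline (x', y', z') (a', b', c') ->
  (x, y, z, (a, b, c)) = (x', y', z', (a', b', c')).
Proof.
move=> g1 g1' xa xa' e.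
have : gline (x', y', z') (a', b', c') (gpt (x, y, z)).
  by rewrite -e; exists 0; rewrite //= scale0r addr0.
have : gline (x', y', z') (a', b', c') (gpt (x + a, y + b, z + c)%N).
  rewrite -e; exists 1; rewrite //= -[1]/(1%:R) gptD /= !mul1n //.
move=> [t1 _ /rowP e1] [t _ /rowP e0].
have := e1 0; have := e1 1; have := e1 2%:R; rewrite !mxE /= !natrD => z1 y1 x1.
have := e0 0; have := e0 1; have := e0 2%:R; rewrite !mxE /= => z0 y0 x0.
have aE : a%:R = (t1 - t) * a'%:R :> R by lra.
have bE : b%:R = (t1 - t) * b'%:R :> R by lra.
have cE : c%:R = (t1 - t) * c'%:R :> R by lra.
have ab : (a * b' = a' * b)%N.
  by apply/eqP; rewrite -(eqr_nat R) !natrM aE bE; apply/eqP; ring.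
have ac : (a * c' = a' * c)%N.
  by apply/eqP; rewrite -(eqr_nat R) !natrM aE cE; apply/eqP; ring.
(* The directions are proportional, and [a = gcd (a a', a b', a c')] and
   [a' = gcd (a' a, a' b, a' c)] are gcds of the same triple. *)
have aa : a = a'.
  have h1 : gcdn (a * a') (gcdn (a * b') (a * c')) = a.
    by rewrite -!muln_gcdr g1' muln1.
  have h2 : gcdn (a' * a) (gcdn (a' * b) (a' * c)) = a'.
    by rewrite -!muln_gcdr g1 muln1.
  by rewrite -[LHS]h1 -[RHS]h2 ab ac [(a * _)%N]mulnC.
have a0 : (0 < a)%N by apply: leq_ltn_trans xa.
rewrite -aa in ab ac aE x0 xa' *.
have bb : b = b' by apply/eqP; rewrite eq_sym -(eqn_pmul2l a0) ab.
have cc : c = c' by apply/eqP; rewrite eq_sym -(eqn_pmul2l a0) ac.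
rewrite -bb -cc in y0 z0 *.
suff t0 : t = 0.
  rewrite t0 !mul0r !addr0 in x0 y0 z0.
  move: x0 y0 z0 => /eqP + /eqP + /eqP; rewrite !eqr_nat => /eqP -> /eqP -> /eqP ->.
  by [].
(* An integral multiple of a primitive vector has first component divisible by [a], so one below [a]
   is zero. *)
have key X Y Z (u : R) : X%:R = u * a%:R -> Y%:R = u * b%:R -> Z%:R = u * c%:R ->
    (X < a)%N -> u = 0.
  move=> XE YE ZE Xa.
  have XY : (X * b = a * Y)%N.
    by apply/eqP; rewrite -(eqr_nat R) !natrM XE YE; apply/eqP; ring.
  have XZ : (X * c = a * Z)%N.
    by apply/eqP; rewrite -(eqr_nat R) !natrM XE ZE; apply/eqP; ring.
  have : (a %| X)%N.
    have <- : gcdn (X * a) (gcdn (X * b) (X * c)) = X by rewrite -!muln_gcdr g1 muln1.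
    by rewrite !dvdn_gcd dvdn_mull // XY XZ !dvdn_mulr.
  move=> aX; have X0 : X = 0%N.
    apply/eqP; rewrite -leqn0 leqNgt; apply/negP => X0.
    by have := dvdn_leq X0 aX; rewrite leqNgt Xa.
  have := XE; rewrite X0 => /esym/eqP; rewrite mulf_eq0 pnatr_eq0 [a == 0%N]gtn_eqF // orbF.
  by move/eqP.
have sub (i j : nat) (u : R) (d : nat) :
    0 <= u -> i%:R + u * d%:R = j%:R -> (j - i)%:R = u * d%:R.
  move=> u0 ij; rewrite natrB -?ij; first by rewrite addrC addKr.
  by rewrite -(ler_nat R) -ij lerDl mulr_ge0.
have [t0|t0] := leP 0 t.
  apply: (key (x - x') (y - y') (z - z'))%N; [exact: sub|exact: sub|exact: sub|].
  by apply: leq_ltn_trans xa; exact: leq_subr.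
have nt0 : 0 <= - t by rewrite oppr_ge0 ltW.
suff : - t = 0 by move/eqP; rewrite oppr_eq0 => /eqP.
apply: (key (x' - x) (y' - y) (z' - z))%N.
- by apply: sub => //; rewrite -x0; ring.
- by apply: sub => //; rewrite -y0; ring.
- by apply: sub => //; rewrite -z0; ring.
- by apply: leq_ltn_trans xa'; exact: leq_subr.
Qed.

Lemma grid_rich n k : (1 < k)%N -> (k <= n)%N ->
  (n ^ 6 <= (16 * k) ^ 4 * ncard (rich_lines k (grid n)))%N.
Proof.
move=> k1 kn; have fin := rich_lines_finite (grid n) k1.
have k0 : (0 < k)%N by apply: ltnW.
(* Here [n %/ (2 * k)] would be 0, but [k] is comparable to [n] and the [n^2] axis-parallel lines
   suffice. *)
have [nk|nk] := ltnP n (2 * k).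
  have h : (n * n <= ncard (rich_lines k (grid n)))%N.
    rewrite -{1 2}(card_ord n) -card_prod -cardsT.
    apply: (card_le_ncard fin (in2W (@axis_inj n))) => -[x y] _.
    exact: axis_rich.
  apply: leq_trans (_ : (16 * k) ^ 4 * (n * n) <= _)%N; last by rewrite leq_mul.
  rewrite [(n ^ 6)%N](_ : _ = n ^ 4 * (n * n))%N; last by rewrite mulnn -expnD.
  by rewrite leq_mul // leq_exp2r // ltnW // (leq_trans nk) // leq_mul.
(* A run of [k] points with steps of at most [s] spans at most [n / 2], which leaves [m >= n / 2]
   starting values in two coordinates. Together, [s^3 / 4] directions and [(s / 4 + 1) m^2] starts
   give order [n^6 / k^4]. *)
pose s := (n %/ (2 * k))%N; pose m := (n - k * s)%N.
have s0 : (0 < s)%N by rewrite divn_gt0 ?muln_gt0.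
have sk : (s * (2 * k) <= n)%N by exact: leq_divM.
have sk2 : (n < s.+1 * (2 * k))%N by rewrite ltn_ceil // muln_gt0.
have ks : (s + k.-1 * s = k * s)%N by rewrite -mulSn prednK.
have ksn : (s + k.-1 * s < n)%N by rewrite ks; move: sk s0 k0; clear; nia.
have my (y : 'I_m) : (y + k.-1 * s < n)%N.
  have := ltn_ord y; rewrite {2}/m -ks ltn_subRL.
  by apply: leq_ltn_trans; rewrite addnC -addnA leq_addl.
pose A := finset.setX [set v : 'I_s * 'I_s * 'I_s | primitive v && (s %/ 4 <= v.1.1)%N]%SET
  (finset.setT : {set 'I_(s %/ 4).+1 * 'I_m * 'I_m}).
pose f (w : 'I_s * 'I_s * 'I_s * ('I_(s %/ 4).+1 * 'I_m * 'I_m)) :=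
  gline (w.2.1.1 : nat, w.2.1.2 : nat, w.2.2 : nat)
        (w.1.1.1.+1, w.1.1.2.+1, w.1.2.+1).
have h : (#|A| <= ncard (rich_lines k (grid n)))%N.
  apply: (@card_le_ncard _ _ f) => //.
    move=> [[[a b] c] [[x y] z]] [[[a' b'] c'] [[x' y'] z']].
    rewrite !inE /= !andbT => /andP[/eqP g sa] /andP[/eqP g' sa'].
    move=> /(gline_inj g g') H.
    have xa : (x < a.+1)%N by rewrite ltnS (leq_trans _ sa) // -ltnS ltn_ord.
    have xa' : (x' < a'.+1)%N by rewrite ltnS (leq_trans _ sa') // -ltnS ltn_ord.
    have := H xa xa' => -[ex ey ez ea eb ec].
    by congr (_, _, _, (_, _, _)); apply/val_inj.
  move=> [[[a b] c] [[x y] z]] _; apply: gline_rich => //=.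
  - have xs : (x <= s)%N by rewrite (leq_trans _ (leq_div s 4)) // -ltnS.
    by apply: leq_ltn_trans (leq_add xs (leq_mul (leqnn _) (ltn_ord a))) _.
  - by apply: leq_ltn_trans (leq_add (leqnn _) (leq_mul (leqnn _) (ltn_ord b))) _; apply: my.
  - by apply: leq_ltn_trans (leq_add (leqnn _) (leq_mul (leqnn _) (ltn_ord c))) _; apply: my.
apply: leq_trans (leq_mul (leqnn _) h).
rewrite cardsX cardsT !card_prod !card_ord.
have hp := card_primitive_large s; move: hp; set p := #|_| => hp.
have m2 : (n <= 2 * m)%N by rewrite /m; move: sk; clear; nia.
have s4 : (s <= 4 * (s %/ 4).+1)%N by rewrite ltnW // mulnC ltn_ceil.
have ns : (n <= 4 * k * s)%N by move: sk2 s0 k0; clear; nia.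
have e1 : (n ^ 4 <= (4 * k) ^ 4 * (4 * p * (4 * (s %/ 4).+1)))%N.
  apply: leq_trans (_ : (4 * k) ^ 4 * (s ^ 3 * s) <= _)%N.
    by rewrite -expnSr -expnMn leq_exp2r.
  by rewrite leq_mul // leq_mul.
have e2 : (n ^ 2 <= 4 * (m * m))%N.
  by apply: leq_trans (_ : (2 * m) ^ 2 <= _)%N; [rewrite leq_exp2r|rewrite expnMn mulnn].
rewrite [(n ^ 6)%N](_ : _ = n ^ 4 * n ^ 2)%N; last by rewrite -expnD.
apply: leq_trans (leq_mul e1 e2) _.
have -> : ((16 * k) ^ 4 = (4 * k) ^ 4 * (4 * (4 * (4 * 4))))%N.
  by rewrite -[16%N]/(4 * 4)%N -mulnA expnMn mulnC.
move: ((4 * k) ^ 4)%N (s %/ 4).+1 => X Y; clear; lia.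
Qed.

End Grid.

Lemma grid_proper (R : realType) n : proper_up_to 3 (grid R n).
Proof.
pose plane (cj : 'I_3 * 'I_n) : set 'rV[R]_3 := [set x | x 0 cj.1 = cj.2%:R + 2^-1].
have gridP p : p \in grid R n -> forall c : 'I_3, exists i : 'I_n, p 0 c = i%:R.
  move=> /imfsetP[[[x y] z] _ ->] /= c; rewrite /gpt /row3 mxE.
  by case: c => [[|[|[|//]]]] /=; [exists x|exists y|exists z].
exists [fset plane cj | cj in (finset.setT : {set 'I_3 * 'I_n})]%fset; split.
- apply: le_trans (_ : (3 * n)%:R <= _).
    rewrite ler_nat (leq_trans (leq_imfset_card _ _ _)) //.
    have -> : (3 * n)%N = #|(finset.setT : {set 'I_3 * 'I_n})|.
      by rewrite cardsT card_prod !card_ord.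
    by rewrite cardE.
  by rewrite card_grid cbrt_cube natrM.
- move=> _ /imfsetP[[c j] _ ->]; exists (delta_mx 0 c), (j%:R + 2^-1); split.
    apply/eqP => /rowP/(_ c); rewrite !mxE !eqxx /= => /eqP.
    by rewrite oner_eq0.
  rewrite predeqE => x /=; rewrite (bigD1 c) //= mxE !eqxx mul1r big1 ?addr0 //.
  by move=> i ic; rewrite mxE (negPf ic) andbF mul0r.
- move=> _ p /imfsetP[[c j] _ ->] /gridP/(_ c)[i pi] /=.
  rewrite /plane /= pi => /(congr1 (fun r => r * 2)); rewrite mulrDl mulVf //.
  rewrite -!natrM natr1 => /eqP; rewrite eqr_nat => /eqP e.
  by move: e; clear; lia.
move=> x Ux p q pg qg Kp Kq.
set K := connected_component _ x in Kp Kq.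
have Kc : connected K by exact: component_connected.
have KU : K `<=` _ := @connected_component_sub _ _ x.
have step u v (c : 'I_3) :
    u \in grid R n -> v \in grid R n -> K u -> K v -> ~ u 0 c < v 0 c.
  move=> ug vg Ku Kv; have [i ui] := gridP _ ug c; have [j vj] := gridP _ vg c.
  rewrite ui vj ltr_nat => ij.
  (* The projection of a cell is an interval; containing [i] and some [j > i], it would contain
     [i + 1/2], so the cell would meet a cutting plane. *)
  have ci : connected ((fun y : 'rV[R]_3 => y 0 c) @` K).
    apply: connected_continuous_connected => //; apply: continuous_subspaceT.
    exact: coord_continuous.
  have /connected_intervalP := ci.
  move=> /(_ (u 0 c) (v 0 c) _ _ (i%:R + 2^-1)).
  case.
  - by exists u.
  - by exists v.
  - rewrite ui vj; apply/andP; split; first by rewrite lerDl invr_ge0.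
    apply: le_trans (_ : (i.+1)%:R <= _); last by rewrite ler_nat.
    by rewrite -[i.+1%:R]natr1 lerD2l invf_le1 // ler1n.
  move=> w Kw /= wc; apply: (KU w Kw); exists (plane (c, i)) => //=.
  by apply/imfsetP; exists (c, i); rewrite //= inE.
have eq c : p 0 c = q 0 c.
  by case: (ltgtP (p 0 c) (q 0 c)) => // h; [have := step p q c|have := step q p c];
    move=> /(_ _ _ _ _ h); case.
by apply/rowP => c; apply: eq.
Qed.

Lemma ncard_incidences_ge (R : realType) (P : {fset 'rV[R]_3})
    (Ls : {fset set 'rV[R]_3}) r :
  (forall L, L \in Ls -> (r <= #|` [fset p in P | p \in L]%fset|)%N) ->
  (r * #|` Ls| <= ncard (incidences P [set` Ls]))%N.
Proof.
move=> h; rewrite (incidences_fset P Ls).2 cardfE mulnC -sum_nat_const.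
apply: leq_sum => L _; rewrite -card_fset_on_line; apply: h; exact: valP.
Qed.

Lemma sub_fset_card (K : choiceType) (A : {fset K}) M : (M <= #|` A|)%N ->
  exists2 B : {fset K}, {subset B <= A} & #|` B| = M.
Proof.
move=> MA; exists [fset x in take M (enum_fset A)]%fset.
  by move=> x; rewrite inE /= => /mem_take.
by rewrite card_fseq undup_id ?take_uniq ?fset_uniq // size_take_min; apply/minn_idPl.
Qed.

(** Lines through one grid point, enough when the term [M] dominates the bound. *)
Lemma grid_pencil (R : realType) n M : (0 < n)%N -> exists Ls : {fset set 'rV[R]_3},
  [/\ #|` Ls| = M, forall L, L \in Ls -> straight_line L &
    (M <= ncard (incidences (grid R n) [set` Ls]))%N].
Proof.
move=> n0; pose L (i : 'I_M) := @gline R (0, 0, 0)%N (1, i : nat, 0)%N.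
have Linj : injective L.
  move=> i j e; have : L j (gpt R (1, i : nat, 0)%N).
    by rewrite -e; exists 1; rewrite //= scale1r; apply: row3_inj; rewrite !mxE /= add0r.
  move=> [t _ /rowP et]; have := et 0; have := et 1; rewrite !mxE /= !add0r mulr1 => + t1.
  by rewrite t1 mul1r => /eqP; rewrite eqr_nat => /eqP ij; apply/val_inj.
exists [fset L i | i in (finset.setT : {set 'I_M})]%fset.
have cM : #|` [fset L i | i in (finset.setT : {set 'I_M})]%fset| = M.
  by rewrite card_fset_image // cardsT card_ord.
split => //.
  by move=> _ /imfsetP[i _ ->]; apply: gline_straight; rewrite !xpair_eqE.
rewrite -[leqLHS]mul1n -[X in (1 * X <= _)%N]cM.
apply: ncard_incidences_ge => _ /imfsetP[i _ ->].
rewrite cardfs_gt0; apply/fset0Pn; exists (gpt R (0, 0, 0)%N).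
rewrite !inE /=; apply/andP; split; first exact: mem_grid.
by apply/mem_set; exists 0 => //=; rewrite scale0r addr0.
Qed.

Lemma grid_rich_card (R : realType) n k : (1 < k)%N -> (k <= n)%N ->
  ((16 ^+ 4)^-1 : R) * ((n ^ 3)%:R ^+ 2 / k%:R ^+ 4)
    <= (ncard (rich_lines k (grid R n)))%:R.
Proof.
move=> k1 kn; have := grid_rich R k1 kn; rewrite -(ler_nat R) natrM !natrX natrM.
set r := (ncard _)%:R => h.
have k0 : 0 < k%:R :> R by rewrite ltr0n ltnW.
rewrite -exprM mulrA ler_pdivrMr ?exprn_gt0 // mulrC ler_pdivrMr ?exprn_gt0 //.
by apply: le_trans h _; rewrite le_eqVlt; apply/orP; left; apply/eqP; ring.
Qed.

Lemma grid_rich_incidences (R : realType) n k : (1 < k)%N -> (k <= n)%N ->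
  ((16 ^+ 4)^-1 : R) * ((n ^ 3)%:R ^+ 2 / k%:R ^+ 3)
    <= (ncard (incidences (grid R n) (rich_lines k (grid R n))))%:R.
Proof.
move=> k1 kn; have k0 : 0 < k%:R :> R by rewrite ltr0n ltnW.
have -> : (n ^ 3)%:R ^+ 2 / k%:R ^+ 3 = k%:R * ((n ^ 3)%:R ^+ 2 / k%:R ^+ 4) :> R.
  by field; rewrite gt_eqF.
rewrite mulrCA; apply: le_trans (ler_wpM2l (ltW k0) (grid_rich_card R k1 kn)) _.
rewrite -natrM ler_nat; have [E sL rL] := rich_on_line (grid R n) k1.
rewrite -{2}E; apply: ncard_incidences_ge => L LLs.
by have := rL [` LLs]%fset; rewrite -card_fset_on_line.
Qed.

Lemma grid_lines (R : realType) n M : (0 < n)%N -> (0 < M)%N ->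
  exists Ls : {fset set 'rV[R]_3},
    [/\ #|` Ls| = M, forall L, L \in Ls -> straight_line L &
      ((16 ^+ 4)^-1 : R) * Num.min
          (M%:R + (n ^ 3)%:R `^ (1 / 2) * M%:R `^ (3 / 4))
          ((n ^ 3)%:R `^ 3^-1 * M%:R)
        <= (ncard (incidences (grid R n) [set` Ls]))%:R].
Proof.
move=> n0 M0; set c : R := (16 ^+ 4)^-1.
have c64 : c <= 64^-1.
  by rewrite /c lef_pV2 ?posrE ?exprn_gt0 //; lra.
have c0 : 0 < c by rewrite invr_gt0 exprn_gt0.
rewrite cbrt_cube; set B : R := _ + _.
have pM : 0 < M%:R :> R by rewrite ltr0n.
have pn : 0 < n%:R :> R by rewrite ltr0n.
(* For [M <= n^2], axis-parallel lines with [n] points each attain [N^(1/3) M]. *)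
have [Mn|Mn] := leqP M (n * n).
  pose A := [fset @gline R (nat_of_ord xy.1, nat_of_ord xy.2, 0)%N (0, 0, 1)%N
    | xy : 'I_n * 'I_n in (finset.setT : {set 'I_n * 'I_n})]%fset.
  have [Ls LsA LsM] : exists2 Ls : {fset set 'rV[R]_3}, {subset Ls <= A} & #|` Ls| = M.
    apply: sub_fset_card; rewrite card_fset_image; last exact: axis_inj.
    by rewrite cardsT card_prod card_ord.
  have rich L : L \in Ls -> rich_lines n (grid R n) L.
    by move=> /LsA/imfsetP[[x y] _ ->]; apply: axis_rich.
  exists Ls; split => // [L /rich[]//|].
  apply: le_trans (_ : (n * M)%:R <= _).
    rewrite natrM; apply: le_trans (_ : c * (n%:R * M%:R) <= _).
      by rewrite ler_wpM2l ?(ltW c0) // ge_min lexx orbT.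
    by rewrite ler_piMl ?mulr_ge0 //; lra.
  by rewrite ler_nat -LsM; apply: ncard_incidences_ge => L /rich[].
pose A : R := (n ^ 3)%:R `^ (1 / 2); pose q : R := M%:R `^ (1 / 4).
have A0 : 0 < A by rewrite powR_gt0 // ltr0n expn_gt0 n0.
have q0 : 0 < q by rewrite powR_gt0.
have NE : (n ^ 3)%:R = A ^+ 2 by exact: powR_half_sqr.
have ME : M%:R = q ^+ 4 by exact: powR_quarter4.
have q3 : M%:R `^ (3 / 4) = q ^+ 3 by exact: powR_quarter3.
have BE : B = q ^+ 4 + A * q ^+ 3 by rewrite /B -/A q3 -ME.
have minB x : Num.min B x <= B by rewrite ge_min lexx.
(* The richness at which [grid_rich] guarantees [M] lines: [(16 kap)^4 M = n^6]. *)
pose kap := A / (16 * q).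
have kap0 : 0 < kap by rewrite divr_gt0 // mulr_gt0.
have AE : A = 16 * q * kap by rewrite /kap; field; rewrite gt_eqF.
have [k2|k2] := ltP kap 2.
  have [Ls [LsM sL inc]] := grid_pencil R M n0.
  exists Ls; split => //; apply: le_trans (_ : M%:R <= _); last by rewrite ler_nat.
  apply: le_trans (ler_wpM2l (ltW c0) (minB _)) _.
  rewrite BE ME.
  have : A * q ^+ 3 <= 32 * q ^+ 4.
    have -> : A * q ^+ 3 = 16 * kap * q ^+ 4 by rewrite AE; ring.
    by rewrite ler_wpM2r ?exprn_ge0 ?(ltW q0) //; lra.
  have Q0 : 0 < q ^+ 4 by rewrite exprn_gt0.
  move=> h; apply: le_trans (_ : c * (33 * q ^+ 4) <= _).
    by rewrite ler_wpM2l ?(ltW c0) //; lra.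
  by rewrite mulrA ler_piMl ?(ltW Q0) //; lra.
pose k := Num.truncn kap.
have /andP[k_le k_gt] := truncn_itv (ltW kap0); rewrite -/k in k_le k_gt.
have k1 : (1 < k)%N by rewrite -ltnS -(ltr_nat R); apply: le_lt_trans k_gt.
have kk : (16 * k%:R) ^+ 4 * M%:R <= (n ^ 6)%:R :> R.
  have -> : (n ^ 6)%:R = A ^+ 4 :> R by rewrite (expnM n 3 2) natrX NE -exprM.
  rewrite ME -exprMn lerXn2r ?nnegrE ?mulr_ge0 ?(ltW q0) ?(ltW A0) //.
  by rewrite AE mulrAC ler_wpM2l // mulr_ge0 // ltW.
(* Otherwise [M > n^2] would give [(16 k)^4 M > n^6]. *)
have kn : (k <= n)%N.
  rewrite leqNgt; apply/negP => nk.
  have : ((n ^ 6)%:R : R) < (16 * k%:R) ^+ 4 * M%:R.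
    rewrite -(natrM R 16 k) -natrX -natrM ltr_nat.
    apply: leq_trans (_ : (n ^ 4 * (n * n)).+1 <= _)%N.
      by rewrite ltnS mulnn -expnD.
    rewrite ltn_mul // ltn_exp2r //; apply: leq_trans nk _; exact: leq_pmull.
  by rewrite ltNge kk.
have fin := rich_lines_finite (grid R n) k1.
have Mrich : (M <= ncard (rich_lines k (grid R n)))%N.
  have := grid_rich R k1 kn => h.
  rewrite -(leq_pmul2l (_ : 0 < (16 * k) ^ 4)%N) ?expn_gt0 ?muln_gt0 ?(ltnW k1) //.
  apply: leq_trans h; rewrite -(ler_nat R) natrM [((16 * k) ^ 4)%:R]natrX natrM.
  exact: kk.
have [Ls LsA LsM] := sub_fset_card Mrich.
have rich L : L \in Ls -> rich_lines k (grid R n) L.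
  by move=> /LsA; rewrite in_fset_set // => /set_mem.
exists Ls; split => // [L /rich[]//|].
apply: le_trans (_ : (k * M)%:R <= _); last first.
  by rewrite ler_nat -LsM; apply: ncard_incidences_ge => L /rich[].
apply: le_trans (ler_wpM2l (ltW c0) (minB _)) _.
rewrite natrM ME BE.
have Q0 : 0 < q ^+ 4 by rewrite exprn_gt0.
have -> : A * q ^+ 3 = 16 * kap * q ^+ 4 by rewrite AE; ring.
have -> : q ^+ 4 + 16 * kap * q ^+ 4 = (1 + 16 * kap) * q ^+ 4 by ring.
rewrite mulrA ler_wpM2r ?(ltW Q0) //.
have kS : kap < k%:R + 1 by rewrite natr1.
have : 2 <= k%:R :> R by rewrite ler_nat.
move=> k2'; apply: le_trans (_ : 64^-1 * (1 + 16 * kap) <= _).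
  by rewrite ler_wpM2r //; lra.
by lra.
Qed.

Theorem theorem1p3 (R : realType) :
  (forall C : R, 0 < C ->
    [/\ (* (i) *)
        exists2 K : R, 0 < K &
          forall (N : nat) (P : {fset 'rV[R]_3}),
            (1 <= N)%N -> #|` P| = N -> proper_up_to C P ->
          forall k : nat, (2 <= k)%N -> k%:R <= C * (N%:R `^ 3^-1) ->
            finite_set (rich_lines k P) /\
            (ncard (rich_lines k P))%:R <= K * (N%:R ^+ 2 / k%:R ^+ 4),
        (* (ii) *)
        exists2 K : R, 0 < K &
          forall (N : nat) (P : {fset 'rV[R]_3}),
            (1 <= N)%N -> #|` P| = N -> proper_up_to C P ->
          forall k : nat, (2 <= k)%N -> k%:R <= C * (N%:R `^ 3^-1) ->
            finite_set (incidences P (rich_lines k P)) /\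
            (ncard (incidences P (rich_lines k P)))%:R
              <= K * (N%:R ^+ 2 / k%:R ^+ 3)
      & (* (iii) *)
        exists2 K : R, 0 < K &
          forall (N : nat) (P : {fset 'rV[R]_3}),
            (1 <= N)%N -> #|` P| = N -> proper_up_to C P ->
          forall (M : nat) (Ls : {fset set 'rV[R]_3}),
            (1 <= M)%N -> #|` Ls| = M ->
            (forall L, L \in Ls -> straight_line L) ->
          let I : R := (ncard (incidences P [set` Ls]))%:R in
          [/\ finite_set (incidences P [set` Ls]),
              (N%:R ^+ 2 < M%:R :> R -> I <= K * M%:R),
              (N%:R `^ (2 / 3) < M%:R :> R -> M%:R <= N%:R ^+ 2 :> R ->
                 I <= K * (N%:R `^ (1 / 2) * M%:R `^ (3 / 4))),
              (M%:R <= N%:R `^ (2 / 3) :> R -> I <= K * (N%:R `^ 3^-1 * M%:R))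
            & I <= K * Num.min (M%:R + N%:R `^ (1 / 2) * M%:R `^ (3 / 4))
                               (N%:R `^ 3^-1 * M%:R)]])
  /\
  (exists C0 c : R, [/\ 0 < C0, 0 < c &
    forall n N : nat, (1 <= n)%N -> N = (n ^ 3)%N ->
    exists P : {fset 'rV[R]_3},
      [/\ #|` P| = N,
          proper_up_to C0 P,
          (forall k : nat, (2 <= k)%N -> k%:R <= N%:R `^ 3^-1 :> R ->
             c * (N%:R ^+ 2 / k%:R ^+ 4) <= (ncard (rich_lines k P))%:R /\
             c * (N%:R ^+ 2 / k%:R ^+ 3)
               <= (ncard (incidences P (rich_lines k P)))%:R)
        & (forall M : nat, (1 <= M)%N ->
           exists Ls : {fset set 'rV[R]_3},
             [/\ #|` Ls| = M,
                 (forall L, L \in Ls -> straight_line L)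
               & c * Num.min (M%:R + N%:R `^ (1 / 2) * M%:R `^ (3 / 4))
                             (N%:R `^ 3^-1 * M%:R)
                   <= (ncard (incidences P [set` Ls]))%:R])]]).
Proof.
split.
  move=> C C0; split.
  - have [K K0 hK] := card_rich_lines_le C0; exists K => // N P N1 NE prop k k2 _.
    by rewrite -NE; apply: hK.
  - have [K K0 hK] := rich_incidences_finite_le C0; exists K => // N P N1 NE prop k k2 _.
    by rewrite -NE; apply: hK.
  - exact: incidences_regimes.
(* 3 from the [3 n] planes cutting the grid, [16^4] from [grid_rich]. *)
exists 3, (16 ^+ 4)^-1; split => //.
move=> n N n1 ->; exists (grid R n); split.
- exact: card_grid.
- exact: grid_proper.
- move=> k k2 kn; have {}kn : (k <= n)%N.
    rewrite -(ler_nat R); apply: le_trans kn _.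
    by rewrite cbrt_cube.
  by split; [exact: grid_rich_card|exact: grid_rich_incidences].
- by move=> M M1; apply: grid_lines.
Qed.
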